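(* Let $p\in C^{1}([0,\frac{\pi}{2}])$ be such that $p(\varphi)\neq 0$ for all $\varphi\in[0,\frac{\pi}{2}]$, and let $g\in C^{1}([0,1))$ be defined by $g(x)=p(\sin^{-1}x)$. Let $0<\epsilon_1<\epsilon_2<\epsilon_3$ with $\epsilon_1<p(0)<\epsilon_2$, and let $A=\{\rho\in[0,1): g(\rho)\in[0,\epsilon_1]\cup[\epsilon_2,\epsilon_3]\}$. Let $w:[0,1]\times[0,\pi]\to\mathbb{R}$ be a weighting such that $W(r,\rho)=w\left(r,\sin^{-1}(\rho/r)\right)$ and its first order partial derivative with respect to $r$ are continuous on $\{(r,\rho): r\in A,\ \min(A)\le\rho\le r\}$ and $W(\rho,\rho)\neq0$ for $\rho\in A$. Let $f\in C_0^{\infty}(B_{0,\epsilon_1}\cup B_{\epsilon_2,\epsilon_3})$. Then $\mathcal{S}_{w,p}f$ determines the harmonic coefficients $F_{lm}(\rho)$ uniquely for $\rho\in g([0,1))$, for all even $l\in\{2k:k\in\mathbb{N}\}$ and $|m|\le l$. That is, if $f_1,f_2\in C_0^{\infty}(B_{0,\epsilon_1}\cup B_{\epsilon_2,\epsilon_3})$ satisfy $\mathcal{S}_{w,p}f_1=\mathcal{S}_{w,p}f_2$ on $[0,1]\times S^2$, then their harmonic coefficients satisfy $(F_1)_{lm}(\rho)=(F_2)_{lm}(\rho)$ for all $\rho\in g([0,1))$, all even $l\geq 0$ and all $|m|\le l$.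
   Context: Hollow balls: $B_{a,b}=\{x\in\mathbb{R}^3: a<|x|<b\}$. $\mathbb{N}$ includes $0$. $C_0^\infty(\Omega)$ denotes smooth real-valued functions with compact support in $\Omega$ (extended by zero to $\mathbb{R}^3$). Polar form: for $f:\mathbb{R}^3\to\mathbb{R}$ write $F(\rho,\theta,\varphi)=f(\rho\sin\varphi\cos\theta,\rho\sin\varphi\sin\theta,\rho\cos\varphi)$, where $\theta\in[0,2\pi]$ is the azimuth and $\varphi\in[0,\pi]$ the colatitude. Rotations: $h=U(\alpha)V(\beta)\in \mathrm{SO}(3)$, where $U(\alpha)$ and $V(\beta)$ are the rotations about the $x_3$- and $x_2$-axis by angles $\alpha\in[0,2\pi]$, $\beta\in[0,\pi]$ respectively, so that $h(0,0,1)^T=(\sin\beta\cos\alpha,\sin\beta\sin\alpha,\cos\beta)^T$. The pair $(\alpha,\beta)$ is identified with this point of $S^2$. The action is $(h\cdot f)(x)=f(hx)$, and $h\cdot F$ is the polar form of $h\cdot f$. Spherical harmonics: for integers $l\ge0$, $|m|\le l$, $$Y_l^m(\theta,\varphi)=(-1)^m\sqrt{\tfrac{(2l+1)(l-m)!}{4\pi(l+m)!}}\,P_l^m(\cos\varphi)e^{\mathrm{i}m\theta},\quad P_l^m(x)=(-1)^m(1-x^2)^{m/2}\tfrac{\mathrm{d}^m}{\mathrm{d}x^m}P_l(x),$$ with $P_l$ the Legendre polynomial of degree $l$ (and the usual convention $P_l^{-m}=(-1)^m\frac{(l-m)!}{(l+m)!}P_l^m$ for negative orders). They form an orthonormal basis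 of $L^2(S^2)$ with surface measure $\mathrm{d}\tau=\sin\varphi\,\mathrm{d}\theta\,\mathrm{d}\varphi$. The harmonic coefficients of $f$ are $F_{lm}(\rho)=\int_{S^2}F(\rho,\cdot)\bar Y_l^m\,\mathrm{d}\tau$. Symmetric curves: given $p\in C^1([0,\frac\pi2])$, viewed as a curve with polar radius $p(\varphi)$ at colatitude $\varphi$, set $\rho(r,\varphi)=p(\sin^{-1}(r\sin\varphi))$ for $(r,\varphi)\in[0,1]\times[0,\pi]$. Generalized spindle transform: for a weighting $w:[0,1]\times[0,\pi]\to\mathbb{R}$ (with $w(r,\cdot)$ integrable on $[0,\pi]$ for each $r$, so that the integrals make sense), $$\mathcal{S}_{w,p}f(r,\alpha,\beta)=\int_{0}^{2\pi}\int_{0}^{\pi}w(r,\varphi)\rho\sin\varphi\sqrt{\rho^2+\left(\tfrac{\mathrm{d}\rho}{\mathrm{d}\varphi}\right)^2}\,(h\cdot F)(\rho,\theta,\varphi)\Big|_{\rho=\rho(r,\varphi)}\mathrm{d}\varphi\,\mathrm{d}\theta,\qquad h=U(\alpha)V(\beta),$$ for $r\in[0,1]$ and $(\alpha,\beta)\in S^2$.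
   Formalization: Adds that w(r,φ)=W(r, r sin φ) for all φ in [0,π] with r∈A, r sin φ≥min A, i.e. w is symmetric about φ=π/2 there; with the principal sin^{-1} alone the claim fails (w=1 for φ≤π/2, −1 for φ>π/2 gives W=1 but Sf=0 for radial f). *)

(* Defs.v *)
From HB Require Import structures.
From mathcomp Require Import all_boot all_order all_algebra.
From mathcomp Require Import all_classical all_reals all_analysis.
From mathcomp Require Import complex.

Set Implicit Arguments.
Unset Strict Implicit.
Unset Printing Implicit Defensive.

Import Order.TTheory GRing.Theory Num.Theory.
Import numFieldNormedType.Exports.

Local Open Scope classical_set_scope.
Local Open Scope ring_scope.

(* [l] is the derivative of [f] at [x] along [D]: one-sided at the endpoints of
   an interval, and no condition at all at an isolated point of [D]. *)
Definition is_derive_within {R : realType} (D : set R) (f : R -> R) (x l : R) : Prop :=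
  (f y - f x) / (y - x) @[y --> within D x^'] --> l.

Definition C1_on {R : realType} (D : set R) (f : R -> R) : Prop :=
  exists df : R -> R,
    (forall x, D x -> is_derive_within D f x (df x)) /\ {within D, continuous df}.

(* Explicit Euclidean norm: the library norm on matrices is the sup norm. *)
Definition enorm {R : realType} (x : 'cV[R]_3) : R :=
  Num.sqrt (\sum_(i < 3) x i 0 ^+ 2).

Definition hollow_ball {R : realType} (a b : R) : set 'cV[R]_3 :=
  [set x | a < enorm x < b].

Definition iter_partial {R : realType} (s : seq 'I_3) (f : 'cV[R]_3 -> R) : 'cV[R]_3 -> R :=
  foldr (fun i g x => derive g x (delta_mx i 0)) f s.

Definition smooth {R : realType} (f : 'cV[R]_3 -> R) : Prop :=
  forall s : seq 'I_3,
    continuous (iter_partial s f) /\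
    forall (i : 'I_3) (x : 'cV[R]_3), derivable (iter_partial s f) x (delta_mx i 0).

Definition support {R : realType} (f : 'cV[R]_3 -> R) : set 'cV[R]_3 :=
  closure [set x | f x != 0].

(* Elements are the extensions by zero to the whole space. *)
Definition Cc_smooth {R : realType} (Omega : set 'cV[R]_3) : set ('cV[R]_3 -> R) :=
  [set f | [/\ smooth f, compact (support f) & support f `<=` Omega]].

Definition vec3 {R : realType} (x y z : R) : 'cV[R]_3 :=
  \col_i nth 0 [:: x; y; z] i.

Definition polar {R : realType} (f : 'cV[R]_3 -> R) (rho theta phi : R) : R :=
  f (vec3 (rho * sin phi * cos theta) (rho * sin phi * sin theta) (rho * cos phi)).

Definition mx3 {R : realType} (rows : seq (seq R)) : 'M[R]_3 :=
  \matrix_(i, j) nth 0 (nth [::] rows i) j.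

Definition rotU {R : realType} (alpha : R) : 'M[R]_3 :=
  mx3 [:: [:: cos alpha; - sin alpha; 0];
          [:: sin alpha;   cos alpha; 0];
          [:: 0;           0;         1] ].

Definition rotV {R : realType} (beta : R) : 'M[R]_3 :=
  mx3 [:: [:: cos beta;   0; sin beta];
          [:: 0;          1; 0];
          [:: - sin beta; 0; cos beta] ].

Definition rot_act {R : realType} (h : 'M[R]_3) (f : 'cV[R]_3 -> R) : 'cV[R]_3 -> R :=
  fun x => f (h *m x).

(* Rodrigues formula. *)
Definition legendre {R : realType} (l : nat) : {poly R} :=
  ((2 ^ l * l`!)%:R)^-1 *: derivn l (('X ^+ 2 - 1) ^+ l).

Definition assoc_legendre_nat {R : realType} (l m : nat) (x : R) : R :=
  (-1) ^+ m * Num.sqrt (1 - x ^+ 2) ^+ m * (derivn m (legendre l)).[x].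

(* [Negz k] is the order [-(k + 1)]; only [|m| <= l] is meaningful, the natural
   subtraction [l - k.+1] being truncated otherwise. *)
Definition assoc_legendre {R : realType} (l : nat) (m : int) (x : R) : R :=
  match m with
  | Posz k => assoc_legendre_nat l k x
  | Negz k => (-1) ^+ k.+1 * ((l - k.+1)`!%:R / (l + k.+1)`!%:R)
              * assoc_legendre_nat l k.+1 x
  end.

Definition cis {R : realType} (t : R) : R[i] := Complex (cos t) (sin t).

(* For [|m| <= l], [absz (l + m)] and [absz (l - m)] are [l + m] and [l - m]. *)
Definition sph_harm {R : realType} (l : nat) (m : int) (theta phi : R) : R[i] :=
  real_complex R
    ((-1) ^ m
     * Num.sqrt (((2 * l + 1)%:R * (absz (l%:Z - m))`!%:R)
                 / (4 * pi * (absz (l%:Z + m))`!%:R))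
     * assoc_legendre l m (cos phi))
  * cis (m%:~R * theta).

Definition sphere_Rintegral {R : realType} (G : R -> R -> R) : R :=
  \int[@lebesgue_measure R]_(theta in `[0, 2 * pi])
    \int[@lebesgue_measure R]_(phi in `[0, pi]) (G theta phi * sin phi).

Definition sphere_integral {R : realType} (G : R -> R -> R[i]) : R[i] :=
  Complex (sphere_Rintegral (fun theta phi => complex.Re (G theta phi)))
          (sphere_Rintegral (fun theta phi => complex.Im (G theta phi))).

Definition harm_coef {R : realType} (f : 'cV[R]_3 -> R) (l : nat) (m : int) (rho : R) : R[i] :=
  sphere_integral (fun theta phi =>
    real_complex R (polar f rho theta phi) * conjc (sph_harm l m theta phi)).

Definition sym_curve {R : realType} (p : R -> R) (r phi : R) : R :=
  p (asin (r * sin phi)).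

(* For [0 <= r <= 1] and [0 < phi < pi] the derivative of [sym_curve p r]
   involves [p] on [0, pi/2] only, and for [p] of class C^1 there it exists
   except at [r = 1], [phi = pi/2]; the null set of remaining angles does not
   affect the integral. *)
Definition spindle {R : realType} (w : R -> R -> R) (p : R -> R) (f : 'cV[R]_3 -> R)
    (r alpha beta : R) : R :=
  \int[@lebesgue_measure R]_(theta in `[0, 2 * pi])
    \int[@lebesgue_measure R]_(phi in `[0, pi])
      (w r phi * sym_curve p r phi * sin phi
       * Num.sqrt (sym_curve p r phi ^+ 2 + (derive1 (sym_curve p r) phi) ^+ 2)
       * polar (rot_act (rotU alpha *m rotV beta) f) (sym_curve p r phi) theta phi).

Definition curve_fun {R : realType} (p : R -> R) (x : R) : R := p (asin x).

Definition radius_set {R : realType} (p : R -> R) (e1 e2 e3 : R) : set R :=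
  [set x | 0 <= x < 1 /\
           (0 <= curve_fun p x <= e1 \/ e2 <= curve_fun p x <= e3)].

Definition weight_W {R : realType} (w : R -> R -> R) (r rho : R) : R :=
  w r (asin (rho / r)).

(* [inf A] is the minimum of [A] whenever [A] is nonempty and closed in [0, 1);
   when [A] is empty so is this region. *)
Definition weight_region {R : realType} (A : set R) : set (R * R) :=
  [set q | A q.1 /\ inf A <= q.2 <= q.1].

(* As [sin] is two-to-one on [0, pi], [weight_W] represents [w] on the region
   only if [w r] agrees at the two angles having the same sine. *)
Definition represented_by_W {R : realType} (A : set R) (w : R -> R -> R) : Prop :=
  forall r phi : R, 0 <= phi <= pi -> weight_region A (r, r * sin phi) ->
    w r phi = weight_W w r (r * sin phi).

Definition W_C1_in_r {R : realType} (A : set R) (w : R -> R -> R) : Prop :=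
  {within weight_region A, continuous (fun q : R * R => weight_W w q.1 q.2)} /\
  exists dW : R -> R -> R,
    (forall r rho, weight_region A (r, rho) ->
       is_derive_within [set r' | weight_region A (r', rho)]
         (fun r' => weight_W w r' rho) r (dW r rho)) /\
    {within weight_region A, continuous (fun q : R * R => dW q.1 q.2)}.

(* Main.v *)
Require Import Defs.
From HB Require Import structures.
From mathcomp Require Import all_boot all_order all_algebra.
From mathcomp Require Import all_classical all_reals all_analysis.
From mathcomp Require Import measurable_realfun complex.
From mathcomp Require Import ring lra zify.

Import Order.TTheory GRing.Theory Num.Theory.
Import numFieldNormedType.Exports.

Local Open Scope classical_set_scope.
Local Open Scope ring_scope.

Set Implicit Arguments.
Unset Strict Implicit.
Unset Printing Implicit Defensive.

(** The transform is linear, so it suffices to treat [f = f1 - f2], whose transform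
    vanishes.  For fixed [r] and [h = U(alpha) V(beta)], it integrates
    in [phi], against a weight, the means of [f] over the circles of colatitude [phi] about
    the axis [h e3] on the spheres of radius [rho(r, phi)].

    Circle means.  Taking means over the circles of colatitude [phi] commutes with
    rotations, so it multiplies the spherical harmonics of degree [l] by
    [2 pi P_l(cos phi)].  The harmonics used for this are the powers
    [q(xi) = (a.xi)^l] with [a] a null vector of C^3, that is [a.a = 0]: for them the
    identity is explicit ([null_power_circle_mean], where the integrand is, up to a
    factor, [((x + u y)^2 - 1)^l] with [u] on a circle about 0, and the Rodrigues formula
    gives its middle coefficient).  It is carried over to [f] by the self-adjointness of
    circle means ([circle_mean_selfadjoint]), a consequence of the invariance of the measure
    [sin b da db dc] in Euler angles.  Integrating the hypothesis against [q] over the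
    sphere thus gives, for [0 < r < 1] and [g x = p (asin x)],
    [int_0^pi w(r, phi) m(r, phi) P_l(cos phi) c(g(r sin phi)) dphi = 0] where
    [c(rho) = int f(rho xi) q(xi) dxi] and [m] collects the geometric factors
    ([null_moment_equation]).

    Abel equation.  With [y = r sin phi] this is an equation of Abel type for [u = c o g].
    For even [l] the halves [phi < pi/2] and [phi > pi/2] add up, and the kernel does not
    vanish on the diagonal because [P_l(0) != 0], [g > 0] and [W(y, y) != 0].  Integrating
    once more against [r / sqrt(x^2 - r^2)] gives a Volterra equation of the first kind
    with a Lipschitz kernel, and so [u] cannot begin to be nonzero at a point near which
    the kernel is controlled ([abel_local_uniqueness]).  Let [s] be the end of the largest
    interval [[0, s]] on which [u] vanishes.  If [s] were not the end of [[0, 1[], then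
    [g s] would lie in the set of radii met by the supports, which is compact and contained
    in the open set ]0, e1[ U ]e2, e3[; by continuity [[s, s + d]] would be contained in
    [A] for some [d > 0], and [s > 0] as [g 0 = p 0] is in the gap.  This is the region
    where the weight is controlled, so [u] would vanish beyond [s]
    ([radial_uniqueness]).

    Back to harmonics.  Hence [f(rho .)] is orthogonal to [(a.xi)^l] for every null vector
    [a] and every [rho] in the range of [g].  Along the null vectors
    [((s - 1/s)/2, i (s + 1/s)/2, 1)] the powers are Laurent polynomials in [s]
    whose coefficients are the harmonics of all orders [m], and interpolation in [s]
    extracts each of them ([sph_harm_from_null_powers]). *)

(** * Continuity and integration over segments *)

Section ContinuityToolkit.
Context {R : realType} {T U V : topologicalType}.
Implicit Types f g : T -> R.

Lemma cont_pair (f : T -> U) (g : T -> V) : continuous f -> continuous g ->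
  continuous (fun x => (f x, g x)).
Proof. by move=> cf cg x; apply: cvg_pair; [exact: cf|exact: cg]. Qed.

Lemma cont_pairl (u : U) : continuous (@pair U V u).
Proof. by move=> x; apply: cvg_pair; [exact: cvg_cst|exact: cvg_id]. Qed.

Lemma cont_id : continuous (fun x : T => x).
Proof. by move=> x; exact: cvg_id. Qed.

Lemma cont_cst (k : U) : continuous (fun _ : T => k).
Proof. by move=> x; exact: cvg_cst. Qed.

Lemma cont_fst (h : T -> U * V) : continuous h -> continuous (fun x => (h x).1).
Proof.
move=> ch x; apply: (@continuous_comp _ _ _ h fst); first exact: ch.
exact: cvg_fst.
Qed.

Lemma cont_snd (h : T -> U * V) : continuous h -> continuous (fun x => (h x).2).
Proof.
move=> ch x; apply: (@continuous_comp _ _ _ h snd); first exact: ch.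
exact: cvg_snd.
Qed.

Lemma cont_comp (f : T -> U) (g : U -> V) :
  continuous f -> continuous g -> continuous (fun x => g (f x)).
Proof. by move=> cf cg x; apply: (@continuous_comp _ _ _ f g); [exact: cf|exact: cg]. Qed.

Lemma contD f g : continuous f -> continuous g -> continuous (fun x => f x + g x).
Proof. by move=> cf cg x; apply: continuousD; [exact: cf|exact: cg]. Qed.

Lemma contN f : continuous f -> continuous (fun x => - f x).
Proof. by move=> cf x; apply: continuousN; exact: cf. Qed.

Lemma contM f g : continuous f -> continuous g -> continuous (fun x => f x * g x).
Proof. by move=> cf cg x; apply: cvgM; [exact: cf|exact: cg]. Qed.

Lemma contMl (k : R) : continuous (GRing.mul k).
Proof. by move=> x; apply: cvgM; [exact: cvg_cst|exact: cvg_id]. Qed.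

Lemma contDl (k : R) : continuous (GRing.add k).
Proof. by move=> x; apply: (@cvgD _ _ _ _ _ (cst k) id); [exact: cvg_cst|exact: cvg_id]. Qed.

Lemma contX f n : continuous f -> continuous (fun x => f x ^+ n).
Proof.
move=> cf; elim: n => [|n IH].
  by rewrite (_ : (fun _ => _) = fun _ => 1) //; move=> x; exact: cvg_cst.
rewrite (_ : (fun _ => _) = fun x => f x * f x ^+ n); first exact: contM.
by apply/funext => x; rewrite exprS.
Qed.

Lemma cont_sin f : continuous f -> continuous (fun x => sin (f x)).
Proof. by move=> cf x; apply: (@continuous_comp _ _ _ f sin); [exact: cf|exact: continuous_sin]. Qed.

Lemma cont_cos f : continuous f -> continuous (fun x => cos (f x)).
Proof. by move=> cf x; apply: (@continuous_comp _ _ _ f cos); [exact: cf|exact: continuous_cos]. Qed.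

Lemma cont_norm f : continuous f -> continuous (fun x => `|f x|).
Proof. by move=> cf x; apply: (@continuous_comp _ _ _ f (fun y : R => `|y|)); [exact: cf|exact: norm_continuous]. Qed.

Lemma cont_sqrt f : continuous f -> continuous (fun x => Num.sqrt (f x)).
Proof. by move=> cf x; apply: (@continuous_comp _ _ _ f Num.sqrt); [exact: cf|exact: sqrt_continuous]. Qed.

Lemma cont_max f g : continuous f -> continuous g -> continuous (fun x => Num.max (f x) (g x)).
Proof. by move=> cf cg x; apply: continuous_max; [exact: cf|exact: cg]. Qed.

Lemma cont_min f g : continuous f -> continuous g -> continuous (fun x => Num.min (f x) (g x)).
Proof. by move=> cf cg x; apply: continuous_min; [exact: cf|exact: cg]. Qed.

End ContinuityToolkit.
(** The cases [pair a], [GRing.mul k] and [GRing.add k] are there because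
    eta-reduced functions escape the higher-order patterns. *)
Ltac cont := repeat first
  [ assumption
  | lazymatch goal with
    | |- continuous (fun _ => ?k) => exact: cont_cst
    | |- continuous (fun x => x) => exact: cont_id
    | |- continuous fst => exact: (cont_fst cont_id)
    | |- continuous snd => exact: (cont_snd cont_id)
    | |- continuous (fun x => (@?f x).1) => apply: cont_fst
    | |- continuous (fun x => (@?f x).2) => apply: cont_snd
    | |- continuous (pair ?a) => exact: cont_pairl
    | |- continuous (fun x => (@?f x, @?g x)) => apply: cont_pair
    | |- continuous (fun x => (@?f x + @?g x)%R) => apply: contD
    | |- continuous (fun x => (- @?f x)%R) => apply: contN
    | |- continuous (fun x => (@?f x * @?g x)%R) => apply: contM
    | |- continuous (GRing.mul ?k) => exact: contMl
    | |- continuous (GRing.add ?k) => exact: contDl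
    | |- continuous sin => exact: continuous_sin
    | |- continuous cos => exact: continuous_cos
    | |- continuous (fun x => (@?f x ^+ _)%R) => apply: contX
    | |- continuous (fun x => sin (@?f x)) => apply: cont_sin
    | |- continuous (fun x => cos (@?f x)) => apply: cont_cos
    | |- continuous (fun x => Num.sqrt (@?f x)) => apply: cont_sqrt
    | |- continuous (fun x => `|@?f x|) => apply: cont_norm
    | |- continuous (fun x => Num.max (@?f x) (@?g x)) => apply: cont_max
    | |- continuous (fun x => Num.min (@?f x) (@?g x)) => apply: cont_min
    | cK : continuous ?K |- continuous (fun x => ?K (@?f x)) =>
        refine (cont_comp _ cK)
    end ].

Definition Int {R : realType} (a b : R) (f : R -> R) : R :=
  \int[@lebesgue_measure R]_(x in `[a, b]) f x.

Section Integrals.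
Context {R : realType}.
Notation mu := (@lebesgue_measure R).
Implicit Types (a b : R) (f g w : R -> R).

Lemma continuous_integrable a b f :
  continuous f -> mu.-integrable `[a, b] (EFin \o f).
Proof.
move=> cf; apply: continuous_compact_integrable; first exact: segment_compact.
exact: continuous_subspaceT.
Qed.

Lemma eq_Int a b f g :
  (forall x, a <= x <= b -> f x = g x) -> Int a b f = Int a b g.
Proof.
by move=> fg; apply: eq_Rintegral => x /set_mem /=; rewrite in_itv /=; exact: fg.
Qed.

Lemma IntD a b f g : continuous f -> continuous g ->
  Int a b (fun x => f x + g x) = Int a b f + Int a b g.
Proof.
move=> cf cg; apply: RintegralD => //; exact: continuous_integrable.
Qed.

Lemma IntB a b f g : continuous f -> continuous g ->
  Int a b (fun x => f x - g x) = Int a b f - Int a b g.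
Proof.
move=> cf cg; apply: RintegralB => //; exact: continuous_integrable.
Qed.

Lemma IntZ a b k f : continuous f -> Int a b (fun x => k * f x) = k * Int a b f.
Proof. move=> cf; apply: RintegralZl => //; exact: continuous_integrable. Qed.

Lemma Int0 a b : Int a b (fun=> 0) = 0.
Proof. by rewrite /Int /Rintegral integral0. Qed.

Lemma Int_cst a b k : a <= b -> Int a b (fun=> k) = k * (b - a).
Proof.
rewrite le_eqVlt => /predU1P[->|ab].
  by rewrite /Int set_itv1 Rintegral_set1 subrr mulr0.
by rewrite /Int Rintegral_cst //= lebesgue_measure_itv /= lte_fin ab.
Qed.

Lemma Int_le a b f g : continuous f -> continuous g ->
  (forall x, a <= x <= b -> f x <= g x) -> Int a b f <= Int a b g.
Proof.
move=> cf cg fg; apply: le_Rintegral => //; first exact: continuous_integrable.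
exact: continuous_integrable.
Qed.

Lemma Int_norm_le a b f M : a <= b -> continuous f ->
  (forall x, a <= x <= b -> `|f x| <= M) -> `|Int a b f| <= M * (b - a).
Proof.
move=> ab cf fM; rewrite -Int_cst //.
apply: le_trans (_ : Int a b (fun x => `|f x|) <= _).
  apply: le_normr_Rintegral => //; exact: continuous_integrable.
apply: Int_le => //; last by move=> x; exact: cst_continuous.
by move=> x; apply: continuous_comp; [exact: cf|exact: norm_continuous].
Qed.

Lemma Int_FTC a b (F f : R -> R) : a <= b -> continuous f ->
  (forall x : R, is_derive x (1 : R) F (f x)) -> Int a b f = F b - F a.
Proof.
rewrite le_eqVlt => /predU1P[-> _ _|ab cf dF].
  by rewrite /Int set_itv1 Rintegral_set1 subrr.
have cF : continuous F.
  move=> x; apply: differentiable_continuous; apply/derivable1_diffP.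
  by have [] := dF x.
rewrite /Int /Rintegral (@continuous_FTC2 _ f F) //.
- exact: continuous_subspaceT.
- split; first by move=> x _; have [] := dF x.
  + by apply: cvg_at_right_filter; exact: cF.
  + by apply: cvg_at_left_filter; exact: cF.
- by move=> x _; rewrite derive1E; have [] := dF x.
Qed.

Lemma Int_cat a b c f : a <= b <= c -> continuous f ->
  Int a c f = Int a b f + Int b c f.
Proof.
move=> /andP[ab bc] cf.
have itf : mu.-integrable `[a, c] (EFin \o f) by exact: continuous_integrable.
rewrite /Int; have := @Rintegral_itvB R f (BLeft a) (BRight c) b itf.
rewrite !bnd_simp => /(_ ab bc) E.
rewrite [X in _ + X](_ : _ = \int[mu]_(x in `]b, c]) f x); first by rewrite -E; ring.
rewrite [RHS]Rintegral_itv_obnd_cbnd //.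
by apply: integrableS itf => //; apply: subset_itv; rewrite bnd_simp.
Qed.

End Integrals.

(** * Integrals depending on a parameter *)
Section Parametric.
Context {R : realType}.
Notation mu := (@lebesgue_measure R).

(** Compactness of the segment makes the neighbourhood of [t0] independent of [y]. *)
Lemma near_uniform_segment {T : topologicalType} (a b : R) (H : T -> R -> R) :
  continuous (fun z : T * R => H z.1 z.2) ->
  forall (t0 : T) (e : R), 0 < e ->
  \forall t \near t0, forall y, a <= y <= b -> `|H t y - H t0 y| < e.
Proof.
move=> cH t0 e e0.
have cpt : compact (`[a, b] : set R) by exact: segment_compact.
move/compact_near_coveringP : cpt => /(_ T (nbhs t0)
  (fun t y => `|H t y - H t0 y| < e)).
have key : forall y, `[a, b]%classic y ->
    \forall x' \near y & i \near nbhs t0, `|H i x' - H t0 x'| < e.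
  move=> y _; have e20 : 0 < e / 2 by lra.
  have /(@cvgrPdist_lt _ _ _ _ (nbhs_filter _)) /(_ _ e20) := cH (t0, y).
  case => -[A B] [/= At0 By] AB.
  exists (B, A); first by split.
  move=> -[x' i] [/= Bx' Ai].
  have h1 := AB (i, x') (conj Ai Bx').
  have h2 := AB (t0, x') (conj (nbhs_singleton At0) Bx').
  rewrite /= in h1 h2.
  rewrite (_ : _ - _ = (H t0 y - H t0 x') - (H t0 y - H i x')); last by ring.
  by rewrite (le_lt_trans (ler_normB _ _)) // (splitr e) ltrD.
move=> /(_ _ key) h.
near=> t.
have /= ht : `[a, b]%classic `<=` (fun y => `|H t y - H t0 y| < e).
  by near: t; exact: h.
by move=> y yab; apply: ht; rewrite /= in_itv.
Unshelve. all: by end_near. Qed.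

Lemma cont_section {T : topologicalType} (H : T -> R -> R) (t : T) :
  continuous (fun z : T * R => H z.1 z.2) -> continuous (H t).
Proof.
move=> cH; apply: (cont_comp (f := fun y : R => (t, y)) _ cH); cont.
Qed.

Lemma integrable_weight (a b : R) (w h : R -> R) :
  mu.-integrable `[a, b] (EFin \o w) -> continuous h ->
  mu.-integrable `[a, b] (EFin \o (fun y => w y * h y)).
Proof.
move=> iw ch.
have mh : measurable_fun (`[a, b]%classic : set (measurableTypeR R)) h.
  apply: subspace_continuous_measurable_fun => //; exact: continuous_subspaceT.
have bh : [bounded h x | x in `[a, b]%classic].
  have cab : compact (`[a, b] : set R) by exact: segment_compact.
  have /compact_bounded[M [Mr HM]] :=
    continuous_compact (continuous_subspaceT ch) cab.
  by exists M; split => // N MN x xab; apply: (HM N MN); exists x.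
have H : mu.-integrable `[a, b] ((EFin \o w) \* (EFin \o h))%E.
  by apply: integrableMl.
by apply: eq_integrable H.
Qed.

Lemma IntwZ (a b : R) (w h : R -> R) (k : R) :
  mu.-integrable `[a, b] (EFin \o w) -> continuous h ->
  Int a b (fun t => k * (w t * h t)) = k * Int a b (fun t => w t * h t).
Proof. by move=> iw ch; apply: RintegralZl => //; exact: integrable_weight. Qed.

Lemma IntwB (a b : R) (w h k : R -> R) :
  mu.-integrable `[a, b] (EFin \o w) -> continuous h -> continuous k ->
  Int a b (fun t => w t * (h t - k t)) =
  Int a b (fun t => w t * h t) - Int a b (fun t => w t * k t).
Proof.
move=> iw ch ck; rewrite -[RHS]RintegralB //; [|exact: integrable_weight..].
by apply: eq_Int => t _; rewrite mulrBr.
Qed.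

(** The variation of [H] is uniformly small by [near_uniform_segment], and it is
    integrated against a weight of finite L1 norm. *)
Lemma Int_weight_param_cont {T : topologicalType} (a b : R) (w : R -> R)
    (H : T -> R -> R) :
  mu.-integrable `[a, b] (EFin \o w) ->
  continuous (fun z : T * R => H z.1 z.2) ->
  continuous (fun t => Int a b (fun y => w y * H t y)).
Proof.
move=> iw cH t0; apply/cvgrPdist_lt => e e0.
have iaw : mu.-integrable `[a, b] (EFin \o (fun y => `|w y|)).
  by have := integrable_norm iw.
set W := Int a b (fun y => `|w y|).
have W0 : 0 <= W by apply: Rintegral_ge0.
(* [W + 1] in place of [W], which may be zero. *)
have d0 : 0 < e / (W + 1) by apply: divr_gt0 => //; lra.
near=> t.
have ht : forall y, a <= y <= b -> `|H t y - H t0 y| < e / (W + 1).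
  by near: t; exact: near_uniform_segment.
have iH s : mu.-integrable `[a, b] (EFin \o (fun y => w y * H s y)).
  by apply: integrable_weight => //; exact: cont_section cH.
rewrite /Int -RintegralB //; apply: le_lt_trans.
  by apply: le_normr_Rintegral => //; exact: (integrableB _ (iH t0) (iH t)).
apply: (@le_lt_trans _ _ (Int a b (fun y => e / (W + 1) * `|w y|))).
  apply: le_Rintegral => //.
  - by apply: integrable_norm => //; exact: (integrableB _ (iH t0) (iH t)).
  - have := integrableZl _ (e / (W + 1)) iaw => /(_ (measurable_itv _)).
    by apply: eq_integrable => //; move=> y _ /=; rewrite EFinM.
  - move=> y /=; rewrite in_itv /= => yab.
    rewrite -mulrBr normrM mulrC ler_wpM2r //.
    by rewrite distrC ltW // ht.
rewrite /Int RintegralZl // -/(Int a b _) -/W.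
rewrite mulrAC ltr_pdivrMr; last by lra.
by rewrite ltr_pM2l //; lra.
Unshelve. all: by end_near. Qed.

Lemma Int_param_cont {T : topologicalType} (a b : R) (H : T -> R -> R) :
  continuous (fun z : T * R => H z.1 z.2) ->
  continuous (fun t => Int a b (H t)).
Proof.
move=> cH.
have -> : (fun t => Int a b (H t)) = fun t => Int a b (fun y => cst 1 y * H t y).
  by apply/funext => t; congr Int; apply/funext => y; rewrite mul1r.
apply: Int_weight_param_cont => //; apply: continuous_integrable.
by move=> x; exact: cst_continuous.
Qed.

End Parametric.

Ltac contI := repeat first
  [ progress cont
  | lazymatch goal with
    | |- continuous (fun x => Int _ _ _) => apply: Int_param_cont => /=
    end ].

(** * Order of integration *)
Section Fubini.
Context {R : realType}.
Notation mu := (@lebesgue_measure R).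
Notation RR := (measurableTypeR R).

(** The boxes with rational corners contained in [U] are countably many and cover [U];
    so continuous functions are measurable for the product of the Borel sigma-algebras. *)
Lemma open_prod_measurable (U : set (R * R)) :
  open U -> measurable (U : set (RR * RR)).
Proof.
move=> oU.
pose box (q : (rat * rat) * (rat * rat)) : set (RR * RR) :=
  [set z | (z.1 \in `](ratr q.1.1 : R), ratr q.1.2[) /\ (z.2 \in `](ratr q.2.1 : R), ratr q.2.2[)].
pose F q : set (RR * RR) := if `[< box q `<=` U >] then box q else set0.
have mbox q : measurable (box q).
  rewrite (_ : box q = [set` `](ratr q.1.1 : R), ratr q.1.2[] `*` [set` `](ratr q.2.1 : R), ratr q.2.2[]) //.
  exact: measurableX.
rewrite (_ : U = \bigcup_q F q).
  apply: countable_bigcupT_measurable => [|q]; first exact: countableP.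
  by rewrite /F; case: ifP.
apply/seteqP; split => [[x y] Uxy|z [q _]]; last first.
  by rewrite /F; case: ifP => // /asboolP qU; exact: qU.
have [[A B] [/= Ax By] AB] : nbhs (x, y) U by apply: open_nbhs_nbhs.
have [e /= e0 eA] := Ax; have [d /= d0 dB] := By.
have [a] := @rat_in_itvoo R (x - e) x ltac:(lra); rewrite in_itv /= => /andP[a1 a2].
have [b] := @rat_in_itvoo R x (x + e) ltac:(lra); rewrite in_itv /= => /andP[b1 b2].
have [c] := @rat_in_itvoo R (y - d) y ltac:(lra); rewrite in_itv /= => /andP[c1 c2].
have [f] := @rat_in_itvoo R y (y + d) ltac:(lra); rewrite in_itv /= => /andP[f1 f2].
exists ((a, b), (c, f)) => //.
have bU : box ((a, b), (c, f)) `<=` U.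
  move=> [u v] /= []; rewrite !in_itv /= => /andP[u1 u2] /andP[v1 v2].
  apply: AB; split => /=.
    by apply: eA => /=; rewrite ltr_norml; lra.
  by apply: dB => /=; rewrite ltr_norml; lra.
rewrite /F asboolT //.
by rewrite /box /= !in_itv /=; split; lra.
Qed.

Lemma continuous2_measurable (H : R * R -> R) : continuous H ->
  measurable_fun setT (H : RR * RR -> RR).
Proof.
move=> /continuousP cH; apply: (measurability _ (RGenOpens.measurableE R)).
move=> _ [_ [a [b ->] <-]]; rewrite setTI.
by apply: open_prod_measurable; apply: cH; exact: interval_open.
Qed.

(** Fubini's theorem on the plane, the functions being extended by zero outside the
    rectangle: [H] is bounded there and [w] is integrable. *)
Lemma Int_swap_weight (a b c d : R) (w : R -> R) (H : R -> R -> R) :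
  mu.-integrable `[c, d] (EFin \o w) ->
  continuous (fun z : R * R => H z.1 z.2) ->
  Int a b (fun x => Int c d (fun y => w y * H x y)) =
  Int c d (fun y => w y * Int a b (fun x => H x y)).
Proof.
move=> iw cH.
have cHx x : continuous (H x) by exact: cont_section cH.
have cHy y : continuous (H ^~ y).
  apply: (cont_comp (f := fun x : R => (x, y)) _ cH); cont.
have iwH x := integrable_weight iw (cHx x).
pose X : set R := `[a, b]%classic; pose Y : set R := `[c, d]%classic.
pose W := w \_ Y; pose K x := (\1_X x : R).
pose f (z : RR * RR) : \bar R := (W z.2 * (K z.1 * H z.1 z.2))%:E.
have mW : measurable_fun setT (W : RR -> RR).
  apply/(measurable_restrictT w); first exact: measurable_itv.
  by have /measurable_int /measurable_EFinP := iw.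
have mf : measurable_fun setT f.
  apply/measurable_EFinP; apply: measurable_funM.
    by apply: (measurableT_comp mW); exact: measurable_snd.
  apply: measurable_funM; last exact: continuous2_measurable.
  apply: measurableT_comp; last exact: measurable_fst.
  apply: measurable_indic; exact: measurable_itv.
have [M HM] : exists M : R, forall x y : R, a <= x <= b -> c <= y <= d -> `|H x y| <= M.
  have cpt : compact (X `*` Y : set (R * R)).
    by apply: compact_setX; exact: segment_compact.
  have /compact_bounded[M [Mr HM]] := continuous_compact (continuous_subspaceT cH) cpt.
  exists (M + 1) => x y xab ycd; apply: (HM (M + 1)); first by lra.
  by exists (x, y) => //; split => /=; rewrite in_itv.
have innery (x : R) : (\int[mu]_y f (x, y) = (K x * Int c d (fun y => w y * H x y))%R%:E)%E.
  rewrite (_ : (fun y => f (x, y)) = fun y => ((K x)%:E * ((EFin \o (fun y => w y * H x y)%R) \_ Y) y)%E); last first.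
    apply/funext => y; rewrite /f /W /= !patchE; case: ifP => yY.
      by rewrite -EFinM; congr EFin; ring.
    by rewrite mul0r mule0.
  rewrite integralZl //; last first.
    apply/integrable_restrict => //; first exact: measurable_itv. rewrite setTI; exact: iwH.
  rewrite -integral_mkcond EFinM; congr (_ * _)%E.
  by rewrite /Int /Rintegral fineK //; apply: integrable_fin_num => //; exact: iwH.
have innerx (y : R) : (\int[mu]_x f (x, y) = (W y * Int a b (fun x => H x y))%R%:E)%E.
  rewrite (_ : (fun x => f (x, y)) = fun x => ((W y)%:E * ((EFin \o (fun x => H x y)) \_ X) x)%E); last first.
    apply/funext => x; rewrite /f /K /= !patchE indicE; case: ifP => xX.
      by rewrite -EFinM; congr EFin; rewrite mul1r.
    by rewrite mul0r mulr0 mule0.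
  have ic : mu.-integrable `[a, b] (EFin \o (H^~ y)) by exact: continuous_integrable.
  rewrite integralZl //; last by apply/integrable_restrict => //; [exact: measurable_itv|rewrite setTI].
  rewrite -integral_mkcond EFinM; congr (_ * _)%E.
  by rewrite /Int /Rintegral fineK //; exact: integrable_fin_num.
have iaw : mu.-integrable `[c, d] (EFin \o (fun y => `|w y|)).
  by have := integrable_norm iw.
have if_ : (mu \x mu)%E.-integrable setT f.
  apply/integrable12ltyP => //.
  apply: (@le_lt_trans _ _ (\int[mu]_(x in X) (M * Int c d (fun y => `|w y|))%R%:E)%E).
    rewrite [leRHS]integral_mkcond; apply: ge0_le_integral => //.
    - by move=> x _; exact: integral_ge0.
    - apply: (measurable_fun_fubini_tonelli_F (m2 := mu) (abse \o f)) => //=.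
      exact: measurableT_comp.
    - apply: (proj1 (measurable_restrictT _ (measurable_itv _))).
      exact: measurable_cst.
    move=> x _; rewrite patchE; case: ifPn => xX; last first.
      rewrite integral0_eq // => y _; rewrite /f /K indicE (negbTE xX).
      by rewrite mul0r mulr0 abse0.
    have xab : a <= x <= b by move/set_mem : xX; rewrite /X /= in_itv.
    rewrite (_ : (M * _)%R%:E = (\int[mu]_(y in Y) (M * `|w y|)%R%:E)%E); last first.
      rewrite -RintegralZl // /Rintegral fineK //.
      apply: integrable_fin_num => //.
      have := integrableZl _ M iaw => /(_ (measurable_itv _)).
      by apply: eq_integrable.
    rewrite [leRHS]integral_mkcond; apply: ge0_le_integral => //.
    - apply: measurableT_comp => //.
      by apply: (measurableT_comp mf); exact: measurable_pair1.
    - apply: (proj1 (measurable_restrictT _ (measurable_itv _))).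
      apply/measurable_EFinP.
      apply: measurable_funM => //; apply/measurable_EFinP.
      exact: measurable_int iaw.
    move=> y _; rewrite patchE /f /W /K /= patchE indicE xX; case: ifP => yY.
      rewrite lee_fin mul1r normrM mulrC ler_wpM2r //; apply: HM => //.
      by move/set_mem : yY; rewrite /Y /= in_itv.
    by rewrite mul0r normr0.
  rewrite /X integral_cst //= lebesgue_measure_itv /=.
  by case: ifP => _; rewrite ?mule0 // -EFinD -EFinM ltry.
have := Fubini if_.
under eq_integral do rewrite innery.
under [RHS]eq_integral do rewrite innerx.
move=> FE.
rewrite [LHS]/Int /Rintegral [in LHS]integral_mkcond.
rewrite [RHS]/Int /Rintegral [in RHS]integral_mkcond; congr fine.
transitivity (\int[mu]_x (K x * Int c d (fun y => w y * H x y))%R%:E)%E.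
  apply: eq_integral => x _; rewrite patchE /K indicE /X.
  by case: (_ \in _) => /=; rewrite ?mul1r ?mul0r.
rewrite FE; apply: eq_integral => y _; rewrite /W !patchE /Y.
by case: (_ \in _) => /=; rewrite ?mul0r.
Qed.

Lemma Int_swap (a b c d : R) (H : R -> R -> R) :
  continuous (fun z : R * R => H z.1 z.2) ->
  Int a b (fun x => Int c d (fun y => H x y)) =
  Int c d (fun y => Int a b (fun x => H x y)).
Proof.
move=> cH.
have := @Int_swap_weight a b c d (cst 1) H; rewrite /cst /=.
have i1 : mu.-integrable `[c, d] (EFin \o cst (1 : R)).
  by apply: continuous_integrable; exact: cont_cst.
move=> /(_ i1 cH).
under eq_Int do under eq_Int do rewrite mul1r.
by under [RHS]eq_Int do rewrite mul1r.
Qed.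

End Fubini.

(** * Functions of three variables with continuous partial derivatives *)
Section PointwiseDerivatives.
Context {R : realType}.
Implicit Types f g : R -> R.

Lemma derC (x k : R) : is_derive x (1 : R) (fun=> k) 0.
Proof. exact: is_derive_cst. Qed.

Lemma derI (x : R) : is_derive x (1 : R) (fun s => s) 1.
Proof. exact: is_derive_id. Qed.

Lemma derD f g (x df dg : R) :
  is_derive x (1 : R) f df -> is_derive x (1 : R) g dg ->
  is_derive x (1 : R) (fun s => f s + g s) (df + dg).
Proof. by move=> hf hg; exact: is_deriveD. Qed.

Lemma derN f (x df : R) :
  is_derive x (1 : R) f df -> is_derive x (1 : R) (fun s => - f s) (- df).
Proof. by move=> hf; exact: is_deriveN. Qed.

Lemma derM f g (x df dg : R) :
  is_derive x (1 : R) f df -> is_derive x (1 : R) g dg ->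
  is_derive x (1 : R) (fun s => f s * g s) (df * g x + f x * dg).
Proof.
move=> hf hg; have := is_deriveM hf hg; move/is_derive_eq; apply.
by rewrite /GRing.scale /=; ring.
Qed.

Lemma der_comp f (h dh : R -> R) (x df : R) :
  (forall y : R, is_derive y (1 : R) h (dh y)) ->
  is_derive x (1 : R) f df ->
  is_derive x (1 : R) (fun s => h (f s)) (dh (f x) * df).
Proof.
by move=> hh hf; have := @is_derive1_comp _ h f x _ _ (hh (f x)) hf.
Qed.

Lemma der_sin f (x df : R) : is_derive x (1 : R) f df ->
  is_derive x (1 : R) (fun s => sin (f s)) (cos (f x) * df).
Proof. apply: (@der_comp f sin cos); exact: is_derive_sin. Qed.

Lemma der_cos f (x df : R) : is_derive x (1 : R) f df ->
  is_derive x (1 : R) (fun s => cos (f s)) (- sin (f x) * df).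
Proof. apply: (@der_comp f cos (fun y => - sin y)); exact: is_derive_cos. Qed.

End PointwiseDerivatives.

Section ChainRule.
Context {R : realType}.

(** Continuous differentiability in the form in which it is applied: a chain rule
    along every differentiable curve. *)
Definition C1_along_curves (F : R -> R -> R -> R) : Prop :=
  exists F1 F2 F3 : R * R * R -> R,
  [/\ continuous (fun v : R * R * R => F v.1.1 v.1.2 v.2),
      continuous F1, continuous F2, continuous F3 &
      forall (x y z : R -> R) (t dx dy dz : R),
        is_derive t (1 : R) x dx -> is_derive t (1 : R) y dy ->
        is_derive t (1 : R) z dz ->
        is_derive t (1 : R) (fun s => F (x s) (y s) (z s))
          (F1 (x t, y t, z t) * dx + F2 (x t, y t, z t) * dy
           + F3 (x t, y t, z t) * dz)].

Lemma mean_value (f df : R -> R) (a b : R) :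
  (forall x : R, is_derive x (1 : R) f (df x)) ->
  exists c, `|c - a| <= `|b - a| /\ f b - f a = df c * (b - a).
Proof.
move=> fdf.
have cf u v : {within `[u, v], continuous f}.
  apply: derivable_within_continuous => x _; by have [] := fdf x.
have [ab|ba] := leP a b.
  have [c + ->] := MVT_segment ab (fun x _ => fdf x) (cf _ _).
  rewrite in_itv /= => /andP[ac cb]; exists c; split => //.
  by rewrite !ger0_norm ?subr_ge0 // lerB.
have [c + E] := MVT_segment (ltW ba) (fun x _ => fdf x) (cf _ _).
rewrite in_itv /= => /andP[bc ca]; exists c; split.
  by rewrite !ler0_norm ?subr_le0 ?(ltW ba) // lerN2 lerB.
by rewrite -[LHS]opprB E; ring.
Qed.

Lemma is_derive1P (f : R -> R) (t d : R) :
  is_derive t (1 : R) f d <-> h^-1 * (f (h + t) - f t) @[h --> 0^'] --> d.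
Proof.
have E : (fun h : R => h^-1 *: ((f \o shift t) (h *: (1 : R)) - f t)) =
         (fun h => h^-1 * (f (h + t) - f t)).
  by apply/funext => h; rewrite /= /shift /= [h *: _]mulr1.
split => [[+ <-]|fd].
  by rewrite /derivable /derive E.
have lE : 'D_1 f t = d by rewrite /derive E; exact/cvg_lim.
by split => //; rewrite /derivable E; apply/cvg_ex; exists d.
Qed.

Lemma is_derive_cvg (f : R -> R) (t d : R) :
  is_derive t (1 : R) f d -> f (h + t) @[h --> 0^'] --> f t.
Proof.
move=> fd; have cf : {for t, continuous f}.
  by apply: differentiable_continuous; apply/derivable1_diffP; case: fd.
have : f (h + t) @[h --> (0 : R)] --> f t.
  apply: (@cvg_comp _ _ _ (fun h : R => h + t) f _ (nbhs t)); last exact: cf.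
  have c0 : continuous (fun h : R => h + t) by cont.
  by have := c0 0; rewrite /continuous_at add0r.
by apply: cvg_trans; apply: cvg_app; exact: nbhs_dnbhs.
Qed.

(** The increment along a curve is the sum of three increments parallel to the axes,
    and the mean value theorem applies to each of them. *)
Lemma C1_of_partials (F : R -> R -> R -> R) (F1 F2 F3 : R * R * R -> R) :
  continuous (fun v : R * R * R => F v.1.1 v.1.2 v.2) ->
  continuous F1 -> continuous F2 -> continuous F3 ->
  (forall x y z, is_derive x (1 : R) (fun s => F s y z) (F1 (x, y, z))) ->
  (forall x y z, is_derive y (1 : R) (fun s => F x s z) (F2 (x, y, z))) ->
  (forall x y z, is_derive z (1 : R) (fun s => F x y s) (F3 (x, y, z))) ->
  C1_along_curves F.
Proof.
move=> cF c1 c2 c3 d1 d2 d3; exists F1, F2, F3; split => //.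
move=> x y z t dx dy dz [hx dxE] [hy dyE] [hz dzE].
have mv : forall h : R, exists c : R * R * R,
   [/\ `|c.1.1 - x t| <= `|x (h + t) - x t|, `|c.1.2 - y t| <= `|y (h + t) - y t|,
       `|c.2 - z t| <= `|z (h + t) - z t| &
     F (x (h + t)) (y (h + t)) (z (h + t)) - F (x t) (y t) (z t) =
     F1 (c.1.1, y (h + t), z (h + t)) * (x (h + t) - x t) +
     F2 (x t, c.1.2, z (h + t)) * (y (h + t) - y t) +
     F3 (x t, y t, c.2) * (z (h + t) - z t)].
  move=> h.
  have [u [hu eu]] := mean_value (x t) (x (h + t)) (fun s => d1 s (y (h + t)) (z (h + t))).
  have [v [hv ev]] := mean_value (y t) (y (h + t)) (fun s => d2 (x t) s (z (h + t))).
  have [w [hw ew]] := mean_value (z t) (z (h + t)) (fun s => d3 (x t) (y t) s).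
  exists (u, v, w); split => //=.
  by rewrite -eu -ev -ew; ring.
have [c Hc] := choice mv.
pose h' : set_system R := (0 : R)^'.
have cx := is_derive_cvg (DeriveDef hx dxE).
have cy := is_derive_cvg (DeriveDef hy dyE).
have cz := is_derive_cvg (DeriveDef hz dzE).
have sq (k u : R -> R) : k (h + t) @[h --> 0^'] --> k t ->
    (forall h, `|u h - k t| <= `|k (h + t) - k t|) -> u h @[h --> 0^'] --> k t.
  move=> ck uk; apply/cvgrPdist_lt => e e0; near=> h.
  rewrite distrC (le_lt_trans (uk h)) // distrC; near: h.
  by move/cvgrPdist_lt : ck => /(_ _ e0).
have cu := sq x (fun h => (c h).1.1) cx (fun h => ltac:(by case: (Hc h))).
have cv := sq y (fun h => (c h).1.2) cy (fun h => ltac:(by case: (Hc h))).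
have cw := sq z (fun h => (c h).2) cz (fun h => ltac:(by case: (Hc h))).
have comp (G : R * R * R -> R) (u v w : R -> R) : continuous G ->
    u h @[h --> 0^'] --> x t -> v h @[h --> 0^'] --> y t -> w h @[h --> 0^'] --> z t ->
    G (u h, v h, w h) @[h --> 0^'] --> G (x t, y t, z t).
  move=> cG hu hv hw.
  apply: (@cvg_comp _ _ _ (fun h : R => (u h, v h, w h)) G _ (nbhs (x t, y t, z t))); last exact: cG.
  exact: (cvg_pair (cvg_pair hu hv) hw).
apply/is_derive1P.
rewrite (_ : (fun h => _) = fun h =>
   F1 ((c h).1.1, y (h + t), z (h + t)) * (h^-1 * (x (h + t) - x t)) +
   F2 (x t, (c h).1.2, z (h + t)) * (h^-1 * (y (h + t) - y t)) +
   F3 (x t, y t, (c h).2) * (h^-1 * (z (h + t) - z t))); last first.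
  by apply/funext => h; have [_ _ _ ->] := Hc h; ring.
apply: cvgD; first apply: cvgD.
- apply: cvgM; first exact: (comp F1 (fun h => (c h).1.1) (fun h => y (h + t)) (fun h => z (h + t)) c1 cu cy cz).
  exact/is_derive1P/(DeriveDef hx dxE).
- apply: cvgM; first exact: (comp F2 (fun=> x t) (fun h => (c h).1.2) (fun h => z (h + t)) c2 (cvg_cst _) cv cz).
  exact/is_derive1P/(DeriveDef hy dyE).
- apply: cvgM; first exact: (comp F3 (fun=> x t) (fun=> y t) (fun h => (c h).2) c3 (cvg_cst _) (cvg_cst _) cw).
  exact/is_derive1P/(DeriveDef hz dzE).
Unshelve. all: by end_near. Qed.

Lemma C1_cst (k : R) : C1_along_curves (fun _ _ _ => k).
Proof.
exists (fun=> 0), (fun=> 0), (fun=> 0); split; try exact: cont_cst.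
by move=> *; rewrite !mul0r !addr0; exact: is_derive_cst.
Qed.

Lemma C1_linear (a b c : R) : C1_along_curves (fun x y z => a * x + b * y + c * z).
Proof.
exists (fun=> a), (fun=> b), (fun=> c); split; try exact: cont_cst.
  by cont.
move=> x y z t dx dy dz hx hy hz.
by apply: is_deriveD.
Qed.

Lemma C1D (F G : R -> R -> R -> R) : C1_along_curves F -> C1_along_curves G ->
  C1_along_curves (fun x y z => F x y z + G x y z).
Proof.
move=> [F1 [F2 [F3 [cF c1 c2 c3 dF]]]] [G1 [G2 [G3 [cG d1 d2 d3 dG]]]].
exists (fun v => F1 v + G1 v), (fun v => F2 v + G2 v), (fun v => F3 v + G3 v).
split; [by cont..|].
move=> x y z t dx dy dz hx hy hz.
have := is_deriveD (dF _ _ _ _ _ _ _ hx hy hz) (dG _ _ _ _ _ _ _ hx hy hz).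
by move/is_derive_eq; apply; ring.
Qed.

Lemma C1M (F G : R -> R -> R -> R) : C1_along_curves F -> C1_along_curves G ->
  C1_along_curves (fun x y z => F x y z * G x y z).
Proof.
move=> [F1 [F2 [F3 [cF c1 c2 c3 dF]]]] [G1 [G2 [G3 [cG d1 d2 d3 dG]]]].
pose f (v : R * R * R) := F v.1.1 v.1.2 v.2.
pose g (v : R * R * R) := G v.1.1 v.1.2 v.2.
exists (fun v => F1 v * g v + f v * G1 v), (fun v => F2 v * g v + f v * G2 v),
  (fun v => F3 v * g v + f v * G3 v).
split; [by cont..|].
move=> x y z t dx dy dz hx hy hz.
have := is_deriveM (dF _ _ _ _ _ _ _ hx hy hz) (dG _ _ _ _ _ _ _ hx hy hz).
by move/is_derive_eq; apply; rewrite /f /g /= /GRing.scale /=; ring.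
Qed.

Lemma mx_norm_lt m n (M : 'M[R]_(m, n)) (e : R) : 0 < e ->
  (forall i j, `|M i j| < e) -> `|M| < e.
Proof.
move=> e0 Me; have [->|M0] := eqVneq M 0; first by rewrite normr0.
have [|[i j] /= E] := @mx_norm_neq0 _ m n M.
  by apply: contra_neq M0; exact: mx_norm_eq0.
by rewrite [ltLHS]E; exact: Me.
Qed.

Lemma vec3_continuous : continuous (fun v : R * R * R => vec3 v.1.1 v.1.2 v.2).
Proof.
move=> v; apply/cvgrPdist_lt => e e0; near=> u.
have h1 : `|v.1.1 - u.1.1| < e.
  near: u; have cu : continuous (fun u : R * R * R => u.1.1) by cont.
  by have /cvgrPdist_lt /(_ _ e0) := cu v.
have h2 : `|v.1.2 - u.1.2| < e.
  near: u; have cu : continuous (fun u : R * R * R => u.1.2) by cont.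
  by have /cvgrPdist_lt /(_ _ e0) := cu v.
have h3 : `|v.2 - u.2| < e.
  near: u; have cu : continuous (fun u : R * R * R => u.2) by cont.
  by have /cvgrPdist_lt /(_ _ e0) := cu v.
apply: mx_norm_lt => // i j; rewrite !mxE.
by case: i => -[|[|[|//]]] ?.
Unshelve. all: by end_near. Qed.

Lemma smooth_C1 (f : 'cV[R]_3 -> R) : smooth f ->
  C1_along_curves (fun x y z => f (vec3 x y z)).
Proof.
move=> sf.
pose D (i : 'I_3) (v : R * R * R) := derive f (vec3 v.1.1 v.1.2 v.2) (delta_mx i 0).
have cD i : continuous (D i).
  by apply: (cont_comp (f := fun v : R * R * R => vec3 v.1.1 v.1.2 v.2) vec3_continuous (sf [:: i]).1).
have pd (i : 'I_3) (u : R -> 'cV[R]_3) (s : R) :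
    (forall h, u (h + s) = h *: delta_mx i 0 + u s) ->
    is_derive s (1 : R) (fun s => f (u s)) (derive f (u s) (delta_mx i 0)).
  move=> us; have df := (sf [::]).2 i (u s).
  apply/is_derive1P; rewrite /= /derivable in df.
  move: df; rewrite /derive; set l := (X in X @ 0^').
  by rewrite (_ : (fun h => _) = l) //; apply/funext => h; rewrite /l /= us.
apply: (@C1_of_partials _ (D 0) (D 1) (D (Ordinal (isT : 2 < 3)%N))) => //.
- exact: (cont_comp vec3_continuous (sf [::]).1).
- move=> x y z; apply: (pd _ (fun s => vec3 s y z)) => h.
  by apply/colP => -[[|[|[|//]]] ?]; rewrite !mxE /= ?mulr1 ?mulr0 ?add0r.
- move=> x y z; apply: (pd _ (fun s => vec3 x s z)) => h.
  by apply/colP => -[[|[|[|//]]] ?]; rewrite !mxE /= ?mulr1 ?mulr0 ?add0r.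
- move=> x y z; apply: (pd _ (fun s => vec3 x y s)) => h.
  by apply/colP => -[[|[|[|//]]] ?]; rewrite !mxE /= ?mulr1 ?mulr0 ?add0r.
Qed.

End ChainRule.

(** * Rotations in Euler angles and circle means *)
Section EulerInvariance.
Context {R : realType}.
Notation R4 := (R * R * R * R)%type.

(** [euler_x], [euler_y] and [euler_z] are the coordinates of
    [U(a) V(b) U(c) V(t) e3] for [v = (a, b, c, t)]: the point of colatitude [t] and
    azimuth [c] in the frame rotated by [U(a) V(b)]. *)
Definition euler_x (v : R4) : R :=
  cos v.1.1.1 * (cos v.1.1.2 * (sin v.2 * cos v.1.2) + sin v.1.1.2 * cos v.2)
  - sin v.1.1.1 * (sin v.2 * sin v.1.2).
Definition euler_y (v : R4) : R :=
  sin v.1.1.1 * (cos v.1.1.2 * (sin v.2 * cos v.1.2) + sin v.1.1.2 * cos v.2)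
  + cos v.1.1.1 * (sin v.2 * sin v.1.2).
Definition euler_z (v : R4) : R :=
  - sin v.1.1.2 * (sin v.2 * cos v.1.2) + cos v.1.1.2 * cos v.2.

Definition on_rotation (F : R -> R -> R -> R) (v : R4) : R :=
  F (euler_x v) (euler_y v) (euler_z v).

(** The properties used of a function of the form [F (h V(t) e3)],
    [h = U(a) V(b) U(c)].  A variation of [t] is one of [h] along the vector field that
    generates right multiplication by rotations about the second axis; [rf_eq] is the
    expression of this field in Euler angles, multiplied by [sin b] to remove its
    singularity at the poles. *)
Record rotation_function (G Ga Gb Gc Gt : R4 -> R) : Prop := RotationFunction {
  rf_cont : continuous G;
  rf_conta : continuous Ga; rf_contb : continuous Gb;
  rf_contc : continuous Gc; rf_contt : continuous Gt;
  rf_da : forall a b c t, is_derive a (1 : R) (fun s => G (s, b, c, t)) (Ga (a, b, c, t));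
  rf_db : forall a b c t, is_derive b (1 : R) (fun s => G (a, s, c, t)) (Gb (a, b, c, t));
  rf_dc : forall a b c t, is_derive c (1 : R) (fun s => G (a, b, s, t)) (Gc (a, b, c, t));
  rf_dt : forall a b c t, is_derive t (1 : R) (fun s => G (a, b, c, s)) (Gt (a, b, c, t));
  rf_eq : forall v, sin v.1.1.2 * Gt v = sin v.1.1.2 * cos v.1.2 * Gb v
     + sin v.1.2 * Ga v - cos v.1.1.2 * sin v.1.2 * Gc v;
  rf_pera : forall b c t, G (2 * pi, b, c, t) = G (0, b, c, t);
  rf_perc : forall a b t, G (a, b, 2 * pi, t) = G (a, b, 0, t) }.

Lemma rotation_function_mul G Ga Gb Gc Gt H Ha Hb Hc Ht :
  rotation_function G Ga Gb Gc Gt -> rotation_function H Ha Hb Hc Ht ->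
  rotation_function (fun v => G v * H v) (fun v => Ga v * H v + G v * Ha v)
    (fun v => Gb v * H v + G v * Hb v) (fun v => Gc v * H v + G v * Hc v)
    (fun v => Gt v * H v + G v * Ht v).
Proof.
move=> [cG cGa cGb cGc cGt Gda Gdb Gdc Gdt Ge Gpa Gpc].
move=> [cH cHa cHb cHc cHt Hda Hdb Hdc Hdt He Hpa Hpc].
split; [by cont..| | | | | | |].
- move=> a b c t; have := is_deriveM (Gda a b c t) (Hda a b c t).
  by move/is_derive_eq; apply; rewrite /GRing.scale /=; ring.
- move=> a b c t; have := is_deriveM (Gdb a b c t) (Hdb a b c t).
  by move/is_derive_eq; apply; rewrite /GRing.scale /=; ring.
- move=> a b c t; have := is_deriveM (Gdc a b c t) (Hdc a b c t).
  by move/is_derive_eq; apply; rewrite /GRing.scale /=; ring.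
- move=> a b c t; have := is_deriveM (Gdt a b c t) (Hdt a b c t).
  by move/is_derive_eq; apply; rewrite /GRing.scale /=; ring.
- by move=> v; rewrite mulrDr mulrA Ge mulrCA He; ring.
- by move=> b c t; rewrite Gpa Hpa.
- by move=> a b t; rewrite Gpc Hpc.
Qed.

(** The field in [rf_eq] does not depend on [t], so that [t] can be shifted. *)
Lemma rotation_function_shift G Ga Gb Gc Gt (k : R) :
  rotation_function G Ga Gb Gc Gt ->
  rotation_function (fun v => G (v.1, v.2 - k)) (fun v => Ga (v.1, v.2 - k))
    (fun v => Gb (v.1, v.2 - k)) (fun v => Gc (v.1, v.2 - k)) (fun v => Gt (v.1, v.2 - k)).
Proof.
move=> [cG cGa cGb cGc cGt Gda Gdb Gdc Gdt Ge Gpa Gpc].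
have cs : continuous (fun v : R4 => (v.1, v.2 - k)) by cont.
split; [exact: (cont_comp cs)..| | | | | | |].
- by move=> a b c t; exact: (Gda a b c (t - k)).
- by move=> a b c t; exact: (Gdb a b c (t - k)).
- by move=> a b c t; exact: (Gdc a b c (t - k)).
- move=> a b c t /=; have /is_derive1P h := Gdt a b c (t - k).
  apply/is_derive1P; move: h; rewrite (_ : (fun _ => _) = (fun h : R => h^-1 * (G (a, b, c, h + t - k) - G (a, b, c, t - k)))) //.
  by apply/funext => h; rewrite addrA.
- by move=> v; rewrite (Ge (v.1, v.2 - k)).
- by move=> b c t; exact: (Gpa b c (t - k)).
- by move=> a b t; exact: (Gpc a b (t - k)).
Qed.

Lemma on_rotation_function F : C1_along_curves F ->
  exists Ga Gb Gc Gt, rotation_function (on_rotation F) Ga Gb Gc Gt.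
Proof.
move=> [F1 [F2 [F3 [cF c1 c2 c3 dF]]]].
pose e v := (euler_x v, euler_y v, euler_z v).
have ce : continuous e by rewrite /e /euler_x /euler_y /euler_z; cont.
pose D (dx dy dz : R4 -> R) v := F1 (e v) * dx v + F2 (e v) * dy v + F3 (e v) * dz v.
have cD dx dy dz : continuous dx -> continuous dy -> continuous dz -> continuous (D dx dy dz).
  move=> cx cy cz; rewrite /D; apply: contD; first apply: contD.
  - exact: (contM (cont_comp ce c1) cx).
  - exact: (contM (cont_comp ce c2) cy).
  - exact: (contM (cont_comp ce c3) cz).
pose ca v : R := cos (v : R4).1.1.1; pose sa v : R := sin (v : R4).1.1.1.
pose cb v : R := cos (v : R4).1.1.2; pose sb v : R := sin (v : R4).1.1.2.
pose cc v : R := cos (v : R4).1.2; pose sc v : R := sin (v : R4).1.2.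
pose ct v : R := cos (v : R4).2; pose st v : R := sin (v : R4).2.
exists (D (fun v => - euler_y v) euler_x (fun=> 0)),
 (D (fun v => ca v * (- sb v * (st v * cc v) + cb v * ct v))
    (fun v => sa v * (- sb v * (st v * cc v) + cb v * ct v))
    (fun v => - cb v * (st v * cc v) - sb v * ct v)),
 (D (fun v => - ca v * (cb v * (st v * sc v)) - sa v * (st v * cc v))
    (fun v => - sa v * (cb v * (st v * sc v)) + ca v * (st v * cc v))
    (fun v => sb v * (st v * sc v))),
 (D (fun v => ca v * (cb v * (ct v * cc v) - sb v * st v) - sa v * (ct v * sc v))
    (fun v => sa v * (cb v * (ct v * cc v) - sb v * st v) + ca v * (ct v * sc v))
    (fun v => - sb v * (ct v * cc v) - cb v * st v)).
split.
- by apply: (cont_comp ce cF).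
- by apply: cD; rewrite /euler_x /euler_y; cont.
- by apply: cD; rewrite /ca /sa /cb /sb /cc /sc /ct /st; cont.
- by apply: cD; rewrite /ca /sa /cb /sb /cc /sc /ct /st; cont.
- by apply: cD; rewrite /ca /sa /cb /sb /cc /sc /ct /st; cont.
- move=> a b c t; apply: dF; rewrite /euler_x /euler_y /euler_z /=.
  + by apply: is_derive_eq; rewrite /GRing.scale /=; ring.
  + by apply: is_derive_eq; rewrite /GRing.scale /=; ring.
  + exact: is_derive_cst.
- move=> a b c t; apply: dF; rewrite /euler_x /euler_y /euler_z /ca /sa /cb /sb /cc /sc /ct /st /=;
  by apply: is_derive_eq; rewrite /GRing.scale /=; ring.
- move=> a b c t; apply: dF; rewrite /euler_x /euler_y /euler_z /ca /sa /cb /sb /cc /sc /ct /st /=;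
  by apply: is_derive_eq; rewrite /GRing.scale /=; ring.
- move=> a b c t; apply: dF; rewrite /euler_x /euler_y /euler_z /ca /sa /cb /sb /cc /sc /ct /st /=;
  by apply: is_derive_eq; rewrite /GRing.scale /=; ring.
- move=> v; rewrite /D /euler_x /euler_y /euler_z -/(ca v) -/(sa v) -/(cb v) -/(sb v) -/(cc v) -/(sc v) -/(ct v) -/(st v).
  have h1 : cc v ^+ 2 = 1 - sc v ^+ 2 by rewrite -[RHS]cos2sin2.
  have h2 : sb v ^+ 2 = 1 - cb v ^+ 2 by rewrite -[RHS]sin2cos2.
  ring: h1 h2.
- move=> b c t; rewrite /on_rotation /euler_x /euler_y /euler_z /=.
  by rewrite mulr_natl cos2pi sin2pi cos0 sin0.
- move=> b c t; rewrite /on_rotation /euler_x /euler_y /euler_z /=.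
  by rewrite mulr_natl cos2pi sin2pi cos0 sin0.
Qed.

Definition Int4 (t : R) (K : R4 -> R) : R :=
  Int 0 (2 * pi) (fun a => Int 0 pi (fun b => Int 0 (2 * pi) (fun c =>
    Int 0 t (fun s => K (a, b, c, s))))).

Lemma Int4D t (K L : R4 -> R) : continuous K -> continuous L ->
  Int4 t (fun v => K v + L v) = Int4 t K + Int4 t L.
Proof.
move=> cK cL; rewrite /Int4 -IntD; [|by contI|by contI].
apply: eq_Int => a _; rewrite -IntD; [|by contI|by contI].
apply: eq_Int => b _; rewrite -IntD; [|by contI|by contI].
apply: eq_Int => c _; rewrite -IntD; [|by contI|by contI].
by [].
Qed.

Let pi2_ge0 : 0 <= 2 * pi :> R.
Proof. by rewrite mulr_ge0 // pi_ge0. Qed.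

(** In [Int4_exact_c], [Int4_exact_b] and [Int4_exact_a] a divergence integrates to its
    boundary terms, which cancel by periodicity in [c] and [a], and at the poles in
    [b]. *)
Lemma Int4_exact_c t (K L : R4 -> R) : continuous K ->
  (forall a b c s, is_derive c (1 : R) (fun c => L (a, b, c, s)) (K (a, b, c, s))) ->
  (forall a b s, L (a, b, 2 * pi, s) = L (a, b, 0, s)) ->
  Int4 t K = 0.
Proof.
move=> cK dL pL; rewrite /Int4.
rewrite (@eq_Int _ _ _ _ (fun=> 0)) ?Int0 // => a _.
rewrite (@eq_Int _ _ _ _ (fun=> 0)) ?Int0 // => b _.
rewrite Int_swap; last by contI.
rewrite (@eq_Int _ _ _ _ (fun=> 0)) ?Int0 // => s _.
rewrite (@Int_FTC _ _ _ (fun c => L (a, b, c, s))) //; last by contI.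
by rewrite pL subrr.
Qed.

Lemma Int4_exact_b t (K L : R4 -> R) : continuous K ->
  (forall a b c s, is_derive b (1 : R) (fun b => L (a, b, c, s)) (K (a, b, c, s))) ->
  (forall a c s, L (a, pi, c, s) = L (a, 0, c, s)) ->
  Int4 t K = 0.
Proof.
move=> cK dL pL; rewrite /Int4.
rewrite (@eq_Int _ _ _ _ (fun=> 0)) ?Int0 // => a _.
rewrite Int_swap; last by contI.
rewrite (@eq_Int _ _ _ _ (fun=> 0)) ?Int0 // => c _.
rewrite Int_swap; last by contI.
rewrite (@eq_Int _ _ _ _ (fun=> 0)) ?Int0 // => s _.
rewrite (@Int_FTC _ _ _ (fun b => L (a, b, c, s))) //; [|by rewrite pi_ge0|by contI].
by rewrite pL subrr.
Qed.

Lemma Int4_exact_a t (K L : R4 -> R) : continuous K ->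
  (forall a b c s, is_derive a (1 : R) (fun a => L (a, b, c, s)) (K (a, b, c, s))) ->
  (forall b c s, L (2 * pi, b, c, s) = L (0, b, c, s)) ->
  Int4 t K = 0.
Proof.
move=> cK dL pL; rewrite /Int4.
rewrite Int_swap; last by contI.
rewrite (@eq_Int _ _ _ _ (fun=> 0)) ?Int0 // => b _.
rewrite Int_swap; last by contI.
rewrite (@eq_Int _ _ _ _ (fun=> 0)) ?Int0 // => c _.
rewrite Int_swap; last by contI.
rewrite (@eq_Int _ _ _ _ (fun=> 0)) ?Int0 // => s _.
rewrite (@Int_FTC _ _ _ (fun a => L (a, b, c, s))) //; last by contI.
by rewrite pL subrr.
Qed.

(** Invariance of the measure [sin b da db dc] on the rotation group: by [rf_eq],
    [sin b * Gt] is the divergence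
    [d_b (sin b cos c G) + d_a (sin c G) - d_c (cos b sin c G)]. *)
Lemma rotation_integral_invariant G Ga Gb Gc Gt (t : R) :
  rotation_function G Ga Gb Gc Gt -> 0 <= t ->
  Int 0 (2 * pi) (fun a => Int 0 pi (fun b => Int 0 (2 * pi) (fun c =>
    sin b * G (a, b, c, t)))) =
  Int 0 (2 * pi) (fun a => Int 0 pi (fun b => Int 0 (2 * pi) (fun c =>
    sin b * G (a, b, c, 0)))).
Proof.
move=> [cG cGa cGb cGc cGt Gda Gdb Gdc Gdt Ge Gpa Gpc] t0.
apply/eqP; rewrite -subr_eq0; apply/eqP.
transitivity (Int4 t (fun v => sin v.1.1.2 * Gt v)).
  rewrite /Int4 -IntB; [|by contI|by contI].
  apply: eq_Int => a _; rewrite -IntB; [|by contI|by contI].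
  apply: eq_Int => b _; rewrite -IntB; [|by contI|by contI].
  apply: eq_Int => c _.
  rewrite (@Int_FTC _ _ _ (fun s => sin b * G (a, b, c, s))) //; first by contI.
pose Kb v := cos v.1.1.2 * cos v.1.2 * G v + sin v.1.1.2 * cos v.1.2 * Gb v.
pose Ka v := sin v.1.2 * Ga v.
pose Kc v := - (cos v.1.1.2 * cos v.1.2 * G v + cos v.1.1.2 * sin v.1.2 * Gc v).
have cKb : continuous Kb by rewrite /Kb; cont.
have cKa : continuous Ka by rewrite /Ka; cont.
have cKc : continuous Kc by rewrite /Kc; cont.
rewrite (_ : (fun v => _) = (fun v => Kb v + (Ka v + Kc v))); last first.
  by apply/funext => v; rewrite Ge /Kb /Ka /Kc; ring.
rewrite (Int4D _ cKb (contD cKa cKc)) (Int4D _ cKa cKc).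
have -> : Int4 t Kb = 0.
  pose L v := sin v.1.1.2 * cos v.1.2 * G v.
  have dL a b c s : is_derive b (1 : R) (fun b => L (a, b, c, s)) (Kb (a, b, c, s)).
    have := derM (derM (is_derive_sin b) (derC b (cos c))) (Gdb a b c s).
    by move/is_derive_eq; apply; rewrite /Kb /=; ring.
  apply: (Int4_exact_b t cKb dL) => a c s.
  by rewrite /L /= sinpi sin0 !mul0r.
have -> : Int4 t Ka = 0.
  pose L v := sin v.1.2 * G v.
  have dL a b c s : is_derive a (1 : R) (fun a => L (a, b, c, s)) (Ka (a, b, c, s)).
    have := derM (derC a (sin c)) (Gda a b c s).
    by move/is_derive_eq; apply; rewrite /Ka /=; ring.
  by apply: (Int4_exact_a t cKa dL) => b c s; rewrite /L /= Gpa.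
have -> : Int4 t Kc = 0.
  pose L v := - (cos v.1.1.2 * sin v.1.2 * G v).
  have dL a b c s : is_derive c (1 : R) (fun c => L (a, b, c, s)) (Kc (a, b, c, s)).
    have := derN (derM (derM (derC c (cos b)) (is_derive_sin c)) (Gdc a b c s)).
    by move/is_derive_eq; apply; rewrite /Kc /=; ring.
  apply: (Int4_exact_c t cKc dL) => a b s.
  by rewrite /L /= mulr_natl sin2pi sin0 !mulr0 !mul0r.
by rewrite !addr0.
Qed.

(** The integral over [h] of [F (h V(t) e3) q (h V(t - phi) e3)] is the same at
    [t = phi] and at [t = 0]; this moves the circle mean from [F] to [q].  Colatitudes
    [phi] and [- phi] describe the same circle. *)
Theorem circle_mean_selfadjoint (F q : R -> R -> R -> R) (phi : R) :
  C1_along_curves F -> C1_along_curves q -> 0 <= phi ->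
  Int 0 (2 * pi) (fun a => Int 0 pi (fun b => Int 0 (2 * pi) (fun c =>
    sin b * (on_rotation F (a, b, c, phi) * on_rotation q (a, b, c, 0))))) =
  Int 0 (2 * pi) (fun a => Int 0 pi (fun b => Int 0 (2 * pi) (fun c =>
    sin b * (on_rotation F (a, b, c, 0) * on_rotation q (a, b, c, - phi))))).
Proof.
move=> /on_rotation_function[Fa [Fb [Fc [Ft rF]]]].
move=> /on_rotation_function[qa [qb [qc [qt rq]]]] phi0.
have := rotation_integral_invariant
  (rotation_function_mul rF (rotation_function_shift phi rq)) phi0.
by rewrite /= subrr sub0r.
Qed.

End EulerInvariance.

(** * Powers of null linear forms as spherical harmonics *)
Section NullVectors.
Context {R : realType}.
Notation C := (R[i]).
Notation rc := (real_complex R).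
Notation I := (Complex 0 1 : C).

(** The Taylor coefficient of order [k] of [(X^2 - 1)^l].  By the Rodrigues formula it is
    a multiple of [P_l] for [k = l] and of its [m]-th derivative for [k = l + m]. *)
Definition taylor_coef (K : nzRingType) (l k : nat) : {poly K} :=
  (('X ^+ 2 - 1) ^+ l)^`N(k).

Lemma size_X2m1_exp (K : nzRingType) l :
  (size (('X ^+ 2 - 1 : {poly K}) ^+ l) <= (2 * l).+1)%N.
Proof.
elim: l => [|l IH]; first by rewrite expr0 size_poly1.
rewrite exprS; apply: leq_trans (size_polyMleq _ _) _.
have s2 : (size ('X ^+ 2 - 1 : {poly K})%R <= 3)%N.
  apply: leq_trans (size_polyD _ _) _.
  by rewrite size_polyXn size_polyN size_poly1.
have := leq_add s2 IH; move: (size _) (size _) => a b; lia.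
Qed.

(** Since [x^2 + y^2 = 1], the base on the left is [(x + u y)^2 - 1]. *)
Lemma null_power_expansion (K : fieldType) (l : nat) (x y u : K) :
  (2 : K) != 0 -> x ^+ 2 + y ^+ 2 = 1 -> u != 0 ->
  (2 * (u * y) * (x + y * ((u - u^-1) / 2))) ^+ l =
  \sum_(k < (2 * l).+1) (taylor_coef K l k).[x] * (u * y) ^+ k.
Proof.
move=> two0 xy u0.
rewrite -(nderiv_taylor_wide (mulrC _ _) (size_X2m1_exp K l)).
rewrite horner_exp hornerD hornerN hornerXn hornerC.
have -> : (x + u * y) ^+ 2 - 1 = (x + u * y) ^+ 2 - (x ^+ 2 + y ^+ 2) by rewrite xy.
by congr (_ ^+ l); field; rewrite two0 u0.
Qed.

Lemma legendre_taylor l k :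
  (@legendre R l)^`(k) = (2 ^ l * l`!)%:R^-1 *: (taylor_coef R l (l + k) *+ (l + k)`!).
Proof.
by rewrite /legendre derivnZ -nderivn_def addnC /derivn iterD.
Qed.

Lemma legendre0 : @legendre R 0 = 1.
Proof. by rewrite /legendre expr0 derivn0 expn0 fact0 muln1 invr1 scale1r. Qed.

Lemma legendre_middle l : (taylor_coef R l l) = (2 ^ l)%:R *: @legendre R l.
Proof.
have := legendre_taylor l 0; rewrite /= addn0 => ->.
have h2 : ((2 ^ l)%:R : R) != 0 by rewrite pnatr_eq0 -lt0n expn_gt0.
have hf : ((l`!)%:R : R) != 0 by rewrite pnatr_eq0 -lt0n fact_gt0.
rewrite -(scaler_nat l`! (taylor_coef R l l)) !scalerA natrM.
rewrite (_ : _ * _ = (1 : R)) ?scale1r //.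
move: h2 hf; move: (_%:R) (_%:R) => a b h2 hf.
by field; rewrite h2 hf.
Qed.

Lemma taylor_coef_rc l k (x : R) :
  (taylor_coef C l k).[rc x] = rc (taylor_coef R l k).[x].
Proof.
rewrite /taylor_coef.
rewrite (_ : ('X ^+ 2 - 1) ^+ l = map_poly rc (('X ^+ 2 - 1) ^+ l)).
  by rewrite nderivn_map horner_map.
by rewrite rmorphXn rmorphB rmorphXn /= map_polyX rmorph1.
Qed.

Lemma cisE (t : R) : cis t = rc (cos t) + I * rc (sin t).
Proof. by rewrite [LHS]complexE /cis /=. Qed.

Lemma cisD (t s : R) : cis (t + s) = cis t * cis s.
Proof. by rewrite /cis cosD sinD; apply/eqP; rewrite eq_complex /= eqxx /= addrC (mulrC (sin t)). Qed.

Lemma cis0 : cis 0 = 1 :> C.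
Proof. by rewrite /cis cos0 sin0. Qed.

Lemma cis_unit (t : R) : cis t * cis (- t) = 1.
Proof. by rewrite -cisD subrr cis0. Qed.

Lemma cis_neq0 (t : R) : cis t != 0.
Proof.
apply/eqP => h; have /eqP := cis_unit t.
by rewrite h mul0r eq_sym oner_eq0.
Qed.

Lemma cisV (t : R) : (cis t)^-1 = cis (- t).
Proof.
by apply: (mulfI (cis_neq0 t)); rewrite cis_unit mulfV // cis_neq0.
Qed.

Lemma cisX (t : R) n : cis t ^+ n = cis (n%:R * t).
Proof.
elim: n => [|n IH]; first by rewrite expr0 mul0r cis0.
by rewrite exprS IH -cisD -[in RHS]natr1 mulrDl mul1r addrC.
Qed.

(** Continuity and integrals are taken componentwise. *)
Definition contC {T : topologicalType} (f : T -> C) : Prop :=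
  continuous (fun t => complex.Re (f t)) /\ continuous (fun t => complex.Im (f t)).

Definition IntC (a b : R) (f : R -> C) : C :=
  Complex (Int a b (fun t => complex.Re (f t))) (Int a b (fun t => complex.Im (f t))).

Lemma ReD (z w : C) : complex.Re (z + w) = complex.Re z + complex.Re w.
Proof. by case: z w => ? ? [? ?]. Qed.
Lemma ImD (z w : C) : complex.Im (z + w) = complex.Im z + complex.Im w.
Proof. by case: z w => ? ? [? ?]. Qed.
Lemma ReM (z w : C) : complex.Re (z * w) =
  complex.Re z * complex.Re w - complex.Im z * complex.Im w.
Proof. by case: z w => ? ? [? ?]. Qed.
Lemma ImM (z w : C) : complex.Im (z * w) =
  complex.Re z * complex.Im w + complex.Im z * complex.Re w.
Proof. by case: z w => ? ? [? ?]. Qed.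

Lemma Re_rcM (t : R) (z : C) : complex.Re (rc t * z) = t * complex.Re z.
Proof. by case: z => x y; rewrite ReM mul0r subr0. Qed.
Lemma Im_rcM (t : R) (z : C) : complex.Im (rc t * z) = t * complex.Im z.
Proof. by case: z => x y; rewrite ImM mul0r addr0. Qed.

Lemma contC_D {T : topologicalType} (f g : T -> C) : contC f -> contC g -> contC (fun t => f t + g t).
Proof.
move=> [f1 f2] [g1 g2]; split.
  by rewrite (funext (fun t => ReD (f t) (g t))); cont.
by rewrite (funext (fun t => ImD (f t) (g t))); cont.
Qed.

Lemma contC_M {T : topologicalType} (f g : T -> C) : contC f -> contC g -> contC (fun t => f t * g t).
Proof.
move=> [f1 f2] [g1 g2]; split.
  by rewrite (funext (fun t => ReM (f t) (g t))); cont.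
by rewrite (funext (fun t => ImM (f t) (g t))); cont.
Qed.

Lemma contC_cst {T : topologicalType} (k : C) : contC (fun _ : T => k).
Proof. by split; cont. Qed.

Lemma IntC_add a b f g : contC f -> contC g ->
  IntC a b (fun t => f t + g t) = IntC a b f + IntC a b g.
Proof.
move=> [f1 f2] [g1 g2]; rewrite /IntC; apply/eqP; rewrite eq_complex /=.
rewrite -!IntD //; apply/andP; split; apply/eqP/eq_Int => t _.
  by rewrite ReD.
by rewrite ImD.
Qed.

Lemma IntC_mul a b (k : C) f : contC f ->
  IntC a b (fun t => k * f t) = k * IntC a b f.
Proof.
case: k => k1 k2 [f1 f2]; apply/eqP; rewrite eq_complex; apply/andP; split; apply/eqP.
  rewrite ReM /= -!IntZ // -IntB; [|by cont|by cont].
  by apply: eq_Int => t _; rewrite ReM.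
rewrite ImM /= -!IntZ // -IntD; [|by cont|by cont].
by apply: eq_Int => t _; rewrite ImM.
Qed.

Lemma contC_sum {T : topologicalType} n (g : nat -> T -> C) :
  (forall k, contC (g k)) -> contC (fun t => \sum_(k < n) g k t).
Proof.
move=> cg; elim: n => [|n IH].
  rewrite (_ : (fun t => _) = fun=> 0); first exact: contC_cst.
  by apply/funext => t; rewrite big_ord0.
rewrite (_ : (fun t => _) = fun t => (\sum_(k < n) g k t) + g n t); first exact: contC_D.
by apply/funext => t; rewrite big_ord_recr.
Qed.

Lemma IntC_sum a b n (d : nat -> C) (g : nat -> R -> C) :
  (forall k, contC (g k)) ->
  IntC a b (fun t => \sum_(k < n) d k * g k t) = \sum_(k < n) d k * IntC a b (g k).
Proof.
move=> cg; have cdg k : contC (fun t => d k * g k t).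
  by apply: contC_M => //; exact: contC_cst.
elim: n => [|n IH].
  rewrite big_ord0 (_ : (fun t => _) = fun=> 0); last first.
    by apply/funext => t; rewrite big_ord0.
  by rewrite /IntC /= Int0.
rewrite big_ord_recr /= -IH -IntC_mul // -IntC_add //; last exact: (contC_sum _ cdg).
by congr IntC; apply/funext => t; rewrite big_ord_recr.
Qed.

Lemma contC_cis {T : topologicalType} (f : T -> R) : continuous f -> contC (fun t => cis (f t)).
Proof. by move=> cf; split; rewrite /cis /=; cont. Qed.

Lemma IntC_cis (k : int) :
  IntC 0 (2 * pi) (fun t => cis (k%:~R * t)) = if k == 0 then rc (2 * pi) else 0.
Proof.
have p2 : 0 <= 2 * pi :> R by rewrite mulr_ge0 // pi_ge0.
case: eqP => [->|/eqP k0].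
  rewrite (_ : (fun t => _) = fun=> 1); last first.
    by apply/funext => t; rewrite mul0r cis0.
  by rewrite /IntC /= Int_cst // Int0 mul1r subr0.
have kR : (k%:~R : R) != 0 by rewrite intr_eq0.
have c2 : cis (2 * pi) = 1 :> C by rewrite /cis mulr_natl cos2pi sin2pi.
have ck : cis (k%:~R * (2 * pi)) = 1 :> C.
  case: (k) => n; first by rewrite -[_%:~R]/(n%:R) -cisX c2 expr1n.
  by rewrite NegzE rmorphN /= mulNr -cisV -[_%:~R]/(n.+1%:R) -cisX c2 expr1n invr1.
have [ck1 ck2] : cos (k%:~R * (2 * pi)) = 1 :> R /\ sin (k%:~R * (2 * pi)) = 0 :> R.
  by case: ck.
rewrite /IntC /cis /=; congr Complex.
  have d t : is_derive t (1 : R) (fun t => k%:~R^-1 * sin (k%:~R * t)) (cos (k%:~R * t)).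
    have := derM (derC t k%:~R^-1) (der_sin (derM (derC t k%:~R) (derI t))).
    by move/is_derive_eq; apply; rewrite !(mul0r, add0r, mulr1) mulrCA mulVf // mulr1.
  rewrite (Int_FTC p2 _ d); last by cont.
  by rewrite ck2 !mulr0 sin0 mulr0 subrr.
have d t : is_derive t (1 : R) (fun t => - (k%:~R^-1 * cos (k%:~R * t))) (sin (k%:~R * t)).
  have := derN (derM (derC t k%:~R^-1) (der_cos (derM (derC t k%:~R) (derI t)))).
  move/is_derive_eq; apply; rewrite !(mul0r, add0r, mulr1) mulrCA mulVf // mulr1.
  by rewrite opprK.
rewrite (Int_FTC p2 _ d); last by cont.
by rewrite ck1 !mulr0 cos0 subrr.
Qed.

(** Write [b1 cos t + b2 sin t = (A e^(i t) + B e^(- i t)) / 2]; that the vector is null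
    means [A B = - b3^2].  If [b3 != 0], the form is [b3 (x + y (u - 1/u) / 2)] with
    [u = (A / b3) e^(i t)], and in the expansion of its power the middle term alone
    has a nonzero mean. *)
Lemma null_power_circle_mean (l : nat) (b1 b2 b3 : C) (x y : R) :
  x ^+ 2 + y ^+ 2 = 1 -> y != 0 -> b1 ^+ 2 + b2 ^+ 2 + b3 ^+ 2 = 0 ->
  IntC 0 (2 * pi) (fun t =>
    ((b1 * rc (cos t) + b2 * rc (sin t)) * rc y + b3 * rc x) ^+ l) =
  rc (2 * pi * (@legendre R l).[x]) * b3 ^+ l.
Proof.
move=> xy y0 nb.
pose A := b1 - I * b2; pose B := b1 + I * b2.
have ii : I ^+ 2 = -1 by exact: sqr_i.
have two0 : (2 : C) != 0 by rewrite pnatr_eq0.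
have AB : A * B = - b3 ^+ 2.
  have nb' : b3 ^+ 2 = - b1 ^+ 2 - b2 ^+ 2.
    by apply/eqP; rewrite -subr_eq0 -[X in _ == X]nb; apply/eqP; ring.
  by rewrite /A /B nb'; move: ii; move: (I) => i ii; ring: ii.
have bE t : b1 * rc (cos t) + b2 * rc (sin t) = (A * cis t + B * cis (- t)) / 2.
  apply: (mulIf two0); rewrite divfK // !cisE cosN sinN rmorphN /= /A /B.
  by move: ii; move: (I) => i ii; ring: ii.
(* If [b3 = 0], then [A] or [B] vanishes and the form is a multiple of one exponential. *)
have [b30|b30] := eqVneq b3 0.
  have /eqP AB0 : A * B = 0 by rewrite AB b30 expr0n oppr0.
  have [E [e He]] : exists (d : C) (e : int), e != 0 /\ forall t,
     (b1 * rc (cos t) + b2 * rc (sin t)) * rc y + b3 * rc x = d * cis (e%:~R * t).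
    move: AB0; rewrite mulf_eq0 => /orP[] /eqP Z.
      exists (B * rc y / 2), (-1); split => // t.
      by rewrite bE Z b30 rmorphN1 mulN1r; field.
    exists (A * rc y / 2), 1; split => // t.
    by rewrite bE Z b30 rmorph1 mul1r; field.
  rewrite (_ : (fun t => _) = fun t => E ^+ l * cis ((l%:Z * e)%:~R * t)); last first.
    apply/funext => t; rewrite He.2 exprMn cisX; congr (_ * cis _).
    by rewrite rmorphM /= mulrA.
  rewrite IntC_mul; last by apply: contC_cis; cont.
  rewrite IntC_cis mulf_eq0 (negbTE He.1) orbF.
  case: l => [|l] /=; last by rewrite b30 expr0n /= !mulr0.
  by rewrite legendre0 hornerC mulr1 !expr0 mul1r mulr1.
have A0 : A != 0.
  apply: contra_neq b30 => A0; apply/eqP; rewrite -sqrf_eq0 -oppr_eq0 -AB A0 mul0r //.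
have y0' : rc y != 0 by rewrite fmorph_eq0.
pose u t := A / b3 * cis t.
have u0 t : u t != 0 by rewrite mulf_neq0 ?cis_neq0 // mulf_neq0 // invr_neq0.
have xyC : rc x ^+ 2 + rc y ^+ 2 = 1 by rewrite -!rmorphXn -rmorphD /= xy rmorph1.
have E t : (b1 * rc (cos t) + b2 * rc (sin t)) * rc y + b3 * rc x =
    b3 * (rc x + rc y * ((u t - (u t)^-1) / 2)).
  have -> : (u t)^-1 = - (B / b3) * cis (- t).
    rewrite /u invfM invf_div cisV; congr (_ * _).
    have -> : B = - b3 ^+ 2 / A by rewrite -AB (mulrC A) mulfK.
    by field; rewrite A0 b30.
  by rewrite bE /u; field; rewrite ?two0 ?b30.
pose d k := b3 ^+ l / 2 ^+ l * (A / b3) ^+ k / (A / b3) ^+ l * rc y ^+ k / rc y ^+ l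
   * rc (taylor_coef R l k).[x].
rewrite (_ : (fun t => _) = fun t => \sum_(k < (2 * l).+1) d k * cis ((k%:Z - l%:Z)%:~R * t)); last first.
  apply/funext => t; rewrite E exprMn.
  have N0 : (2 * (u t * rc y)) ^+ l != 0 by apply: expf_neq0; apply: mulf_neq0 => //; apply: mulf_neq0.
  apply: (mulfI N0); rewrite mulrCA -exprMn null_power_expansion //.
  rewrite !mulr_sumr; apply: eq_bigr => k _.
  rewrite taylor_coef_rc rmorphB /= mulrBl cisD -cisV -!cisX /d /u !exprMn.
  field.
  apply/and5P; split; apply: expf_neq0; [exact: cis_neq0|exact: y0'| |exact: A0|exact: two0].
  by rewrite invr_eq0; exact: b30.
rewrite (IntC_sum _ _ _ d (g := fun k t => cis ((k%:Z - l%:Z)%:~R * t))); last first.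
  by move=> k; apply: contC_cis; cont.
have ll : (l < (2 * l).+1)%N by lia.
rewrite (bigD1 (Ordinal ll)) //= big1 ?addr0; last first.
  move=> k kl; rewrite IntC_cis subr_eq0 ifF ?mulr0 //.
  apply/negbTE; apply: contra kl; rewrite eqz_nat => /eqP kl.
  by apply/eqP/val_inj.
rewrite IntC_cis subrr eqxx /d legendre_middle hornerZ !rmorphM natrX rmorphXn /=.
rewrite (_ : real_complex R 2%:R = 2); last by rewrite rmorph_nat.
field.
apply/and3P; split; apply: expf_neq0; [exact: y0'| |exact: two0].
by apply: mulf_neq0; [exact: A0|rewrite invr_eq0; exact: b30].
Qed.

Definition dotC (a1 a2 a3 : C) (x y z : R) : C := a1 * rc x + a2 * rc y + a3 * rc z.

Lemma dotC_power_C1 (a1 a2 a3 : C) l :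
  C1_along_curves (fun x y z => complex.Re (dotC a1 a2 a3 x y z ^+ l)) /\
  C1_along_curves (fun x y z => complex.Im (dotC a1 a2 a3 x y z ^+ l)).
Proof.
elim: l => [|l [IHr IHi]]; first by split; [exact: (C1_cst (1 : R))|exact: (C1_cst (0 : R))].
have lr : C1_along_curves (fun x y z => complex.Re (dotC a1 a2 a3 x y z)).
  rewrite (_ : (fun _ => _) = fun x y z => complex.Re a1 * x + complex.Re a2 * y + complex.Re a3 * z).
    exact: C1_linear.
  by do 3 apply/funext => ?; rewrite /dotC !ReD !ReM /= !mulr0 !subr0.
have li : C1_along_curves (fun x y z => complex.Im (dotC a1 a2 a3 x y z)).
  rewrite (_ : (fun _ => _) = fun x y z => complex.Im a1 * x + complex.Im a2 * y + complex.Im a3 * z).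
    exact: C1_linear.
  by do 3 apply/funext => ?; rewrite /dotC !ImD !ImM /= !mulr0 !add0r.
split.
  rewrite (_ : (fun _ => _) = fun x y z =>
     complex.Re (dotC a1 a2 a3 x y z) * complex.Re (dotC a1 a2 a3 x y z ^+ l)
     + - 1 * (complex.Im (dotC a1 a2 a3 x y z) * complex.Im (dotC a1 a2 a3 x y z ^+ l))).
    by apply: C1D; [exact: C1M|apply: C1M; [exact: C1_cst|exact: C1M]].
  by do 3 apply/funext => ?; rewrite exprS ReM mulN1r.
rewrite (_ : (fun _ => _) = fun x y z =>
   complex.Re (dotC a1 a2 a3 x y z) * complex.Im (dotC a1 a2 a3 x y z ^+ l)
   + complex.Im (dotC a1 a2 a3 x y z) * complex.Re (dotC a1 a2 a3 x y z ^+ l)).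
  by apply: C1D; exact: C1M.
by do 3 apply/funext => ?; rewrite exprS ImM.
Qed.

(** The components [b1], [b2], [b3] of a null vector in the rotated frame form a null
    vector, whose third component is the value of the form on the axis. *)
Lemma null_power_rotated_mean (a1 a2 a3 : C) l (a b phi : R) :
  a1 ^+ 2 + a2 ^+ 2 + a3 ^+ 2 = 0 -> sin phi != 0 ->
  IntC 0 (2 * pi) (fun c => dotC a1 a2 a3 (euler_x (a, b, c, phi))
     (euler_y (a, b, c, phi)) (euler_z (a, b, c, phi)) ^+ l) =
  rc (2 * pi * (@legendre R l).[cos phi]) *
    dotC a1 a2 a3 (sin b * cos a) (sin b * sin a) (cos b) ^+ l.
Proof.
move=> nl sphi.
pose b1 := a1 * rc (cos a * cos b) + a2 * rc (sin a * cos b) - a3 * rc (sin b).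
pose b2 := - a1 * rc (sin a) + a2 * rc (cos a).
pose b3 := dotC a1 a2 a3 (sin b * cos a) (sin b * sin a) (cos b).
have nb : b1 ^+ 2 + b2 ^+ 2 + b3 ^+ 2 = 0.
  have h1 : rc (cos a) ^+ 2 = 1 - rc (sin a) ^+ 2.
    by rewrite -!rmorphXn /= cos2sin2 rmorphB rmorph1.
  have h2 : rc (cos b) ^+ 2 = 1 - rc (sin b) ^+ 2.
    by rewrite -!rmorphXn /= cos2sin2 rmorphB rmorph1.
  have h3 : a3 ^+ 2 = - a1 ^+ 2 - a2 ^+ 2.
    by apply/eqP; rewrite -subr_eq0 -[X in _ == X]nl; apply/eqP; ring.
  rewrite /b1 /b2 /b3 /dotC !rmorphM /=.
  by ring: h1 h2 h3.
rewrite -[_ ^+ l]/(b3 ^+ l) -(null_power_circle_mean l (cos2Dsin2 phi) sphi nb).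
congr IntC; apply/funext => c; congr (_ ^+ l).
rewrite /dotC /b1 /b2 /b3 /dotC /euler_x /euler_y /euler_z.
rewrite ![fst _]/= ![snd _]/= !(rmorphD, rmorphB, rmorphM, rmorphN).
by ring.
Qed.

(** [sphC] and [sph] integrate over the sphere in azimuth [a] and colatitude [b]. *)
Definition sphC (G : R -> R -> C) : C :=
  IntC 0 (2 * pi) (fun a => IntC 0 pi (fun b => rc (sin b) * G a b)).

Definition sph (G : R -> R -> R) : R :=
  Int 0 (2 * pi) (fun a => Int 0 pi (fun b => sin b * G a b)).

Lemma sphCE G : sphC G = Complex (sph (fun a b => complex.Re (G a b))) (sph (fun a b => complex.Im (G a b))).
Proof.
have e1 a : IntC 0 pi (fun b => rc (sin b) * G a b) =
    Complex (Int 0 pi (fun b => sin b * complex.Re (G a b)))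
            (Int 0 pi (fun b => sin b * complex.Im (G a b))).
  rewrite /IntC; congr Complex; apply: eq_Int => b _.
    exact: Re_rcM.
  exact: Im_rcM.
by rewrite /sphC (funext e1).
Qed.

Definition on_sphere (F : R -> R -> R -> R) (a b : R) : R :=
  F (sin b * cos a) (sin b * sin a) (cos b).

Lemma on_rotation0 F a b c : on_rotation F (a, b, c, 0) = on_sphere F a b.
Proof.
rewrite /on_rotation /on_sphere /euler_x /euler_y /euler_z /= sin0 cos0.
by congr F; ring.
Qed.

Lemma on_rotation_continuous (F : R -> R -> R -> R) : C1_along_curves F -> continuous (on_rotation F).
Proof. by move=> /on_rotation_function[? [? [? [? []]]]]. Qed.

Lemma sphC_rcM (K : R -> R -> R) (q : R -> R -> C) :
  sphC (fun a b => rc (K a b) * q a b) =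
  Complex (sph (fun a b => K a b * complex.Re (q a b)))
          (sph (fun a b => K a b * complex.Im (q a b))).
Proof.
have e1 : (fun a b => complex.Re (rc (K a b) * q a b)) = fun a b => K a b * complex.Re (q a b).
  by apply/funext => a; apply/funext => b; exact: Re_rcM.
have e2 : (fun a b => complex.Im (rc (K a b) * q a b)) = fun a b => K a b * complex.Im (q a b).
  by apply/funext => a; apply/funext => b; exact: Im_rcM.
by rewrite sphCE e1 e2.
Qed.

(** The eigenvalue [2 pi P_l(cos phi)] of the circle mean on powers of null forms passes
    from these to [F] by self-adjointness. *)
Lemma circle_mean_null_power (F : R -> R -> R -> R) (a1 a2 a3 : C) l (phi : R) :
  C1_along_curves F -> a1 ^+ 2 + a2 ^+ 2 + a3 ^+ 2 = 0 -> 0 < phi < pi ->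
  sphC (fun a b => rc (Int 0 (2 * pi) (fun c => on_rotation F (a, b, c, phi)))
      * dotC a1 a2 a3 (sin b * cos a) (sin b * sin a) (cos b) ^+ l) =
  rc (2 * pi * (@legendre R l).[cos phi]) *
  sphC (fun a b => rc (on_sphere F a b)
      * dotC a1 a2 a3 (sin b * cos a) (sin b * sin a) (cos b) ^+ l).
Proof.
move=> F1 nl phi0.
have sphi : 0 < sin phi by apply: sin_gt0_pi.
have sphi' : sin (- phi) != 0 by rewrite sinN oppr_eq0 gt_eqF.
have [cr ci] := dotC_power_C1 a1 a2 a3 l.
have mean a b : IntC 0 (2 * pi) (fun c => dotC a1 a2 a3 (euler_x (a, b, c, - phi))
     (euler_y (a, b, c, - phi)) (euler_z (a, b, c, - phi)) ^+ l) =
  rc (2 * pi * (@legendre R l).[cos phi]) *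
    dotC a1 a2 a3 (sin b * cos a) (sin b * sin a) (cos b) ^+ l.
  by rewrite null_power_rotated_mean // cosN.
have key (q : R -> R -> R -> R) : C1_along_curves q ->
   (forall a b, Int 0 (2 * pi) (fun c => on_rotation q (a, b, c, - phi)) =
      2 * pi * (@legendre R l).[cos phi] * on_sphere q a b) ->
   sph (fun a b => Int 0 (2 * pi) (fun c => on_rotation F (a, b, c, phi)) * on_sphere q a b) =
   2 * pi * (@legendre R l).[cos phi] * sph (fun a b => on_sphere F a b * on_sphere q a b).
  move=> q1 qm.
  have cF := on_rotation_continuous F1; have cq := on_rotation_continuous q1.
  have csq : continuous (fun z : R * R => on_sphere q z.1 z.2).
    rewrite (_ : (fun z => _) = fun z : R * R => on_rotation q (z.1, z.2, 0, 0)); first by cont.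
    by apply/funext => z; rewrite on_rotation0.
  have csF : continuous (fun z : R * R => on_sphere F z.1 z.2).
    rewrite (_ : (fun z => _) = fun z : R * R => on_rotation F (z.1, z.2, 0, 0)); first by cont.
    by apply/funext => z; rewrite on_rotation0.
  have csq1 a : continuous (on_sphere q a) by exact: (@cont_section _ _ (on_sphere q)).
  have csF1 a : continuous (on_sphere F a) by exact: (@cont_section _ _ (on_sphere F)).
  have := circle_mean_selfadjoint F1 q1 (ltW (andP phi0).1).
  move=> E; transitivity (Int 0 (2 * pi) (fun a => Int 0 pi (fun b => Int 0 (2 * pi) (fun c =>
    sin b * (on_rotation F (a, b, c, phi) * on_rotation q (a, b, c, 0)))))).
    apply: eq_Int => a _; apply: eq_Int => b _.
    rewrite [RHS](eq_Int (g := fun c => (sin b * on_sphere q a b) * on_rotation F (a, b, c, phi))).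
      by rewrite IntZ; [ring|contI].
    by move=> c _; rewrite on_rotation0; ring.
  rewrite E /sph -IntZ; last first.
    by apply: Int_param_cont; apply: contM; [cont|apply: contM].
  apply: eq_Int => a _; rewrite -IntZ; last first.
    by apply: contM; [exact: continuous_sin|apply: contM; [exact: csF1|exact: csq1]].
  apply: eq_Int => b _.
  rewrite (eq_Int (g := fun c => (sin b * on_sphere F a b) * on_rotation q (a, b, c, - phi))).
    by rewrite IntZ ?qm; [ring|contI].
  by move=> c _; rewrite on_rotation0; ring.
have hr := key _ cr (fun a b => etrans (congr1 (@complex.Re R) (mean a b)) (Re_rcM _ _)).
have hi := key _ ci (fun a b => etrans (congr1 (@complex.Im R) (mean a b)) (Im_rcM _ _)).
rewrite !sphC_rcM hr hi [RHS]complexE Re_rcM Im_rcM [LHS]complexE.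
by [].
Qed.

(** The inverse of a Vandermonde matrix. *)
Lemma polynomial_coef_from_values (n : nat) (k : 'I_n) :
  exists lam : 'I_n -> C, forall c : 'I_n -> C,
    c k = \sum_(j < n) lam j * (\sum_(i < n) c i * rc (j.+1%:R) ^+ i).
Proof.
pose a := (\row_(j < n) rc (j.+1%:R) : 'rV[C]_n).
pose V := Vandermonde n a.
have Vu : V \in unitmx.
  rewrite unitmxE det_Vandermonde unitfE.
  apply/prodf_neq0 => i _; apply/prodf_neq0 => j ij.
  rewrite !mxE subr_eq0 (inj_eq (@complexI R)) eqr_nat eqSS.
  by rewrite neq_ltn ij orbT.
exists (fun j => invmx V j k) => c.
pose cr := (\row_i c i : 'rV[C]_n).
have : cr *m V *m invmx V = cr by rewrite mulmxK.
move=> /matrixP /(_ 0 k); rewrite [in RHS]mxE => <-.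
rewrite mxE; apply: eq_bigr => j _; rewrite mulrC; congr (_ * _).
by rewrite mxE; apply: eq_bigr => i _; rewrite !mxE.
Qed.

(** The linear forms of the vectors [(null1 s, null2 s, 1)], [s != 0], have [l]-th powers
    that span the harmonics of degree [l]. *)
Definition null1 (s : R) : C := (rc s - rc s^-1) / 2.
Definition null2 (s : R) : C := I * (rc s + rc s^-1) / 2.

Lemma null12 (s : R) : s != 0 -> null1 s ^+ 2 + null2 s ^+ 2 + 1 ^+ 2 = 0.
Proof.
move=> s0; rewrite /null1 /null2 fmorphV /=.
have : rc s != 0 by rewrite fmorph_eq0.
have := @sqr_i R; move: (I) (rc s) => i z ii z0.
have two0 : (2 : C) != 0 by rewrite pnatr_eq0.
have -> : (i * (z + z^-1) / 2) ^+ 2 = i ^+ 2 * ((z + z^-1) / 2) ^+ 2 by ring.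
by rewrite ii; field; rewrite z0 ?two0.
Qed.

Lemma dotC_null (s a b : R) : s != 0 ->
  dotC (null1 s) (null2 s) 1 (sin b * cos a) (sin b * sin a) (cos b) =
  rc (cos b) + rc (sin b) * ((rc s * cis a - (rc s * cis a)^-1) / 2).
Proof.
move=> s0; rewrite /dotC /null1 /null2 invfM cisV !cisE cosN sinN rmorphN fmorphV !rmorphM /=.
have := @sqr_i R; move: (I) => i ii.
by ring: ii.
Qed.

(** By [null_power_expansion] at [u = s e^(i a)], [s^l] times the power of the form is a
    polynomial of degree [2 l] in [s] whose coefficient of order [l + m] is a multiple of
    the function on the left; it is recovered from the values at [s = 1, ..., 2 l + 1].
    The case [sin b = 0] is left out because the expansion divides by [sin b]. *)
Lemma sph_harm_from_null_powers (l m : nat) : (m <= l)%N ->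
  exists mu : 'I_(2 * l).+1 -> C, forall a b : R, sin b != 0 ->
  rc (sin b ^+ m * (derivn m (@legendre R l)).[cos b]) * cis (m%:R * a) =
  \sum_(j < (2 * l).+1) mu j *
     dotC (null1 (j.+1%:R)) (null2 (j.+1%:R)) 1 (sin b * cos a) (sin b * sin a) (cos b) ^+ l.
Proof.
move=> ml; have lml : (l + m < (2 * l).+1)%N by lia.
have [lam Hlam] := polynomial_coef_from_values (Ordinal lml).
exists (fun j => rc ((l + m)`!%:R / l`!%:R) * lam j * rc (j.+1%:R) ^+ l) => a b sb.
have y0 : rc (sin b) != 0 by rewrite fmorph_eq0.
have two0 : (2 : C) != 0 by rewrite pnatr_eq0.
have z0 := cis_neq0 a.
have xyC : rc (cos b) ^+ 2 + rc (sin b) ^+ 2 = 1.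
  by rewrite -!rmorphXn -rmorphD /= cos2Dsin2 rmorph1.
pose c (k : 'I_(2 * l).+1) : C :=
   rc (taylor_coef R l k).[cos b] * (cis a * rc (sin b)) ^+ k / (2 * cis a * rc (sin b)) ^+ l.
have valE (j : 'I_(2 * l).+1) : \sum_(i < (2 * l).+1) c i * rc (j.+1%:R) ^+ i =
   rc (j.+1%:R) ^+ l * dotC (null1 (j.+1%:R)) (null2 (j.+1%:R)) 1
     (sin b * cos a) (sin b * sin a) (cos b) ^+ l.
  have j0 : (j.+1%:R : R) != 0 by rewrite pnatr_eq0.
  have j0' : rc (j.+1%:R : R) != 0 by rewrite fmorph_eq0.
  have u0 : rc (j.+1%:R) * cis a != 0 by apply: mulf_neq0.
  rewrite dotC_null //.
  have N0 : (2 * cis a * rc (sin b)) ^+ l != 0.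
    by apply: expf_neq0; apply: mulf_neq0 => //; apply: mulf_neq0.
  apply: (mulfI N0); rewrite -!exprMn.
  rewrite [RHS](_ : _ = (2 * (rc j.+1%:R * cis a * rc (sin b)) * (rc (cos b) +
     rc (sin b) * ((rc j.+1%:R * cis a - (rc j.+1%:R * cis a)^-1) / 2))) ^+ l); last first.
    by congr (_ ^+ l); ring.
  rewrite null_power_expansion // mulr_sumr; apply: eq_bigr => k _.
  rewrite taylor_coef_rc /c.
  move: N0; move: ((2 * cis a * rc (sin b)) ^+ l) => D N0.
  by rewrite !exprMn; field.
have := Hlam c; under [X in _ = X]eq_bigr do rewrite valE.
move=> E; rewrite -[RHS](_ : rc ((l + m)`!%:R / l`!%:R) * c (Ordinal lml) = _); last first.
  by rewrite E mulr_sumr; apply: eq_bigr => j _; ring.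
rewrite /c -[nat_of_ord (Ordinal lml)]/(l + m)%N legendre_taylor hornerZ hornerMn -cisX.
have hf : rc (l`!%:R) != 0 by rewrite fmorph_eq0 pnatr_eq0 -lt0n fact_gt0.
rewrite natrM natrX -[_ *+ (l + m)`!]mulr_natr !(rmorphM, fmorphV, rmorphXn) (rmorph_nat _ 2) /=.
move: hf; move: (rc (l`!%:R)) (rc (_`!%:R)) (rc (horner _ _)) => p1 p2 p3 hf.
rewrite exprD; move: z0 y0; move: (cis a) (rc (sin b)) => z y z0 y0.
rewrite !exprMn; field.
by apply/and4P; split=> //; apply: expf_neq0.
Qed.

Lemma contC_rc {T : topologicalType} (f : T -> R) : continuous f -> contC (fun t => rc (f t)).
Proof. by move=> cf; split => //=; cont. Qed.

Lemma contC_exp {T : topologicalType} (f : T -> C) n : contC f -> contC (fun t => f t ^+ n).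
Proof.
move=> cf; elim: n => [|n IH]; first exact: (contC_cst 1).
rewrite (_ : (fun t => _) = fun t => f t * f t ^+ n); first exact: contC_M.
by apply/funext => t; rewrite exprS.
Qed.

Lemma contC_IntC {T : topologicalType} (a b : R) (G : T -> R -> C) :
  contC (fun z : T * R => G z.1 z.2) -> contC (fun t => IntC a b (G t)).
Proof. by move=> [c1 c2]; split; apply: Int_param_cont. Qed.

Lemma contC_comp {T U : topologicalType} (h : T -> U) (f : U -> C) :
  continuous h -> contC f -> contC (fun t => f (h t)).
Proof. by move=> ch [c1 c2]; split; [exact: (cont_comp ch c1)|exact: (cont_comp ch c2)]. Qed.

Lemma legendre_projection_vanishes (f : R -> R -> R) (l m : nat) :
  continuous (fun z : R * R => f z.1 z.2) -> (m <= l)%N ->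
  (forall s, s != 0 -> sphC (fun a b => rc (f a b) *
     dotC (null1 s) (null2 s) 1 (sin b * cos a) (sin b * sin a) (cos b) ^+ l) = 0) ->
  sph (fun a b => f a b * (sin b ^+ m * (derivn m (@legendre R l)).[cos b] * cos (m%:R * a))) = 0 /\
  sph (fun a b => f a b * (sin b ^+ m * (derivn m (@legendre R l)).[cos b] * sin (m%:R * a))) = 0.
Proof.
move=> cf ml f0.
have [mu Hmu] := sph_harm_from_null_powers ml.
pose q (j : nat) (z : R * R) : C := dotC (null1 (j.+1%:R)) (null2 (j.+1%:R)) 1
  (sin z.2 * cos z.1) (sin z.2 * sin z.1) (cos z.2) ^+ l.
pose g (j : nat) (a b : R) : C := rc (sin b) * (rc (f a b) * q j (a, b)).
have cq j : contC (q j).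
  apply: contC_exp; rewrite /dotC; apply: contC_D; first apply: contC_D.
  - by apply: contC_M; [exact: contC_cst|apply: contC_rc; cont].
  - by apply: contC_M; [exact: contC_cst|apply: contC_rc; cont].
  - by apply: contC_M; [exact: contC_cst|apply: contC_rc; cont].
have cg j : contC (fun z : R * R => g j z.1 z.2).
  apply: contC_M; first by apply: contC_rc; cont.
  apply: contC_M; first exact: contC_rc.
  by apply: (contC_comp (h := fun z : R * R => (z.1, z.2))) => //; cont.
have cgs j a : contC (g j a).
  by apply: (contC_comp (h := fun b : R => (a, b)) _ (cg j)); cont.
(* The coefficients are extended by zero to all indices, as [IntC_sum] requires. *)
pose mu' (j : nat) : C := if insub j is Some k then mu k else 0.
pose h a b : C := rc (f a b) *
  (rc (sin b ^+ m * (derivn m (@legendre R l)).[cos b]) * cis (m%:R * a)).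
have hE a b : rc (sin b) * h a b = \sum_(j < (2 * l).+1) mu' j * g j a b.
  have [s0|s0] := eqVneq (sin b) 0.
    by rewrite s0 mul0r big1 // => j _; rewrite /g s0 mul0r mulr0.
  rewrite /h (Hmu a b s0) !mulr_sumr; apply: eq_bigr => j _.
  rewrite /mu' valK /g /q; ring.
have : sphC h = 0.
  rewrite /sphC (_ : (fun a => _) = fun a => \sum_(j < (2 * l).+1) mu' j * IntC 0 pi (g j a)); last first.
    apply/funext => a; rewrite (funext (hE a)).
    by rewrite (IntC_sum _ _ _ mu' (g := fun j b => g j a b)).
  rewrite (IntC_sum _ _ _ mu' (g := fun j a => IntC 0 pi (g j a))); last first.
    by move=> j; exact: contC_IntC.
  by rewrite big1 // => j _; rewrite [IntC _ _ _]f0 ?mulr0 // pnatr_eq0.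
rewrite sphCE => -[hr hi]; split.
  rewrite -[RHS]hr; congr sph; apply/funext => a; apply/funext => b.
  by ring.
rewrite -[RHS]hi; congr sph; apply/funext => a; apply/funext => b.
by ring.
Qed.

End NullVectors.

(** * Substitution in improper integrals *)
Section Substitution.
Context {R : realType}.
Notation mu := (@lebesgue_measure R).

Lemma itv_oo_bigcup (a b : R) : a < b ->
  let d n := (b - a) / n.+3%:R in
  `]a, b[%classic = \bigcup_n `[a + d n, b - d n]%classic :> set R.
Proof.
move=> ab d; apply/seteqP; split => [x /=|x [n _] /=].
  rewrite in_itv /= => /andP[ax xb].
  pose e := Num.min (x - a) (b - x).
  have e0 : 0 < e by rewrite lt_min !subr_gt0 ax.
  have [n _ /(_ _ (leqnn n))] := near_infty_natSinv_lt (PosNum (divr_gt0 e0 (ltac:(lra) : 0 < b - a))).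
  rewrite /= => h; exists n => //=.
  have dn : d n <= e.
    rewrite /d -ler_pdivlMl; last by lra.
    rewrite mulrC; apply: ltW; apply: le_lt_trans h.
    by rewrite lef_pV2 ?posrE // ler_nat ltnW.
  move: dn; rewrite /e le_min in_itv /= => /andP[]; lra.
rewrite !in_itv /= => /andP[h1 h2].
have dn0 : 0 < d n by rewrite divr_gt0 // subr_gt0.
by apply/andP; split; lra.
Qed.

(** Neither [dm] nor [h] is controlled at the ends of the intervals: the substitution is
    made on segments that exhaust them, with passage to the limit by monotone
    convergence. *)
Lemma ge0_substitution_oo (m dm h : R -> R) (a b : R) : a < b ->
  continuous m ->
  {in `[a, b] &, {homo m : x y / x < y}} ->
  (forall x : R, a < x < b -> is_derive x (1 : R) m (dm x)) ->
  {in `]a, b[, continuous dm} ->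
  (forall y, m a < y < m b -> 0 <= h y) ->
  (forall x, a < x < b -> 0 <= dm x) ->
  {in `]m a, m b[, continuous h} ->
  (\int[mu]_(y in `]m a, m b[) (h y)%:E = \int[mu]_(x in `]a, b[) (h (m x) * dm x)%:E)%E.
Proof.
move=> ab cm mono dmE cdm h0 dm0 ch.
pose d n := (b - a) / n.+3%:R : R.
have d0 n : 0 < d n by rewrite divr_gt0 // subr_gt0.
have d3 n : d n * 3 <= b - a.
  rewrite /d mulrAC ler_pdivrMr // ler_pM2l ?subr_gt0 // ler_nat //.
pose u n := a + d n; pose v n := b - d n.
have au n : a < u n by rewrite /u ltrDl.
have vb n : v n < b by rewrite /v; have := d0 n; lra.
have uv n : u n < v n by rewrite /u /v; have := d3 n; have := d0 n; lra.
have abu n : u n \in `[a, b] by rewrite in_itv /=; have := au n; have := uv n; have := vb n; lra.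
have abv n : v n \in `[a, b] by rewrite in_itv /=; have := au n; have := uv n; have := vb n; lra.
have aab : a \in `[a, b] by rewrite in_itv /=; lra.
have bab : b \in `[a, b] by rewrite in_itv /=; lra.
have mau n : m a < m (u n) by apply: mono.
have mvb n : m (v n) < m b by apply: mono.
have dnoninc n p : (n <= p)%N -> d p <= d n.
  by move=> np; rewrite /d ler_pM2l ?subr_gt0 // lef_pV2 ?posrE // ler_nat !ltnS.
have mule x y : a <= x -> y <= b -> x <= y -> m x <= m y.
  move=> ax yb; rewrite le_eqVlt => /predU1P[->//|xy]; apply/ltW/mono => //; rewrite in_itv /=; lra.
have U1 : `]m a, m b[%classic = \bigcup_n `[m (u n), m (v n)]%classic :> set R.
  apply/seteqP; split => [y /=|y [n _] /=].
    rewrite in_itv /= => /andP[h1 h2].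
    have mab : m a <= m b by lra.
    have [|c cab cy] := @IVT R m a b y (ltW ab) (continuous_subspaceT cm).
      by rewrite (min_idPl mab) (max_idPr mab); lra.
    have : `]a, b[%classic c.
      move: cab; rewrite /= !in_itv /= => /andP[ac cb]; apply/andP; split; rewrite lt_neqAle ?ac ?cb andbT; apply/eqP => E.
        by move: h1; rewrite E cy ltxx.
      by move: h2; rewrite -E cy ltxx.
    rewrite (itv_oo_bigcup ab) => -[n _] /=; rewrite in_itv /= => /andP[c1 c2].
    exists n => //=; rewrite in_itv /= -cy; apply/andP; split; apply: mule => //.
    - exact/ltW/au.
    - by apply: (le_trans c2); exact/ltW/vb.
    - by apply: le_trans c1; exact/ltW/au.
    - exact/ltW/vb.
  by rewrite !in_itv /= => /andP[h1 h2]; have := mau n; have := mvb n; lra.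
have U2 := itv_oo_bigcup ab.
have eqn n : (\int[mu]_(y in `[m (u n), m (v n)]) (h y)%:E =
              \int[mu]_(x in `[u n, v n]) (h (m x) * dm x)%:E)%E.
  have dmE' x : x \in `]a, b[ -> (derive1 m) x = dm x.
    by rewrite in_itv /= => /dmE dx; rewrite derive1E; case: dx.
  have cm' x : x \in `]a, b[ -> {for x, continuous (derive1 m)}.
    move=> xab; have := cdm x xab; rewrite /prop_for /continuous_at dmE' //.
    apply: cvg_trans; apply: near_eq_cvg.
    have : nbhs x `]a, b[%classic by apply: near_in_itvoo.
    by apply: filterS => y yab; rewrite dmE'.
  have uab : u n \in `]a, b[ by rewrite in_itv /=; have := au n; have := uv n; have := vb n; lra.
  have vab : v n \in `]a, b[ by rewrite in_itv /=; have := au n; have := uv n; have := vb n; lra.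
  have sub x : u n <= x <= v n -> x \in `]a, b[.
    by rewrite in_itv /=; have := au n; have := vb n; lra.
  have hcont : {within `[m (u n), m (v n)], continuous h}.
    apply: continuous_in_subspaceT => y /set_mem; rewrite /= in_itv /= => /andP[y1 y2].
    by apply: ch; rewrite in_itv /=; have := mau n; have := mvb n; lra.
  rewrite (integration_by_substitution_increasing (F := m) (G := h)) //.
  - apply: eq_integral => x /set_mem /=; rewrite in_itv /= => xuv.
    by rewrite /= fctE dmE' //; exact: sub.
  - exact/ltW/uv.
  - move=> x y; rewrite !in_itv /= => xuv yuv xy; apply: mono => //; rewrite in_itv /=; have := au n; have := vb n; lra.
  - by move=> x; rewrite in_itv /= => xuv; apply: cm'; apply: sub; lra.
  - by apply/cvg_ex; exists ((derive1 m) (u n)); apply: cvg_at_right_filter; exact: cm'.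
  - by apply/cvg_ex; exists ((derive1 m) (v n)); apply: cvg_at_left_filter; exact: cm'.
  - split.
    + by move=> x; rewrite in_itv /= => xuv; have [] : is_derive x (1 : R) m (dm x) by apply: dmE; have := au n; have := vb n; lra.
    + by apply: cvg_at_right_filter; exact: cm.
    + by apply: cvg_at_left_filter; exact: cm.
have c1 : (\int[mu]_(y in `[m (u n), m (v n)]) (h y)%:E @[n --> \oo] --> \int[mu]_(y in `]m a, m b[) (h y)%:E)%E.
  rewrite U1; apply: ge0_nondecreasing_set_cvg_integral => //.
  - move=> n p np; rewrite subsetEset => y /=; rewrite !in_itv /= => /andP[y1 y2].
    apply/andP; split.
      apply: le_trans y1; apply: mule; [exact/ltW/au|exact/ltW/(lt_trans (uv n))|].
      by rewrite /u lerD2l dnoninc.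
    apply: (le_trans y2); apply: mule; [exact/ltW/(lt_trans _ (uv n))|exact/ltW/vb|].
    by rewrite /v lerD2l lerN2 dnoninc.
  - move=> n; apply/measurable_EFinP; apply: subspace_continuous_measurable_fun => //.
    apply: continuous_in_subspaceT => y /set_mem; rewrite /= in_itv /= => /andP[y1 y2].
    by apply: ch; rewrite in_itv /=; have := mau n; have := mvb n; lra.
  - move=> n y /=; rewrite in_itv /= => /andP[y1 y2]; rewrite lee_fin h0 //.
    by have := mau n; have := mvb n; lra.
have c2 : (\int[mu]_(x in `[u n, v n]) (h (m x) * dm x)%:E @[n --> \oo] --> \int[mu]_(x in `]a, b[) (h (m x) * dm x)%:E)%E.
  rewrite U2; apply: ge0_nondecreasing_set_cvg_integral => //.
  - move=> n p np; rewrite subsetEset => y /=; rewrite !in_itv /= => /andP[y1 y2].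
    have dp := dnoninc _ _ np; apply/andP; split.
      by apply: le_trans y1; rewrite lerD2l.
    by apply: (le_trans y2); rewrite lerD2l lerN2.
  - move=> n; apply/measurable_EFinP; apply: subspace_continuous_measurable_fun => //.
    apply: continuous_in_subspaceT => x /set_mem; rewrite /= in_itv /= => /andP[x1 x2].
    have axb : a < x < b by have := le_lt_trans x2 (vb n); have := lt_le_trans (au n) x1; lra.
    apply: cvgM; last by apply: cdm; rewrite in_itv.
    apply: (@continuous_comp _ _ _ m h); first exact: cm.
    by apply: ch; rewrite in_itv /=; apply/andP; split; apply: mono => //; rewrite ?in_itv /=; lra.
  - move=> n x /=; rewrite in_itv /= => /andP[x1 x2].
    have axb : a < x < b by have := le_lt_trans x2 (vb n); have := lt_le_trans (au n) x1; lra.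
    rewrite lee_fin mulr_ge0 ?dm0 //; apply: h0.
    by apply/andP; split; apply: mono => //; rewrite ?in_itv /=; lra.
rewrite (funext eqn) in c1.
exact: (cvg_unique _ c1 c2).
Qed.

End Substitution.

(** * Composition of two Abel transforms *)
Section AbelExchange.
Context {R : realType}.
Notation mu := (@lebesgue_measure R).
Notation RR := (measurableTypeR R).

Lemma integral_oo_Int (a b : R) (f : R -> R) : continuous f ->
  (\int[mu]_(x in `]a, b[) (f x)%:E = (Int a b f)%:E)%E.
Proof.
move=> cf; have itf : mu.-integrable `[a, b] (EFin \o f) by exact: continuous_integrable.
have itf1 : mu.-integrable `]a, b] (EFin \o f).
  by apply: integrableS itf => //; apply: subset_itv; rewrite bnd_simp.
have itf2 : mu.-integrable `]a, b[ (EFin \o f).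
  by apply: integrableS itf => //; apply: subset_itv; rewrite bnd_simp.
rewrite /Int /Rintegral -(integral_itv_obnd_cbnd (measurable_int mu itf1)).
rewrite -(integral_itv_bndo_bndc (measurable_int mu itf2)).
by rewrite fineK //; apply: integrable_fin_num.
Qed.

Let pi2_gt0 : 0 < pi / 2 :> R.
Proof. by rewrite divr_gt0 // pi_gt0. Qed.

Lemma sin_cos_gt0 (t : R) : 0 < t < pi / 2 -> 0 < sin t /\ 0 < cos t.
Proof.
move=> /andP[t0 t1]; split.
  by apply: sin_gt0_pi; have := pi_gt0 R; lra.
by apply: cos_gt0_pihalf; have := pi_gt0 R; lra.
Qed.

Lemma sin_mono_pihalf : {in `[0, pi / 2] &, {homo (@sin R) : x y / x < y}}.
Proof.
move=> x y; rewrite !in_itv /= => xI yI xy.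
by rewrite ltr_sin // in_itv /=; have := pi_gt0 R; lra.
Qed.

(** The substitution is [y = r sin t]. *)
Lemma abel_substitution_inner (q : R -> R) (r : R) : 0 < r ->
  continuous q -> (forall y, 0 <= q y) ->
  (\int[mu]_(y in `]0%R, r[) (q y / Num.sqrt (r ^+ 2 - y ^+ 2))%:E =
   (Int 0 (pi / 2) (fun t => q (r * sin t)))%:E)%E.
Proof.
move=> r0 cq q0.
have cqs : continuous (fun t : R => q (r * sin t)) by cont.
rewrite -integral_oo_Int //.
have cm : continuous (fun t : R => r * sin t) by cont.
have mono : {in `[0, pi / 2] &, {homo (fun t : R => r * sin t) : t s / t < s}}.
  by move=> t s tI sI ts; rewrite ltr_pM2l //; exact: sin_mono_pihalf.
have dmE (t : R) : 0 < t < pi / 2 -> is_derive t (1 : R) (fun t => r * sin t) (r * cos t).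
  move=> _; have := derM (derC t r) (is_derive_sin t).
  by move/is_derive_eq; apply; rewrite mul0r add0r.
have := @ge0_substitution_oo R (fun t => r * sin t) (fun t => r * cos t)
  (fun y => q y / Num.sqrt (r ^+ 2 - y ^+ 2)) 0 (pi / 2) pi2_gt0 cm mono dmE.
rewrite sin0 mulr0 sin_pihalf mulr1 => ->.
- apply: eq_integral => t /set_mem /=; rewrite in_itv /= => tI.
  have [s0 c0] := sin_cos_gt0 tI.
  have -> : r ^+ 2 - (r * sin t) ^+ 2 = (r * cos t) ^+ 2.
    by rewrite !exprMn cos2sin2; ring.
  rewrite sqrtr_sqr gtr0_norm ?mulr_gt0 // divfK // gt_eqF // mulr_gt0 //.
- by move=> t _; apply: contM; [exact: cont_cst|exact: continuous_cos].
- by move=> y yI; rewrite divr_ge0 // sqrtr_ge0.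
- by move=> t tI; have [s0 c0] := sin_cos_gt0 tI; rewrite mulr_ge0 ?ltW.
- move=> y; rewrite in_itv /= => yI; apply: cvgM; first exact: cq.
  apply: cvgV.
    by rewrite gt_eqF // sqrtr_gt0 subr_gt0 ltr_sqr ?nnegrE //; lra.
  have cs : continuous (fun y : R => Num.sqrt (r ^+ 2 - y ^+ 2)) by cont.
  exact: cs.
Qed.

(** The substitution is [r^2 = rho^2 + (x^2 - rho^2) sin^2 t]. *)
Lemma abel_substitution_outer (q : R -> R) (x rho : R) : 0 < rho < x ->
  continuous q -> (forall y, 0 <= q y) ->
  (\int[mu]_(r in `]rho, x[) (r * q r / (Num.sqrt (x ^+ 2 - r ^+ 2) * Num.sqrt (r ^+ 2 - rho ^+ 2)))%:E =
   (Int 0 (pi / 2) (fun t => q (Num.sqrt (rho ^+ 2 + (x ^+ 2 - rho ^+ 2) * sin t ^+ 2))))%:E)%E.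
Proof.
move=> /andP[rho0 rhox] cq q0.
have x0 : 0 < x by lra.
pose m t := Num.sqrt (rho ^+ 2 + (x ^+ 2 - rho ^+ 2) * sin t ^+ 2).
pose D := x ^+ 2 - rho ^+ 2.
have D0 : 0 < D by rewrite subr_gt0 ltr_sqr ?nnegrE //; lra.
have in0 t : 0 < rho ^+ 2 + D * sin t ^+ 2.
  by rewrite ltr_pwDl ?exprn_gt0 // mulr_ge0 ?sqr_ge0 // ltW.
have m0 t : 0 < m t by rewrite sqrtr_gt0; exact: in0.
have m2 t : m t ^+ 2 = rho ^+ 2 + D * sin t ^+ 2 by rewrite sqr_sqrtr // ltW //; exact: in0.
have cm : continuous m by rewrite /m; cont.
have cqm : continuous (fun t => q (m t)) by cont.
rewrite -(integral_oo_Int 0 (pi / 2) cqm).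
pose dm t := D * (sin t * cos t) / m t.
have ma : m 0 = rho by rewrite /m sin0 expr0n /= mulr0 addr0 sqrtr_sqr gtr0_norm.
have mb : m (pi / 2) = x by rewrite /m sin_pihalf expr1n mulr1 subrKC sqrtr_sqr gtr0_norm.
have mono : {in `[0, pi / 2] &, {homo m : t s / t < s}}.
  move=> t s tI sI ts; rewrite /m ltr_sqrt; last exact: in0.
  rewrite ltrD2l ltr_pM2l // ltr_sqr ?nnegrE; first exact: sin_mono_pihalf.
    by apply: sin_ge0_pi; move: tI; rewrite in_itv /=; have := pi_gt0 R; lra.
  by apply: sin_ge0_pi; move: sI; rewrite in_itv /=; have := pi_gt0 R; lra.
have dmE (t : R) : 0 < t < pi / 2 -> is_derive t (1 : R) m (dm t).
  move=> _.
  have d1 : is_derive t (1 : R) (fun s => rho ^+ 2 + D * sin s ^+ 2) (D * (2 * sin t * cos t)).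
    have := derD (derC t (rho ^+ 2)) (derM (derC t D) (derM (is_derive_sin t) (is_derive_sin t))).
    by move/is_derive_eq; apply; ring.
  have := @is_derive1_comp R (@Num.sqrt R) _ t _ _ (is_derive1_sqrt (in0 t)) d1.
  move/is_derive_eq; apply; rewrite -/(m t) /dm.
  by have := m0 t; move: (m t) => mt mt0; field; rewrite gt_eqF.
have := @ge0_substitution_oo R m dm
  (fun r => r * q r / (Num.sqrt (x ^+ 2 - r ^+ 2) * Num.sqrt (r ^+ 2 - rho ^+ 2))) 0 (pi / 2) pi2_gt0 cm mono dmE.
rewrite ma mb => ->.
- apply: eq_integral => t /set_mem /=; rewrite in_itv /= => tI.
  have [s0 c0] := sin_cos_gt0 tI.
  have -> : x ^+ 2 - m t ^+ 2 = D * cos t ^+ 2 by rewrite m2 cos2sin2 /D; ring.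
  have -> : m t ^+ 2 - rho ^+ 2 = D * sin t ^+ 2 by rewrite m2; ring.
  rewrite !(sqrtrM _ (ltW D0)) !sqrtr_sqr !gtr0_norm // /dm; congr EFin.
  have : D = Num.sqrt D ^+ 2 by rewrite sqr_sqrtr // ltW.
  have : Num.sqrt D != 0 by rewrite gt_eqF // sqrtr_gt0.
  move: (Num.sqrt D) => d d0 ->.
  by field; rewrite ?d0 !gt_eqF //.
- move=> t _; rewrite /dm; apply: cvgM.
    have cc : continuous (fun t : R => D * (sin t * cos t)) by cont.
    exact: cc.
  by apply: cvgV; [rewrite gt_eqF|exact: cm].
- by move=> y yI; rewrite divr_ge0 // mulr_ge0 ?sqrtr_ge0 //; lra.
- move=> t tI; have [s0 c0] := sin_cos_gt0 tI.
  by rewrite /dm divr_ge0 ?mulr_ge0 ?ltW //.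
- move=> y; rewrite in_itv /= => yI; apply: cvgM.
    have cc : continuous (fun r : R => r * q r) by cont.
    exact: cc.
  apply: cvgV.
    by rewrite gt_eqF // mulr_gt0 // sqrtr_gt0 subr_gt0 ltr_sqr ?nnegrE //; lra.
  have cs : continuous (fun r : R => Num.sqrt (x ^+ 2 - r ^+ 2) * Num.sqrt (r ^+ 2 - rho ^+ 2)) by cont.
  exact: cs.
Qed.

(** Both sides are the integral of
    [r Q(r, y) / (sqrt (x^2 - r^2) sqrt (r^2 - y^2))] over the triangle [0 < y < r < x],
    taken in the two orders (Tonelli) and desingularized by the substitutions above. *)
Lemma abel_exchange_ge0 (Q : R -> R -> R) (x : R) : 0 < x ->
  continuous (fun z : R * R => Q z.1 z.2) -> (forall r y, 0 <= Q r y) ->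
  Int 0 (pi / 2) (fun s => x * sin s *
     Int 0 (pi / 2) (fun t => Q (x * sin s) (x * sin s * sin t))) =
  Int 0 x (fun y => Int 0 (pi / 2) (fun t =>
     Q (Num.sqrt (y ^+ 2 + (x ^+ 2 - y ^+ 2) * sin t ^+ 2)) y)).
Proof.
move=> x0 cQ Q0.
have cQ1 r : continuous (Q r) by exact: cont_section cQ.
have cQ2 y : continuous (Q ^~ y).
  by apply: (cont_comp (f := fun r : R => (r, y)) _ cQ); cont.
pose U : set (R * R) := [set z | 0 < z.2 /\ z.2 < z.1 /\ z.1 < x].
have mU : measurable (U : set (RR * RR)).
  apply: open_prod_measurable.
  rewrite (_ : U = [set z | 0 < z.2] `&` ([set z | 0 < z.1 - z.2] `&` [set z | 0 < x - z.1])); last first.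
    by apply/seteqP; split => z /=; rewrite !subr_gt0.
  have op (F : R * R -> R) : continuous F -> open [set z | 0 < F z].
    by move=> cF; apply: (open_comp (f := F) (D := [set y : R | 0 < y])) => //; exact: open_gt.
  by apply: openI; [|apply: openI]; apply: op; cont.
(* The inverse as a real power, a function that is measurable on the whole line. *)
pose ip (t : R) := t `^ (-1).
pose K (r y : R) := r * Q r y * (ip (Num.sqrt (x ^+ 2 - r ^+ 2)) * ip (Num.sqrt (r ^+ 2 - y ^+ 2))).
have KE r y : K r y = r * Q r y / (Num.sqrt (x ^+ 2 - r ^+ 2) * Num.sqrt (r ^+ 2 - y ^+ 2)).
  by rewrite /K /ip !powR_inv1 ?sqrtr_ge0 // invfM.
pose f (z : RR * RR) : \bar R := (\1_U z * K z.1 z.2)%:E.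
have f0 z : (0 <= f z)%E.
  rewrite lee_fin indicE; case: (boolP (z \in U)) => [/set_mem[z1 [z2 z3]]|_]; last by rewrite mul0r.
  rewrite mul1r KE divr_ge0 ?mulr_ge0 ?sqrtr_ge0 //; lra.
have mf : measurable_fun setT f.
  apply/measurable_EFinP; apply: measurable_funM; first exact: measurable_indic.
  have mc (F : R * R -> R) : continuous F -> measurable_fun setT (F : RR * RR -> RR).
    exact: continuous2_measurable.
  apply: measurable_funM.
    by apply: measurable_funM; apply: mc; cont.
  have mip (F : R * R -> R) : continuous F ->
      measurable_fun setT ((fun z => ip (F z)) : RR * RR -> RR).
    by move=> cF; exact: (measurableT_comp (@measurable_powR R (-1)) (mc F cF)).
  apply: measurable_funM.
    by apply: (mip (fun z => Num.sqrt (x ^+ 2 - z.1 ^+ 2))); cont.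
  by apply: (mip (fun z => Num.sqrt (z.1 ^+ 2 - z.2 ^+ 2))); cont.
have ft := fubini_tonelli (m1 := mu) (m2 := mu) f mf f0.
clear f0 mf.
pose E r := Int 0 (pi / 2) (fun t => Q r (r * sin t)).
have cE : continuous E by rewrite /E; contI; apply: (cont_comp (f := fun z : R * R => (z.1, z.1 * sin z.2)) _ cQ); cont.
have E0 r : 0 <= E r by apply: Rintegral_ge0.
have U_empty_l r y : ~ (0 < r < x) -> (r, y) \in U = false.
  move=> h; apply/negbTE; apply/negP => /set_mem [] /= y0 [yr rx]; apply: h; lra.
have U_empty_r r y : ~ (0 < y < x) -> (r, y) \in U = false.
  move=> h; apply/negbTE; apply/negP => /set_mem [] /= y0 [yr rx]; apply: h; lra.
(* The absolute value extends the factor [r] to a nonnegative continuous function. *)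
have left r : (\int[mu]_y f (r, y) =
    (\1_(`]0%R, x[%classic) r * (`|r| * E r / Num.sqrt (x ^+ 2 - r ^+ 2)))%:E)%E.
  rewrite indicE; have [rx|rx] := boolP (r \in `]0, x[%classic); last first.
    have xn : ~ (0 < r < x).
      by move=> h; move/negP: rx; apply; apply/mem_set; rewrite /= in_itv.
    rewrite mul0r; apply: integral0_eq => y _.
    by rewrite /f indicE (U_empty_l _ _ xn) mul0r.
  have {}rx : 0 < r < x by move/set_mem: rx; rewrite /= in_itv.
  have r0 : 0 < r by lra.
  pose c := r / Num.sqrt (x ^+ 2 - r ^+ 2).
  have c0 : 0 <= c by exact: (divr_ge0 (ltW r0) (sqrtr_ge0 _)).
  have cq : continuous (fun y => c * Q r y) by cont.
  have := @abel_substitution_inner (fun y => c * Q r y) r r0 cq (fun y => mulr_ge0 c0 (Q0 r y)).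
  rewrite IntZ; last by apply: (cont_comp (f := fun t : R => (r, r * sin t)) _ cQ); cont.
  have -> : 1 * (`|r| * E r / Num.sqrt (x ^+ 2 - r ^+ 2)) = c * E r.
    by rewrite mul1r (gtr0_norm r0) mulrAC.
  move=> <-.
  rewrite [RHS]integral_mkcond; apply: eq_integral => y _; rewrite patchE /f indicE.
  have -> : ((r, y) \in U) = (y \in `]0, r[%classic).
    apply/idP/idP => [/set_mem [/= h1 [h2 h3]]|/set_mem].
      by apply/mem_set; rewrite /= in_itv /=; lra.
    rewrite /= in_itv /= => h; apply/mem_set; split => /=; first by lra.
    by split => /=; lra.
  case: ifP => _; last by rewrite mul0r.
  by rewrite mul1r KE /c invfM; congr EFin; rewrite [fst _]/= [snd _]/=; ring.
have right y : (\int[mu]_r f (r, y) = (\1_(`]0%R, x[%classic) y * Int 0 (pi / 2) (fun t =>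
     Q (Num.sqrt (y ^+ 2 + (x ^+ 2 - y ^+ 2) * sin t ^+ 2)) y))%:E)%E.
  rewrite indicE; have [yx|yx] := boolP (y \in `]0, x[%classic); last first.
    have xn : ~ (0 < y < x).
      by move=> h; move/negP: yx; apply; apply/mem_set; rewrite /= in_itv.
    rewrite mul0r; apply: integral0_eq => r _.
    by rewrite /f indicE (U_empty_r _ _ xn) mul0r.
  have {}yx : 0 < y < x by move/set_mem: yx; rewrite /= in_itv.
  rewrite mul1r -(@abel_substitution_outer (Q ^~ y) x y yx (cQ2 y) (Q0 ^~ y)).
  rewrite [RHS]integral_mkcond; apply: eq_integral => r _; rewrite patchE /f indicE.
  have -> : ((r, y) \in U) = (r \in `]y, x[%classic).
    apply/idP/idP => [/set_mem [/= h1 [h2 h3]]|/set_mem].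
      by apply/mem_set; rewrite /= in_itv /=; lra.
    rewrite /= in_itv /= => h; apply/mem_set; split => /=; first by lra.
    by split => /=; lra.
  case: ifP => _; last by rewrite mul0r.
  by rewrite mul1r KE.
pose rhs y := Int 0 (pi / 2) (fun t =>
     Q (Num.sqrt (y ^+ 2 + (x ^+ 2 - y ^+ 2) * sin t ^+ 2)) y).
have E1 : (\int[mu]_r \int[mu]_y f (r, y) =
    \int[mu]_r (\1_(`]0%R, x[%classic) r * (`|r| * E r / Num.sqrt (x ^+ 2 - r ^+ 2)))%:E)%E.
  by apply: eq_integral => r _; exact: left.
have E2 : (\int[mu]_y \int[mu]_r f (r, y) = \int[mu]_y (\1_(`]0%R, x[%classic) y * rhs y)%:E)%E.
  by apply: eq_integral => y _; exact: right.
have {}ft := etrans (esym E1) (etrans ft E2).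
clear left right E1 E2 U_empty_l U_empty_r; move: ft.
have indic_oo (g : R -> R) : (\int[mu]_r (\1_(`]0%R, x[%classic) r * g r)%:E =
    \int[mu]_(r in `]0%R, x[) (g r)%:E)%E.
  rewrite [RHS]integral_mkcond; apply: eq_integral => r _; rewrite patchE indicE.
  case: ifP => _; first by rewrite mul1r.
  by rewrite mul0r.
have cn : continuous (fun r : R => `|r|) by cont.
have cE' : continuous (fun r : R => `|r| * E r) by exact: contM cn cE.
have E0' r : 0 <= `|r| * E r by rewrite mulr_ge0.
have crhs : continuous rhs.
  rewrite /rhs; contI.
  apply: (cont_comp (f := fun z : R * R =>
    (Num.sqrt (z.1 ^+ 2 + (x ^+ 2 - z.1 ^+ 2) * sin z.2 ^+ 2), z.1)) _ cQ).
  by cont.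
rewrite !indic_oo (abel_substitution_inner x0 cE' E0') (integral_oo_Int _ _ crhs).
move=> [<-]; apply: eq_Int => t tI.
have st : 0 <= sin t by apply: sin_ge0_pi; have := pi_gt0 R; lra.
by rewrite (ger0_norm (mulr_ge0 (ltW x0) st)).
Qed.

End AbelExchange.

(** * Local uniqueness for Abel equations *)
Section AbelUniqueness.
Context {R : realType}.

Let pi2_gt0 : 0 < pi / 2 :> R.
Proof. by rewrite divr_gt0 // pi_gt0. Qed.

(** The constant [M] is added to [Q] to make it nonnegative, then subtracted. *)
Lemma abel_exchange (Q : R -> R -> R) (x M : R) : 0 < x ->
  continuous (fun z : R * R => Q z.1 z.2) -> (forall r y, `|Q r y| <= M) ->
  Int 0 (pi / 2) (fun s => x * sin s *
     Int 0 (pi / 2) (fun t => Q (x * sin s) (x * sin s * sin t))) =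
  Int 0 x (fun y => Int 0 (pi / 2) (fun t =>
     Q (Num.sqrt (y ^+ 2 + (x ^+ 2 - y ^+ 2) * sin t ^+ 2)) y)).
Proof.
move=> x0 cQ QM.
have M0 : 0 <= M := le_trans (normr_ge0 _) (QM 0 0).
have cQM : continuous (fun z : R * R => Q z.1 z.2 + M) by cont.
have cMM : continuous (fun z : R * R => M) by cont.
have e1 := @abel_exchange_ge0 R (fun r y => Q r y + M) x x0 cQM
  (fun r y => ltac:(have := QM r y; rewrite ler_norml; lra)).
have e2 := @abel_exchange_ge0 R (fun r y => M) x x0 cMM (fun _ _ => M0).
have cl : continuous (fun z : R * R => Q (x * sin z.1) (x * sin z.1 * sin z.2)).
  by apply: (cont_comp (f := fun z : R * R => (x * sin z.1, x * sin z.1 * sin z.2)) _ cQ); cont.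
have cr : continuous (fun z : R * R => Q (Num.sqrt (z.1 ^+ 2 + (x ^+ 2 - z.1 ^+ 2) * sin z.2 ^+ 2)) z.1).
  by apply: (cont_comp (f := fun z : R * R => (Num.sqrt (z.1 ^+ 2 + (x ^+ 2 - z.1 ^+ 2) * sin z.2 ^+ 2), z.1)) _ cQ); cont.
have cl1 s : continuous (fun t => Q (x * sin s) (x * sin s * sin t)).
  exact: (@cont_section _ _ (fun s t => Q (x * sin s) (x * sin s * sin t)) s cl).
have cr1 (y : R) : continuous (fun t => Q (Num.sqrt (y ^+ 2 + (x ^+ 2 - y ^+ 2) * sin t ^+ 2)) y).
  by apply: (cont_comp (f := fun t : R => (y, t)) _ cr); cont.
have cl2 : continuous (fun s : R => x * sin s * Int 0 (pi / 2) (fun t => Q (x * sin s) (x * sin s * sin t))).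
  by apply: contM; [cont|exact: Int_param_cont].
have cr2 : continuous (fun y : R => Int 0 (pi / 2) (fun t =>
     Q (Num.sqrt (y ^+ 2 + (x ^+ 2 - y ^+ 2) * sin t ^+ 2)) y)) by exact: Int_param_cont.
have cM1 : continuous (fun t : R => M) by cont.
move: e1; rewrite (eq_Int (g := fun s => x * sin s * Int 0 (pi / 2) (fun t => Q (x * sin s) (x * sin s * sin t))
   + x * sin s * Int 0 (pi / 2) (fun t => M))); last first.
  by move=> s _; rewrite (IntD _ _ (cl1 s) cM1) mulrDr.
rewrite [in RHS](eq_Int (g := fun y => Int 0 (pi / 2) (fun t =>
     Q (Num.sqrt (y ^+ 2 + (x ^+ 2 - y ^+ 2) * sin t ^+ 2)) y) + Int 0 (pi / 2) (fun t => M))); last first.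
  by move=> y _; rewrite (IntD _ _ (cr1 y) cM1).
have cl3 : continuous (fun s : R => x * sin s * Int 0 (pi / 2) (fun=> M)) by cont.
have cr3 : continuous (fun y : R => Int 0 (pi / 2) (fun=> M)) by exact: cont_cst.
by rewrite (IntD _ _ cl2 cl3) (IntD _ _ cr2 cr3) e2 => /addIr.
Qed.

(** The distance from the origin to [(p, a)] is a 1-Lipschitz function of [a]. *)
Lemma sqrt_sum_lipschitz (p a b : R) :
  `|Num.sqrt (p ^+ 2 + a ^+ 2) - Num.sqrt (p ^+ 2 + b ^+ 2)| <= `|a - b|.
Proof.
have Aa (c : R) : `|c| <= Num.sqrt (p ^+ 2 + c ^+ 2).
  by rewrite -sqrtr_sqr ler_sqrt ?addr_ge0 ?sqr_ge0 // lerDr sqr_ge0.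
have A2 (c : R) : Num.sqrt (p ^+ 2 + c ^+ 2) ^+ 2 = p ^+ 2 + c ^+ 2.
  by rewrite sqr_sqrtr // addr_ge0 ?sqr_ge0.
have ha := Aa a; have hb := Aa b; have ha2 := A2 a; have hb2 := A2 b.
move: ha hb ha2 hb2; set A := Num.sqrt _; set B := Num.sqrt _ => ha hb ha2 hb2.
have A0 : 0 <= A by apply: le_trans ha.
have B0 : 0 <= B by apply: le_trans hb.
have [AB0|AB0] := eqVneq (A + B) 0.
  have -> : A = 0 by lra.
  have -> : B = 0 by lra.
  by rewrite subrr normr0.
have ABp : 0 < A + B by rewrite lt_def AB0 addr_ge0.
rewrite -(ler_pM2r ABp) -{1}(gtr0_norm ABp) -normrM.
have -> : (A - B) * (A + B) = (a - b) * (a + b).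
  have -> : (A - B) * (A + B) = A ^+ 2 - B ^+ 2 by ring.
  by rewrite ha2 hb2; ring.
rewrite normrM ler_wpM2l //; apply: le_trans (ler_normD _ _) _; exact: lerD.
Qed.

(** By [abel_exchange] the equation becomes the Volterra equation
    [int_0^x u(y) H(x, y) dy = 0], where [H] is Lipschitz in [x] and
    [H(x, x) = (pi / 2) K(x, x)].  Since [K] is not assumed differentiable, difference
    quotients replace the derivative in [x].  Let [m] be the maximum of [|u|] on
    [[s, s + d]], attained at [xm].  The mean of [u H(xm, .)] over [[xm, xm + h]] is at
    most [L' (m d + B h)]; as [h] tends to 0, [m |H(xm, xm)| <= L' m d], so that
    [m = 0] when [d] is small. *)
Lemma abel_local_uniqueness (K : R -> R -> R) (u : R -> R) (s eta L M B : R) :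
  0 < s -> 0 < eta ->
  continuous (fun z : R * R => K z.1 z.2) -> (forall r y, `|K r y| <= M) ->
  (forall r r' y, `|K r y - K r' y| <= L * `|r - r'|) -> K s s != 0 ->
  continuous u -> (forall y, `|u y| <= B) -> (forall y, y <= s -> u y = 0) ->
  (forall r, s <= r <= s + eta ->
     Int 0 (pi / 2) (fun t => K r (r * sin t) * u (r * sin t)) = 0) ->
  exists2 d, 0 < d & forall y, y <= s + d -> u y = 0.
Proof.
move=> s0 eta0 cK KM KL Ks cu uB us abel.
have B0 : 0 <= B := le_trans (normr_ge0 _) (uB 0).
have M0 : 0 <= M := le_trans (normr_ge0 _) (KM 0 0).
have L0 : 0 <= L by have := le_trans (normr_ge0 _) (KL 1 0 0); rewrite subr0 normr1 mulr1.
pose rr x y t : R := Num.sqrt (y ^+ 2 + (x ^+ 2 - y ^+ 2) * sin t ^+ 2).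
pose H x y := Int 0 (pi / 2) (fun t => K (rr x y t) y).
have cH : continuous (fun z : R * R => H z.1 z.2).
  apply: Int_param_cont => /=.
  apply: (cont_comp (f := fun z : R * R * R => (rr z.1.1 z.1.2 z.2, z.1.2)) _ cK).
  by rewrite /rr; cont.
have cKt x y : continuous (fun t => K (rr x y t) y).
  by apply: (cont_comp (f := fun t : R => (rr x y t, y)) _ cK); rewrite /rr; cont.
have cHx x : continuous (H x) by exact: cont_section cH.
have Psi0 x : s <= x <= s + eta -> Int 0 x (fun y => u y * H x y) = 0.
  move=> xI; have x0 : 0 < x by lra.
  have cQ : continuous (fun z : R * R => K z.1 z.2 * u z.2) by cont.
  have QB r y : `|K r y * u y| <= M * B by rewrite normrM ler_pM.
  have := @abel_exchange (fun r y => K r y * u y) x (M * B) x0 cQ QB.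
  rewrite (eq_Int (g := fun=> 0)); last first.
    move=> t tI; have t0 : 0 <= sin t by apply: sin_ge0_pi; have := pi_gt0 R; lra.
    have xt : x * sin t <= x by rewrite -[leRHS]mulr1 ler_pM2l // sin_le1.
    have [r1|r1] := leP s (x * sin t); first by rewrite abel ?mulr0 //; lra.
    rewrite (eq_Int (g := fun=> 0)) ?Int0 ?mulr0 // => t' t'I.
    rewrite us ?mulr0 //; apply: le_trans (ltW r1).
    by rewrite -[leRHS]mulr1 ler_wpM2l ?sin_le1 // mulr_ge0 // ltW.
  rewrite Int0 => /esym; rewrite (eq_Int (g := fun y => u y * H x y)) //.
  move=> y _; rewrite -IntZ; last exact: cKt.
  by apply: eq_Int => t _; rewrite mulrC.
pose L' := L * (pi / 2).
have L'0 : 0 <= L' by rewrite mulr_ge0 // ltW.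
have HL x x' y : 0 <= x -> 0 <= x' -> `|H x y - H x' y| <= L' * `|x - x'|.
  move=> x0 x'0; rewrite /H -IntB; [|exact: cKt|exact: cKt].
  rewrite /L' mulrAC -[pi / 2 as X in _ * X]subr0.
  apply: Int_norm_le; [exact: ltW|by apply: contD; [exact: cKt|apply: contN; exact: cKt]|].
  move=> t _; apply: le_trans (KL _ _ _) _; rewrite ler_wpM2l // /rr.
  have e z : y ^+ 2 + (z ^+ 2 - y ^+ 2) * sin t ^+ 2 = (y * cos t) ^+ 2 + (z * sin t) ^+ 2.
    by rewrite !exprMn cos2sin2; ring.
  rewrite !e; apply: le_trans (sqrt_sum_lipschitz _ _ _) _.
  rewrite -mulrBl normrM -[leRHS]mulr1 ler_wpM2l //.
  by rewrite ler_norml sin_le1 sin_geN1.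
have HxxE x : 0 <= x -> H x x = K x x * (pi / 2).
  move=> x0; rewrite /H (eq_Int (g := fun=> K x x)); last first.
    by move=> t _; rewrite /rr subrr mul0r addr0 sqrtr_sqr ger0_norm.
  by rewrite Int_cst ?subr0 // ltW.
pose c := `|K s s| / 2.
have c0 : 0 < c by rewrite divr_gt0 // normr_gt0.
have [d1 d10 Kd1] : exists2 d1, 0 < d1 & forall x, s <= x <= s + d1 -> c <= `|K x x|.
  have cD : continuous (fun x : R => K x x).
    by apply: (cont_comp (f := fun x : R => (x, x)) _ cK); cont.
  have /cvgrPdist_lt /(_ _ c0) := cD s => -[e /= e0 he].
  exists (e / 2); first by lra.
  move=> x xI; have /he /= : `|s - x| < e by rewrite ltr_norml; lra.
  move=> h.
  have := lerB_dist (K s s) (K x x); rewrite /c in h *; lra.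
(* The last term makes [L d] smaller than the lower bound [c] of [|K|] on the diagonal. *)
pose d := Num.min (eta / 2) (Num.min d1 (c / (2 * (L + 1)))).
have L1 : 0 < 2 * (L + 1) by lra.
have d0 : 0 < d by rewrite !lt_min d10 (divr_gt0 c0 L1) !andbT divr_gt0.
have deta : d <= eta / 2 by rewrite /d ge_min lexx.
have dd1 : d <= d1 by rewrite /d !ge_min lexx orbT.
have dc : L * d <= c / 2.
  have : d <= c / (2 * (L + 1)) by rewrite /d !ge_min lexx !orbT.
  rewrite ler_pdivlMr; last by lra.
  by nra.
exists d => //.
have cnu : continuous (fun y => `|u y|) by cont.
have [xm xmI xmax] := @EVT_max R (fun y => `|u y|) s (s + d) ltac:(lra) (continuous_subspaceT cnu).
move: xmI; rewrite in_itv /= => xmI.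
pose m := `|u xm|.
have um y : s <= y <= s + d -> `|u y| <= m by move=> yI; apply: xmax; rewrite in_itv.
have m0 : 0 <= m by exact: normr_ge0.
suff mz : m = 0.
  move=> y yd; have [ys|sy] := leP y s; first exact: us.
  by apply/eqP; rewrite -normr_le0 -mz um // ltW.
pose v y := u y * H xm y.
have cv : continuous v by apply: contM.
(* The equations at [xm] and [xm + h] are subtracted, and [u] vanishes on [[0, s]]. *)
have small h : 0 < h -> h <= eta / 2 -> `|Int xm (xm + h) v| <= L' * h * (m * d + B * h).
  move=> h0 he.
  have x1 : 0 <= xm by lra.
  have x2 : 0 <= xm + h by lra.
  have xh : `|xm - (xm + h)| = h by rewrite opprD addNKr normrN (gtr0_norm h0).
  have I1 : 0 <= xm <= xm + h by lra.
  have I2 : 0 <= s <= xm + h by lra.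
  have I3 : s <= xm <= xm + h by lra.
  have sxm : s <= xm by lra.
  have xmh : xm <= xm + h by lra.
  have xmd : xm - s <= d by lra.
  have um' y : s <= y <= xm -> `|u y| <= m by move=> yI; apply: um; lra.
  have J1 : s <= xm <= s + eta by lra.
  have J2 : s <= xm + h <= s + eta by lra.
  have P1 := Psi0 xm J1; have P2 := Psi0 (xm + h) J2.
  have cw : continuous (fun y => u y * H (xm + h) y) by apply: contM.
  have E : Int xm (xm + h) v = Int 0 (xm + h) (fun y => v y - u y * H (xm + h) y).
    by rewrite (IntB _ _ cv cw) P2 subr0 (Int_cat I1 cv) P1 add0r.
  have cdw : continuous (fun y => v y - u y * H (xm + h) y) by cont.
  have Z : Int 0 s (fun y => v y - u y * H (xm + h) y) = 0.
    rewrite (eq_Int (g := fun=> 0)) ?Int0 // => y /andP[_ ys].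
    by rewrite /v (us y ys) !mul0r subrr.
  rewrite E (Int_cat I2 cdw) Z add0r (Int_cat I3 cdw).
  have bd y b : `|u y| <= b -> `|v y - u y * H (xm + h) y| <= b * (L' * h).
    move=> ub; rewrite /v -mulrBr normrM; apply: (ler_pM (normr_ge0 _) (normr_ge0 _) ub).
    have hl := HL xm (xm + h) y x1 x2; rewrite xh in hl; exact: hl.
  apply: le_trans (ler_normD _ _) _.
  have bd1 y : s <= y <= xm -> `|v y - u y * H (xm + h) y| <= m * (L' * h).
    by move=> yI; exact: (bd y m (um' y yI)).
  have bd2 y : xm <= y <= xm + h -> `|v y - u y * H (xm + h) y| <= B * (L' * h).
    by move=> yI; exact: (bd y B (uB y)).
  have b1 := Int_norm_le sxm cdw bd1.
  have b2 := Int_norm_le xmh cdw bd2.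
  apply: le_trans (lerD b1 b2) _.
  have -> : L' * h * (m * d + B * h) = m * (L' * h) * d + B * (L' * h) * (xm + h - xm) by ring.
  rewrite lerD2r; apply: ler_wpM2l xmd.
  exact: (mulr_ge0 m0 (mulr_ge0 L'0 (ltW h0))).
have vm : `|v xm| <= L' * (m * d).
  rewrite leNgt; apply/negP => gap.
  pose e := (`|v xm| - L' * (m * d)) / 3.
  have e0 : 0 < e by rewrite divr_gt0 // subr_gt0.
  have /cvgrPdist_lt /(_ _ e0) := cv xm => -[w /= w0 hw].
  pose h := Num.min (w / 2) (Num.min (eta / 2) (e / (L' * B + 1))).
  have LB : 0 <= L' * B by rewrite mulr_ge0.
  have h0 : 0 < h by rewrite !lt_min !divr_gt0 //; lra.
  have hw2 : h <= w / 2 by rewrite /h ge_min lexx.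
  have he2 : h <= eta / 2 by rewrite /h !ge_min lexx orbT.
  have hLB : L' * B * h <= e.
    have : h <= e / (L' * B + 1) by rewrite /h !ge_min lexx !orbT.
    by rewrite ler_pdivlMr; [nra|lra].
  have := small h h0 he2.
  have close : `|Int xm (xm + h) (fun y => v y - v xm)| <= e * (xm + h - xm).
    apply: Int_norm_le; [lra|by cont|].
    move=> y yI; rewrite distrC ltW //; apply: hw; rewrite /= ltr_norml; lra.
  have cvm : continuous (fun _ : R => v xm) by exact: cont_cst.
  move: close; rewrite (IntB _ _ cv cvm).
  rewrite Int_cst; last by lra.
  have -> : xm + h - xm = h by ring.
  move=> close bnd.
  have tri : `|v xm| * h <= e * h + `|Int xm (xm + h) v|.
    rewrite -{1}(gtr0_norm h0) -normrM.
    have := ler_normB (Int xm (xm + h) v) (Int xm (xm + h) v - v xm * h).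
    rewrite opprB addrCA subrr addr0; lra.
  have : `|v xm| * h <= h * (e + L' * (m * d) + L' * B * h) by lra.
  rewrite [X in X <= _]mulrC (ler_pM2l h0) => fin.
  have e3 : e * 3 = `|v xm| - L' * (m * d) by rewrite /e divfK.
  by clear -fin e3 hLB e0; lra.
have xm0 : 0 <= xm by lra.
move: vm; rewrite /v normrM -/m HxxE // normrM (gtr0_norm pi2_gt0) /L'.
move=> vm'.
have fin : m * `|K xm xm| * (pi / 2) <= L * d * m * (pi / 2).
  have -> : L * d * m * (pi / 2) = L * (pi / 2) * (m * d) by ring.
  by rewrite -mulrA.
rewrite (ler_pM2r pi2_gt0) in fin.
have ck : c <= `|K xm xm| by apply: Kd1; lra.
have h1 : m * c <= m * `|K xm xm| by apply: ler_wpM2l.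
have h2 : L * d * m <= c / 2 * m by apply: ler_wpM2r.
have h3 : m * c <= 0 by clear -fin h1 h2; lra.
by apply/eqP; rewrite eq_le m0 andbT -(pmulr_lle0 _ c0); exact: h3.
Qed.

End AbelUniqueness.

(** * Functions given on a subset of the line *)
Section Within.
Context {R : realType}.

Lemma continuous_comp_from_within {T U : topologicalType} (D : set U) (f : U -> R) (h : T -> U) :
  {within D, continuous f} -> continuous h -> (forall z, D (h z)) ->
  continuous (fun z => f (h z)).
Proof.
move=> /subspace_continuousP cf ch Dh z.
apply: (@cvg_comp _ _ _ h f _ (within D (nbhs (h z)))); last exact: cf.
move=> B; rewrite /within /= => hB; near=> y.
by have := Dh y; near: y; exact: (ch z _ hB).
Unshelve. all: by end_near. Qed.

Lemma is_derive_within_cvg (D : set R) (f : R -> R) (x l : R) :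
  is_derive_within D f x l -> f y @[y --> within D (nbhs x)] --> f x.
Proof.
move=> fl; apply/cvgrPdist_lt => e e0.
move/cvgrPdist_lt : fl => /(_ 1 ltr01) [d /= d0 hd].
pose k := `|l| + 1.
have k0 : 0 < k by rewrite ltr_wpDl.
exists (Num.min d (e / k)) => /=; first by rewrite lt_min d0 divr_gt0.
move=> y; rewrite /ball_ /= lt_min => /andP[yd ye] Dy.
have [->|yx] := eqVneq y x; first by rewrite subrr normr0.
have := hd y yd yx Dy => /=.
have yx0 : y - x != 0 by rewrite subr_eq0.
move=> h; have : `|(f y - f x) / (y - x)| < k.
  have := ler_normB l (l - (f y - f x) / (y - x)).
  by rewrite opprB addrCA subrr addr0 /k; move=> h'; apply: (le_lt_trans h'); rewrite ltrD2l.
rewrite normrM normfV ltr_pdivrMr ?normr_gt0 // distrC => h2; apply: (lt_trans h2).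
by rewrite mulrC -ltr_pdivlMr // distrC.
Qed.

Lemma C1_on_within_continuous (D : set R) (f : R -> R) :
  C1_on D f -> {within D, continuous f}.
Proof.
move=> [df [dfE _]]; apply/subspace_continuousP => x Dx.
exact: is_derive_within_cvg (dfE x Dx).
Qed.

Lemma is_derive_within_interior (D : set R) (f : R -> R) (x l : R) :
  nbhs x D -> is_derive_within D f x l -> is_derive x (1 : R) f l.
Proof.
move=> [d /= d0 xD] fl; apply/is_derive1P; apply/cvgrPdist_lt => e e0.
move/cvgrPdist_lt : fl => /(_ e e0) [d' /= d'0 hd].
exists (Num.min d d') => /=; first by rewrite lt_min d0.
move=> h; rewrite /ball_ /= sub0r normrN lt_min => /andP[hd1 hd2] h0.
have hx : x - (h + x) = - h by ring.
have b1 : ball_ Num.Def.normr x d' (h + x) by rewrite /ball_ /= hx normrN.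
have b2 : h + x != x by rewrite -subr_eq0 addrK.
have b3 : D (h + x) by apply: xD; rewrite /ball_ /= hx normrN.
by have := hd _ b1 b2 b3; rewrite /= addrK mulrC.
Qed.

Lemma continuous_bounded (a b : R) (f : R -> R) : continuous f ->
  exists M, forall y, a <= y <= b -> `|f y| <= M.
Proof.
move=> cf; have cab : compact (`[a, b] : set R) by exact: segment_compact.
have /compact_bounded[M [Mr HM]] := continuous_compact (continuous_subspaceT cf) cab.
exists (M + 1) => y yab; apply: (HM (M + 1)); first by rewrite ltrDl.
by exists y => //=; rewrite in_itv.
Qed.

Lemma continuous2_bounded (a b : R) (f : R * R -> R) : continuous f ->
  exists M, forall x y, a <= x <= b -> a <= y <= b -> `|f (x, y)| <= M.
Proof.
move=> cf; have cpt : compact (`[a, b] `*` `[a, b] : set (R * R)).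
  by apply: compact_setX; exact: segment_compact.
have /compact_bounded[M [Mr HM]] := continuous_compact (continuous_subspaceT cf) cpt.
exists (M + 1) => x y xab yab; apply: (HM (M + 1)); first by rewrite ltrDl.
by exists (x, y) => //; split; rewrite /= in_itv.
Qed.

(** [sin] is symmetric about [pi / 2]. *)
Lemma Int_reflect (f : R -> R) : continuous f ->
  Int 0 pi (fun t => f (sin t)) = 2 * Int 0 (pi / 2) (fun t => f (sin t)).
Proof.
move=> cf; have cfs : continuous (fun t => f (sin t)) by cont.
have p2 : 0 <= pi / 2 :> R by rewrite divr_ge0 // pi_ge0.
have pg : 0 <= pi :> R by exact: pi_ge0.
have I1 : (0 : R) <= (pi : R) / 2 <= (pi : R) by rewrite p2 /=; move: pg; move: (pi) => P; lra.
rewrite (Int_cat I1 cfs).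
suff -> : Int (pi / 2) pi (fun t => f (sin t)) = Int 0 (pi / 2) (fun t => f (sin t)) by ring.
rewrite /Int /Rintegral; congr fine.
pose F (t : R) : R := pi - t.
have dF : derive1 F = cst (-1).
  apply/funext => t; rewrite derive1E.
  have [_ ->] : is_derive t (1 : R) F (-1); last by [].
  by have := derD (derC t pi) (derN (derI t)); move/is_derive_eq; apply; rewrite add0r.
have cF : continuous F by apply: contD; [exact: cont_cst|exact: (contN (f := fun x : R => x) cont_id)].
have := @integration_by_substitution_decreasing R F (fun t => f (sin t)) 0 (pi / 2) p2.
have F0 : F 0 = pi by rewrite /F subr0.
have F1 : F (pi / 2) = pi / 2 by rewrite /F; field.
rewrite F0 F1 => ->.
- apply: eq_integral => t _; congr EFin; rewrite fctE dF /=.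
  have -> : sin (F t) = sin t by rewrite /F sinB sinpi cospi mul0r mulN1r sub0r opprK.
  by rewrite -[(- cst (-1)) t]/(- (-1)) opprK mulr1.
- by move=> x y _ _ xy; rewrite /F ltrD2l ltrN2.
- by rewrite dF => x _; exact: cst_continuous.
- by rewrite dF; exact: is_cvg_cst.
- by rewrite dF; exact: is_cvg_cst.
- split.
  + by move=> x _; have := derD (derC x pi) (derN (derI x)); case.
  + by apply: cvg_at_right_filter; exact: cF.
  + by apply: cvg_at_left_filter; exact: cF.
- exact: continuous_subspaceT.
Qed.

End Within.

(** * Lipschitz kernels on a triangle *)
Section LipschitzKernels.
Context {R : realType}.
Variables s T : R.

(** Bounded and Lipschitz in the first variable, uniformly on the triangle
    [s <= y <= r <= T]. *)
Definition lipschitz_kernel (k : R -> R -> R) : Prop :=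
  exists M L : R, 0 <= M /\ 0 <= L /\
  forall r r' y, s <= y -> y <= r <= T -> y <= r' <= T ->
    `|k r y| <= M /\ `|k r y - k r' y| <= L * `|r - r'|.

Lemma lipschitz_kernel_cst (a : R -> R) (M : R) :
  (forall y, s <= y <= T -> `|a y| <= M) -> lipschitz_kernel (fun _ y => a y).
Proof.
move=> aM; exists `|M|, 0; split => //; split => // r r' y sy yr yr'.
rewrite subrr normr0 mul0r; split => //.
apply: le_trans (ler_norm M); apply: aM; rewrite sy /=.
by case/andP: yr; exact: le_trans.
Qed.

Lemma lipschitz_kernelM k1 k2 : lipschitz_kernel k1 -> lipschitz_kernel k2 ->
  lipschitz_kernel (fun r y => k1 r y * k2 r y).
Proof.
move=> [M1 [L1 [M10 [L10 h1]]]] [M2 [L2 [M20 [L20 h2]]]].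
exists (M1 * M2), (L1 * M2 + M1 * L2); split; first exact: mulr_ge0.
split; first by apply: addr_ge0; apply: mulr_ge0.
move=> r r' y sy yr yr'; have [a1 b1] := h1 r r' y sy yr yr'.
have [a2 b2] := h2 r r' y sy yr yr'; have [a1' _] := h1 r' r y sy yr' yr.
split; first by rewrite normrM; exact: ler_pM.
have -> : k1 r y * k2 r y - k1 r' y * k2 r' y =
  (k1 r y - k1 r' y) * k2 r y + k1 r' y * (k2 r y - k2 r' y) by ring.
apply: le_trans (ler_normD _ _) _; rewrite !normrM.
have -> : (L1 * M2 + M1 * L2) * `|r - r'| = L1 * `|r - r'| * M2 + M1 * (L2 * `|r - r'|) by ring.
by apply: lerD; apply: ler_pM.
Qed.

Lemma lipschitz_kernelD k1 k2 : lipschitz_kernel k1 -> lipschitz_kernel k2 ->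
  lipschitz_kernel (fun r y => k1 r y + k2 r y).
Proof.
move=> [M1 [L1 [M10 [L10 h1]]]] [M2 [L2 [M20 [L20 h2]]]].
exists (M1 + M2), (L1 + L2); split; first exact: addr_ge0.
split; first exact: addr_ge0.
move=> r r' y sy yr yr'; have [a1 b1] := h1 r r' y sy yr yr'.
have [a2 b2] := h2 r r' y sy yr yr'; split.
  by apply: le_trans (ler_normD _ _) _; exact: lerD.
have -> : k1 r y + k2 r y - (k1 r' y + k2 r' y) =
  (k1 r y - k1 r' y) + (k2 r y - k2 r' y) by ring.
by rewrite mulrDl; apply: le_trans (ler_normD _ _) _; exact: lerD.
Qed.

Lemma lipschitz_kernel_scalar (c : R) : lipschitz_kernel (fun _ _ => c).
Proof. by apply: (@lipschitz_kernel_cst (fun=> c) `|c|). Qed.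

Lemma lipschitz_kernel_horner (p : {poly R}) k :
  lipschitz_kernel k -> lipschitz_kernel (fun r y => p.[k r y]).
Proof.
move=> hk; elim/poly_ind: p => [|p a IH].
  rewrite (_ : (fun _ => _) = fun _ _ => 0); first exact: lipschitz_kernel_scalar.
  by apply/funext => r; apply/funext => y; rewrite horner0.
rewrite (_ : (fun _ => _) = fun r y => p.[k r y] * k r y + a).
  apply: lipschitz_kernelD; first exact: lipschitz_kernelM.
  exact: lipschitz_kernel_scalar.
by apply/funext => r; apply/funext => y; rewrite hornerMXaddC.
Qed.

Lemma lipschitz_kernel_id : 0 <= s -> lipschitz_kernel (fun r _ => r).
Proof.
move=> s0; exists `|T|, 1; split => //; split => // r r' y sy yr yr'.
rewrite mul1r; split => //; have [h1 h2] := andP yr.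
have r0 : 0 <= r by apply: le_trans h1; apply: le_trans sy.
by rewrite (ger0_norm r0); apply: le_trans h2 (ler_norm T).
Qed.

Lemma lipschitz_kernel_inv : 0 < s -> lipschitz_kernel (fun r _ => r^-1).
Proof.
move=> s0; exists s^-1, (s^-1 * s^-1).
have si : 0 <= s^-1 by rewrite invr_ge0 ltW.
split => //; split; first exact: mulr_ge0.
move=> r r' y sy /andP[yr rT] /andP[yr' r'T].
have sr : s <= r by apply: le_trans yr.
have sr' : s <= r' by apply: le_trans yr'.
have r0 : 0 < r by apply: lt_le_trans sr.
have r0' : 0 < r' by apply: lt_le_trans sr'.
have ri : r^-1 <= s^-1 by rewrite lef_pV2.
have ri' : r'^-1 <= s^-1 by rewrite lef_pV2.
have p1 : 0 <= r^-1 by rewrite invr_ge0 ltW.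
have p2 : 0 <= r'^-1 by rewrite invr_ge0 ltW.
split; first by rewrite ger0_norm.
have -> : r^-1 - r'^-1 = r^-1 * r'^-1 * (r' - r) by field; rewrite !gt_eqF.
rewrite !normrM distrC (ger0_norm p1) (ger0_norm p2).
by apply: ler_wpM2r => //; apply: ler_pM.
Qed.

(** The lower bound [kappa^2] keeps the argument away from the singularity of the square
    root. *)
Lemma lipschitz_kernel_sqrt k (kappa : R) : 0 < kappa ->
  (forall r y, s <= y -> y <= r <= T -> kappa ^+ 2 <= k r y) ->
  lipschitz_kernel k -> lipschitz_kernel (fun r y => Num.sqrt (k r y)).
Proof.
move=> k0 kk [M [L [M0 [L0 h]]]].
exists (M / kappa), (L / kappa); split; first by rewrite divr_ge0 // ltW.
split; first by rewrite divr_ge0 // ltW.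
move=> r r' y sy yr yr'; have [a b] := h r r' y sy yr yr'.
have q1 : kappa <= Num.sqrt (k r y).
  by rewrite -(gtr0_norm k0) -sqrtr_sqr; apply: ler_wsqrtr; exact: kk.
have q2 : kappa <= Num.sqrt (k r' y).
  by rewrite -(gtr0_norm k0) -sqrtr_sqr; apply: ler_wsqrtr; exact: kk.
have kge z : y <= z <= T -> 0 <= k z y.
  by move=> zI; apply: le_trans (kk z y sy zI); rewrite sqr_ge0.
have e1 : Num.sqrt (k r y) ^+ 2 = k r y by rewrite sqr_sqrtr // kge.
have e2 : Num.sqrt (k r' y) ^+ 2 = k r' y by rewrite sqr_sqrtr // kge.
move: q1 q2 e1 e2; move: (Num.sqrt (k r y)) (Num.sqrt (k r' y)) => A B q1 q2 e1 e2.
have A0 : 0 < A by apply: lt_le_trans q1.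
have B0 : 0 < B by apply: lt_le_trans q2.
split.
  rewrite (gtr0_norm A0) ler_pdivlMr //.
  apply: (@le_trans _ _ (A * A)); first by rewrite ler_pM2l.
  by rewrite -expr2 e1; apply: le_trans (ler_norm _) a.
rewrite mulrAC ler_pdivlMr //.
apply: (@le_trans _ _ (`|A - B| * (A + B))).
  by apply: ler_wpM2l => //; rewrite -[kappa]addr0; apply: lerD => //; exact: ltW.
rewrite -(gtr0_norm (addr_gt0 A0 B0)) -normrM.
have -> : (A - B) * (A + B) = k r y - k r' y by rewrite -e1 -e2; ring.
exact: b.
Qed.

End LipschitzKernels.

(** * Uniqueness for the radial equation *)
Section RadialUniqueness.
Context {R : realType}.

(** The retraction of the line onto [[lo, hi]]; it extends functions known on part
    of the line or of the plane. *)
Definition clamp (lo hi x : R) : R := Num.max lo (Num.min x hi).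

Lemma clamp_itv lo hi x : lo <= hi -> lo <= clamp lo hi x <= hi.
Proof.
by move=> h; rewrite /clamp le_max lexx /= ge_max h /= ge_min lexx orbT.
Qed.

Lemma clamp_id lo hi x : lo <= x <= hi -> clamp lo hi x = x.
Proof. by move=> /andP[h1 h2]; rewrite /clamp (min_idPl h2) (max_idPr h1). Qed.

Lemma clamp_lo lo hi x : x <= lo -> clamp lo hi x = lo.
Proof.
move=> h; rewrite /clamp; apply: max_idPl.
by rewrite ge_min h.
Qed.

Lemma max_lipschitz (a x y : R) : `|Num.max a x - Num.max a y| <= `|x - y|.
Proof.
have h1 := ler_norm (x - y); have h2 := ler_norm (y - x); rewrite (distrC y x) in h2.
have h3 := normr_ge0 (x - y).
by rewrite ler_norml; case: (leP a x) => ax; case: (leP a y) => ay; lra.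
Qed.

Lemma min_lipschitz (a x y : R) : `|Num.min x a - Num.min y a| <= `|x - y|.
Proof.
have h1 := ler_norm (x - y); have h2 := ler_norm (y - x); rewrite (distrC y x) in h2.
have h3 := normr_ge0 (x - y).
by rewrite ler_norml; case: (leP x a) => ax; case: (leP y a) => ay; lra.
Qed.

Lemma clamp_lipschitz lo hi x y : `|clamp lo hi x - clamp lo hi y| <= `|x - y|.
Proof. exact: le_trans (max_lipschitz _ _ _) (min_lipschitz _ _ _). Qed.

Section Local.
Variables (A : set R) (w : R -> R -> R) (g dg : R -> R) (Q : {poly R}) (s T : R).
Hypotheses (s_gt0 : 0 < s) (sT : s < T) (T1 : T < 1)
  (A_ge0 : forall x, A x -> 0 <= x) (A_itv : forall x, s <= x <= T -> A x)
  (cg : {within `[0, 1[, continuous g}) (cdg : {within `[0, 1[, continuous dg})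
  (g_gt0 : forall x, 0 <= x < 1 -> 0 < g x)
  (hW : W_C1_in_r A w) (hWd : forall x, A x -> weight_W w x x != 0)
  (Q0 : Q.[0] != 0).

Let sT' : s <= T. Proof. exact: ltW. Qed.
Let T_gt0 : 0 < T. Proof. exact: lt_trans sT. Qed.

(** The map [(r, y) -> (proj_r r y, proj_y y)] retracts the plane onto the triangle
    [s <= y <= r <= T], where the weight is controlled. *)
Definition proj_y (y : R) := clamp s T y.
Definition proj_r (r y : R) := clamp (proj_y y) T r.

Let proj_y_itv y : s <= proj_y y <= T. Proof. exact: clamp_itv. Qed.
Let proj_r_itv r y : proj_y y <= proj_r r y <= T.
Proof. by apply: clamp_itv; case/andP: (proj_y_itv y). Qed.

Lemma proj_y_01 y : `[0, 1[%classic (proj_y y).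
Proof.
have /andP[h1 h2] := proj_y_itv y; rewrite /= in_itv /=.
by rewrite (le_trans (ltW s_gt0) h1) (le_lt_trans h2 T1).
Qed.

Lemma weight_region_itv r y : s <= y -> y <= r <= T -> weight_region A (r, y).
Proof.
move=> sy /andP[yr rT]; split => /=; first by apply: A_itv; rewrite (le_trans sy yr).
rewrite yr andbT; apply: le_trans sy; apply: inf_lbound; last by apply: A_itv; rewrite lexx.
by exists 0 => x; exact: A_ge0.
Qed.

Lemma proj_region z : weight_region A (proj_r z.1 z.2, proj_y z.2).
Proof. by apply: weight_region_itv; [case/andP: (proj_y_itv z.2)|exact: proj_r_itv]. Qed.

Lemma proj_continuous : continuous (fun z : R * R => (proj_r z.1 z.2, proj_y z.2)).
Proof. by rewrite /proj_r /proj_y /clamp; cont. Qed.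

Lemma proj_y_continuous : continuous proj_y.
Proof. by rewrite /proj_y /clamp; cont. Qed.

(** Mean value theorem in [r], with the derivative bounded on the compact triangle. *)
Lemma weight_lipschitz : lipschitz_kernel s T (weight_W w).
Proof.
have [cW [dW [dWE cdW]]] := hW.
have cW' := continuous_comp_from_within cW proj_continuous proj_region.
have cdW' := continuous_comp_from_within cdW proj_continuous proj_region.
have [M HM] := continuous2_bounded s T cW'.
have [L HL] := continuous2_bounded s T cdW'.
have prE r y : s <= y -> y <= r <= T -> proj_y y = y /\ proj_r r y = r.
  move=> sy /andP[yr rT]; have E : proj_y y = y by apply: clamp_id; rewrite sy (le_trans yr).
  by split=> //; rewrite /proj_r E; apply: clamp_id; rewrite yr.
have Wb r y : s <= y -> y <= r <= T -> `|weight_W w r y| <= `|M|.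
  move=> sy yr; have [e1 e2] := prE r y sy yr; have /andP[yr1 rT] := yr.
  have := HM r y; rewrite /= e1 e2 => h; apply: le_trans (ler_norm M); apply: h.
    by rewrite (le_trans sy yr1).
  by rewrite sy (le_trans yr1).
have dWb r y : s <= y -> y <= r <= T -> `|dW r y| <= `|L|.
  move=> sy yr; have [e1 e2] := prE r y sy yr; have /andP[yr1 rT] := yr.
  have := HL r y; rewrite /= e1 e2 => h; apply: le_trans (ler_norm L); apply: h.
    by rewrite (le_trans sy yr1).
  by rewrite sy (le_trans yr1).
have lip r r' y : s <= y -> y <= r -> r <= r' -> r' <= T ->
    `|weight_W w r' y - weight_W w r y| <= `|L| * (r' - r).
  move=> sy yr; rewrite le_eqVlt => /predU1P[->|rr'] r'T.
    by rewrite !subrr normr0 mulr0.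
  have dWd x : x \in `]r, r'[ -> is_derive x (1 : R) (fun x => weight_W w x y) (dW x y).
    rewrite in_itv /= => /andP[rx xr'].
    have reg : weight_region A (x, y).
      by apply: weight_region_itv => //; rewrite (ltW (le_lt_trans yr rx)) (ltW (lt_le_trans xr' r'T)).
    apply: is_derive_within_interior (dWE x y reg).
    have : nbhs x `]r, r'[%classic by apply: near_in_itvoo; rewrite in_itv /= rx.
    apply: filterS => z /=; rewrite in_itv /= => /andP[rz zr'].
    by apply: weight_region_itv => //; rewrite (ltW (le_lt_trans yr rz)) (ltW (lt_le_trans zr' r'T)).
  have cWy : {within `[r, r'], continuous (fun x => weight_W w x y)}.
    have cWp : continuous (fun x => weight_W w (proj_r x y) (proj_y y)).
      by apply: (cont_comp (f := fun x : R => (x, y)) _ cW'); cont.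
    apply: (@subspace_eq_continuous _ _ _ (fun x => weight_W w (proj_r x y) (proj_y y))); last exact: continuous_subspaceT.
    move=> x /set_mem; rewrite /= in_itv /= => /andP[rx xr'].
    have xI : y <= x <= T by rewrite (le_trans yr rx) (le_trans xr' r'T).
    have [e1 e2] := prE x y sy xI; by rewrite e1 e2.
  have [c cI ->] := MVT rr' dWd cWy.
  move: cI; rewrite in_itv /= => /andP[rc cr'].
  have d0 : 0 < r' - r by rewrite subr_gt0.
  rewrite normrM (gtr0_norm d0) ler_pM2r //; apply: dWb => //.
  by rewrite (ltW (le_lt_trans yr rc)) (ltW (lt_le_trans cr' r'T)).
exists `|M|, `|L|; split => //; split => // r r' y sy yr yr'; split; first exact: Wb.
have /andP[a1 a2] := yr; have /andP[b1 b2] := yr'.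
have [rr'|r'r] := leP r r'.
  rewrite distrC [`|r - r'|]distrC (ger0_norm (_ : 0 <= r' - r)) ?subr_ge0 //.
  exact: lip.
by rewrite (gtr0_norm (_ : 0 < r - r')) ?subr_gt0 //; apply: lip => //; exact: ltW.
Qed.

(** The factor of [u y] in the equation at [y = r sin t], with [sin t] and [cos t ^ 2]
    expressed through [y / r]. *)
Definition radial_kernel (r y : R) : R :=
  weight_W w r y * (g y * (y * r^-1) *
    Num.sqrt (g y ^+ 2 + dg y ^+ 2 * (r ^+ 2 - y ^+ 2)) * Q.[1 - (y * r^-1) ^+ 2]).

Let cgp : continuous (fun y => g (proj_y y)).
Proof. exact: continuous_comp_from_within cg proj_y_continuous proj_y_01. Qed.
Let cdgp : continuous (fun y => dg (proj_y y)).
Proof. exact: continuous_comp_from_within cdg proj_y_continuous proj_y_01. Qed.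

Lemma radial_kernel_lipschitz : lipschitz_kernel s T radial_kernel.
Proof.
have pE y : s <= y <= T -> proj_y y = y by exact: clamp_id.
have [Mg Hg] := continuous_bounded s T cgp.
have [Md Hd] := continuous_bounded s T cdgp.
have lg : lipschitz_kernel s T (fun _ y => g y).
  by apply: (@lipschitz_kernel_cst _ s T g Mg) => y yI; have := Hg y yI; rewrite pE.
have ld : lipschitz_kernel s T (fun _ y => dg y).
  by apply: (@lipschitz_kernel_cst _ s T dg Md) => y yI; have := Hd y yI; rewrite pE.
have ly : lipschitz_kernel s T (fun _ y => y).
  apply: (@lipschitz_kernel_cst _ s T id T) => y /andP[sy yT].
  by rewrite ger0_norm // (le_trans (ltW s_gt0) sy).
have lr := @lipschitz_kernel_id _ s T (ltW s_gt0).
have li := @lipschitz_kernel_inv _ s T s_gt0.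
have lm : lipschitz_kernel s T (fun _ _ => -1) by exact: lipschitz_kernel_scalar.
have l1 : lipschitz_kernel s T (fun _ _ => 1) by exact: lipschitz_kernel_scalar.
have lyr := lipschitz_kernelM ly li.
have lq : lipschitz_kernel s T (fun r y => Q.[1 - (y * r^-1) ^+ 2]).
  apply: lipschitz_kernel_horner.
  rewrite (_ : (fun _ => _) = fun r y => 1 + (-1) * (y * r^-1 * (y * r^-1))).
    by apply: lipschitz_kernelD => //; apply: lipschitz_kernelM => //; exact: lipschitz_kernelM.
  by apply/funext => r; apply/funext => y; rewrite mulN1r expr2.
have cgn : continuous (fun y => g (proj_y y)) by exact: cgp.
have [ym ymI ymin] := EVT_min sT' (continuous_subspaceT cgn).
have ym01 : 0 <= proj_y ym < 1 by have := proj_y_01 ym; rewrite /= in_itv.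
have kap := g_gt0 ym01.
have lsq : lipschitz_kernel s T (fun r y => Num.sqrt (g y ^+ 2 + dg y ^+ 2 * (r ^+ 2 - y ^+ 2))).
  apply: (lipschitz_kernel_sqrt kap).
    move=> r y sy /andP[yr rT].
    have yT : y <= T by exact: le_trans yr rT.
    have gk : g (proj_y ym) <= g y.
      have yI : y \in `[s, T] by rewrite in_itv /= sy yT.
      by have := ymin y yI; rewrite (pE y) // sy yT.
    apply: le_trans (_ : g y ^+ 2 <= _).
      by rewrite ler_sqr ?nnegrE ?(ltW kap) //; exact: le_trans (ltW kap) gk.
    have y0 : 0 <= y by apply: le_trans sy; exact: ltW.
    by rewrite lerDl mulr_ge0 ?sqr_ge0 // subr_ge0 ler_sqr ?nnegrE //; exact: le_trans yr.
  rewrite (_ : (fun _ => _) = fun r y => g y * g y + dg y * dg y * (r * r + (-1) * (y * y))).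
    apply: lipschitz_kernelD; first exact: lipschitz_kernelM.
    apply: lipschitz_kernelM; first exact: lipschitz_kernelM.
    apply: lipschitz_kernelD; first exact: lipschitz_kernelM.
    by apply: lipschitz_kernelM => //; exact: lipschitz_kernelM.
  by apply/funext => r; apply/funext => y; rewrite !expr2 mulN1r.
apply: (lipschitz_kernelM weight_lipschitz).
apply: lipschitz_kernelM lq; apply: lipschitz_kernelM lsq.
exact: lipschitz_kernelM.
Qed.

Lemma radial_kernel_continuous :
  continuous (fun z : R * R => radial_kernel (proj_r z.1 z.2) (proj_y z.2)).
Proof.
have [cW _] := hW.
have cW' := continuous_comp_from_within cW proj_continuous proj_region.
have cr : continuous (fun z : R * R => proj_r z.1 z.2) by rewrite /proj_r /proj_y /clamp; cont.
have cy : continuous (fun z : R * R => proj_y z.2) by rewrite /proj_y /clamp; cont.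
have cg2 : continuous (fun z : R * R => g (proj_y z.2)).
  by apply: (cont_comp (f := fun z : R * R => z.2) _ cgp); cont.
have cd2 : continuous (fun z : R * R => dg (proj_y z.2)).
  by apply: (cont_comp (f := fun z : R * R => z.2) _ cdgp); cont.
have ci : continuous (fun z : R * R => (proj_r z.1 z.2)^-1).
  move=> z; apply: cvgV; last exact: cr.
  have /andP[h1 h2] := proj_r_itv z.1 z.2; have /andP[h3 h4] := proj_y_itv z.2.
  by rewrite gt_eqF // (lt_le_trans s_gt0) // (le_trans h3).
have cyr := contM cy ci.
have cq : continuous (fun z : R * R => Q.[1 - (proj_y z.2 * (proj_r z.1 z.2)^-1) ^+ 2]).
  have cp : continuous (fun x : R => Q.[x]) by exact: continuous_horner.
  by apply: (cont_comp (f := fun z : R * R => 1 - (proj_y z.2 * (proj_r z.1 z.2)^-1) ^+ 2) _ cp); cont.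
have cs : continuous (fun z : R * R => Num.sqrt (g (proj_y z.2) ^+ 2 +
   dg (proj_y z.2) ^+ 2 * (proj_r z.1 z.2 ^+ 2 - proj_y z.2 ^+ 2))) by cont.
apply: (contM cW'); apply: contM cq; apply: contM cs.
exact: (contM cg2 cyr).
Qed.

(** On the diagonal [t = pi / 2], so the polynomial is evaluated at [cos t ^ 2 = 0]. *)
Lemma radial_kernel_diag : radial_kernel s s != 0.
Proof.
have s01 : 0 <= s < 1 by rewrite (ltW s_gt0) (lt_trans sT).
have gs := g_gt0 s01.
rewrite /radial_kernel (mulfV (lt0r_neq0 s_gt0)) mulr1 expr1n !subrr mulr0 addr0 sqrtr_sqr.
rewrite (gtr0_norm gs); apply: mulf_neq0.
  by apply: hWd; apply: A_itv; rewrite lexx.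
by apply: mulf_neq0 => //; apply: mulf_neq0; rewrite gt_eqF.
Qed.

Variable u : R -> R.
Hypotheses (cu : {within `[0, 1[, continuous u}) (w_repr : represented_by_W A w)
  (u_before : forall y, 0 <= y <= s -> u y = 0)
  (equation : forall r, 0 < r < 1 ->
     Int 0 pi (fun t => w r t * (g (r * `|sin t|) * sin t *
       Num.sqrt (g (r * `|sin t|) ^+ 2 + (dg (r * `|sin t|) * (r * cos t)) ^+ 2) *
       (Q.[cos t ^+ 2] * u (r * `|sin t|)))) = 0).

(** As [u] vanishes on [[0, s]], the equation at [r <= T] involves the kernel on the
    triangle [s <= y <= r <= T] only, where it agrees with its extension to the
    plane. *)
Lemma radial_local_step : exists2 d, 0 < d & forall y, s <= y <= s + d -> y <= T -> u y = 0.
Proof.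
pose K r y := radial_kernel (proj_r r y) (proj_y y).
pose v y := u (proj_y y).
have cK : continuous (fun z : R * R => K z.1 z.2) by exact: radial_kernel_continuous.
have [M [L [M0 [L0 lip]]]] := radial_kernel_lipschitz.
have KM r y : `|K r y| <= M.
  have /andP[h1 h2] := proj_y_itv y.
  by have [] := lip _ _ _ h1 (proj_r_itv r y) (proj_r_itv r y).
have KL r r' y : `|K r y - K r' y| <= L * `|r - r'|.
  have /andP[h1 h2] := proj_y_itv y.
  have [_ h] := lip _ _ _ h1 (proj_r_itv r y) (proj_r_itv r' y).
  by apply: (le_trans h); apply: ler_wpM2l => //; exact: clamp_lipschitz.
have ps : proj_y s = s by apply: clamp_id; rewrite lexx.
have Ks : K s s != 0.
  by rewrite /K /proj_r ps clamp_id ?lexx //; exact: radial_kernel_diag.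
have cv : continuous v.
  exact: continuous_comp_from_within cu proj_y_continuous proj_y_01.
have [B vB'] := continuous_bounded s T cv.
have vB y : `|v y| <= B.
  have := vB' (proj_y y) (proj_y_itv y); rewrite /v.
  by rewrite (_ : proj_y (proj_y y) = proj_y y) //; apply: clamp_id; exact: proj_y_itv.
have us : u s = 0 by apply: u_before; rewrite lexx ltW.
have vs y : y <= s -> v y = 0 by move=> ys; rewrite /v /proj_y clamp_lo.
have abel r : s <= r <= s + (T - s) ->
    Int 0 (pi / 2) (fun t => K r (r * sin t) * v (r * sin t)) = 0.
  rewrite subrKC => /andP[sr rT].
  have r0 : 0 < r by apply: lt_le_trans sr.
  have r01 : 0 < r < 1 by rewrite r0 (le_lt_trans rT).
  pose h (x : R) := K r (r * x) * v (r * x).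
  have ch : continuous h.
    apply: contM.
      by apply: (cont_comp (f := fun x : R => (r, r * x)) _ cK); cont.
    by apply: (cont_comp (f := fun x : R => r * x) _ cv); cont.
  have half := Int_reflect ch.
  suff full : Int 0 pi (fun t => h (sin t)) = 0.
    rewrite full in half; apply/eqP; move/esym/eqP: half.
    by rewrite mulf_eq0 pnatr_eq0.
  rewrite -[RHS](equation r01); apply: eq_Int => t tI.
  have st0 : 0 <= sin t by exact: sin_ge0_pi.
  rewrite (ger0_norm st0) /h.
  have rst : r * sin t <= r by rewrite -[leRHS]mulr1 ler_pM2l // sin_le1.
  have rs0 : 0 <= r * sin t by rewrite mulr_ge0 // ltW.
  have [rs|sr'] := leP (r * sin t) s.
    by rewrite vs // (u_before (y := r * sin t)) ?rs0 // !mulr0.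
  have yT : r * sin t <= T by exact: le_trans rT.
  have py : proj_y (r * sin t) = r * sin t by apply: clamp_id; rewrite (ltW sr').
  have pr : proj_r r (r * sin t) = r by rewrite /proj_r py clamp_id // rst.
  have reg : weight_region A (r, r * sin t) by apply: weight_region_itv; [exact: ltW|rewrite rst].
  rewrite /K /v pr py (w_repr tI reg) /radial_kernel.
  have -> : r * sin t * r^-1 = sin t by rewrite mulrAC divff ?mul1r // gt_eqF.
  have -> : (dg (r * sin t) * (r * cos t)) ^+ 2 = dg (r * sin t) ^+ 2 * (r ^+ 2 - (r * sin t) ^+ 2).
    by rewrite !exprMn cos2sin2; ring.
  by rewrite cos2sin2; ring.
have eta0 : 0 < T - s by rewrite subr_gt0.
have [d d0 hd] := abel_local_uniqueness s_gt0 eta0 cK KM KL Ks cv vB vs abel.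
exists d => // y /andP[sy yd] yT.
by have := hd y yd; rewrite /v /proj_y clamp_id // sy.
Qed.

End Local.
End RadialUniqueness.

Section RadialGlobal.
Context {R : realType}.

Lemma within_open_near (g : R -> R) (O : set R) (s : R) :
  {within `[0, 1[, continuous g} -> 0 <= s < 1 -> open O -> O (g s) ->
  exists2 d, 0 < d & forall y, 0 <= y < 1 -> `|s - y| < d -> O (g y).
Proof.
move=> /subspace_continuousP cg sI oO Os.
have sI' : `[0, 1[%classic s by rewrite /= in_itv.
have : nbhs (g s) O by apply: open_nbhs_nbhs.
move=> /(cg s sI')[d /= d0 hd]; exists d => // y yI yd.
by apply: (hd y yd); rewrite /= in_itv.
Qed.

(** If [c o g] is not zero, let [s] be the supremum of the [t] such that it vanishes on
    [[0, t]].  Then [g s] belongs to the closed set [Z], otherwise [c o g] would vanish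
    beyond [s].  So [g s] is in [V], hence [s > 0] and the points near [s] are in [A];
    by [radial_local_step], [c o g] vanishes beyond [s] after all. *)
Theorem radial_uniqueness (A V Z : set R) (w : R -> R -> R) (g dg c : R -> R) (Q : {poly R}) :
  (forall x, A x -> 0 <= x) ->
  {within `[0, 1[, continuous g} -> {within `[0, 1[, continuous dg} ->
  (forall x, 0 <= x < 1 -> 0 < g x) ->
  W_C1_in_r A w -> (forall x, A x -> weight_W w x x != 0) -> Q.[0] != 0 ->
  represented_by_W A w ->
  open V -> ~ V (g 0) -> (forall x, 0 <= x < 1 -> V (g x) -> A x) ->
  closed Z -> Z `<=` V -> continuous c -> (forall rho, 0 <= rho -> c rho != 0 -> Z rho) ->
  (forall r, 0 < r < 1 ->
     Int 0 pi (fun t => w r t * (g (r * `|sin t|) * sin t *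
       Num.sqrt (g (r * `|sin t|) ^+ 2 + (dg (r * `|sin t|) * (r * cos t)) ^+ 2) *
       (Q.[cos t ^+ 2] * c (g (r * `|sin t|))))) = 0) ->
  forall x, 0 <= x < 1 -> c (g x) = 0.
Proof.
move=> A0 cg cdg g0 hW hWd Q0 wr oV V0 VA cZ ZV cc cZ0 equation x xI.
pose u y := c (g y).
have uZ y : 0 <= y < 1 -> ~ Z (g y) -> u y = 0.
  move=> yI nZ; apply/eqP; apply: contra_notT nZ => uy.
  by apply: cZ0 => //; exact/ltW/g0.
apply/eqP; apply: contrapT => /negP ux; rewrite -/(u x) in ux.
pose S : set R := [set t | 0 <= t < 1 /\ forall y, 0 <= y <= t -> u y = 0].
have S0 : S 0.
  split; first by rewrite lexx ltr01.
  move=> y; rewrite -eq_le => /eqP <-; apply: uZ; first by rewrite lexx ltr01.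
  by move/ZV.
have Sx t : S t -> t <= x.
  move=> [_ h]; rewrite leNgt; apply/negP => xt; move/eqP: ux; apply; apply: h.
  by rewrite (ltW xt) andbT; case/andP: xI.
have supS : has_sup S by split; [exists 0|exists x => t /Sx].
pose s := sup S.
have s0 : 0 <= s by apply: sup_upper_bound.
have sx : s <= x by apply: sup_le_ub => //; exists 0.
have s1 : s < 1 by apply: (le_lt_trans sx); case/andP: xI.
have sI : 0 <= s < 1 by rewrite s0.
have cu : {within `[0, 1[, continuous u}.
  apply/subspace_continuousP => y yI.
  apply: (@cvg_comp _ _ _ g c _ (nbhs (g y))); last exact: cc.
  by move/subspace_continuousP : cg; apply.
have before y : 0 <= y < s -> u y = 0.
  move=> /andP[y0 ys]; have [t St yt] := sup_gt (ex_intro _ 0 S0 : S !=set0) ys.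
  by apply: St.2; rewrite y0 ltW.
have us : u s = 0.
  have [s00|sn0] := eqVneq s 0; first by rewrite s00; apply: S0.2; rewrite lexx.
  apply/eqP; apply: contrapT => /negP us.
  have oN : open [set z : R | z != 0] by exact: open_neq.
  have [d d0 hd] := within_open_near cu sI oN us.
  have sp : 0 < s by rewrite lt_def sn0.
  pose y := Num.max 0 (s - d / 2).
  have ys : y < s by rewrite /y gt_max sp /= ltrBlDr ltrDl divr_gt0.
  have y0 : 0 <= y by rewrite /y le_max lexx.
  have /eqP := before y (introT andP (conj y0 ys)); apply/negP; apply: hd.
    by rewrite y0 (lt_trans ys s1).
  rewrite gtr0_norm ?subr_gt0 // ltrBlDr -ltrBlDl.
  have : s - d / 2 <= y by rewrite /y le_max lexx orbT.
  by apply: lt_le_trans; rewrite ltrD2l ltrN2 ltr_pdivrMr // ltr_pMr // ltr1n.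
have upto y : 0 <= y <= s -> u y = 0.
  move=> /andP[y0]; rewrite le_eqVlt => /predU1P[->//|ys].
  by apply: before; rewrite y0.
(* The supremum excludes any interval of vanishing beyond [s]. *)
have noext t : s < t -> t < 1 -> (forall y, s <= y <= t -> u y = 0) -> False.
  move=> st t1 h; have : S t.
    split; first by rewrite (ltW (le_lt_trans s0 st)).
    move=> y /andP[y0 yt]; have [ys|sy] := leP y s; first by apply: upto; rewrite y0.
    by apply: h; rewrite (ltW sy).
  by move=> /(sup_upper_bound supS); rewrite leNgt st.
have step d : 0 < d -> exists2 t, s < t < 1 & forall y, s <= y <= t -> 0 <= y < 1 /\ `|s - y| < d.
  move=> d0; exists (Num.min (s + d / 2) ((s + 1) / 2)).
    rewrite lt_min gt_min ltrDl divr_gt0 //=; apply/andP; split; first by clear -s1; lra.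
    by apply/orP; right; clear -s1; lra.
  move=> y; rewrite le_min => /andP[sy /andP[yd y1]].
  split; first by rewrite (le_trans s0 sy) /=; clear -s1 y1; lra.
  rewrite distrC ger0_norm ?subr_ge0 //; clear -yd d0; lra.
have Zs : Z (g s).
  apply: contrapT => nZ.
  have oZ : open (~` Z) by exact: closed_openC.
  have [d d0 hd] := within_open_near cg sI oZ nZ.
  have [t /andP[st t1] ht] := step d d0.
  apply: (noext t st t1) => y /ht[yI yd]; apply: uZ => //; exact: hd.
have Vs : V (g s) by exact: ZV.
have sp : 0 < s.
  by rewrite lt_def s0 andbT; apply/eqP => s00; apply: V0; rewrite -s00.
have [d d0 hd] := within_open_near cg sI oV Vs.
have [T /andP[sT T1] hT] := step d d0.
have AT y : s <= y <= T -> A y by move=> /hT[yI yd]; apply: VA => //; exact: hd.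
have [d' d'0 hd'] := radial_local_step sp sT T1 A0 AT cg cdg g0 hW hWd Q0 cu wr upto equation.
apply: (noext (Num.min (s + d') T)).
- by rewrite lt_min ltrDl d'0.
- by rewrite gt_min T1 orbT.
- by move=> y; rewrite le_min => /andP[sy /andP[y1 y2]]; apply: hd' => //; rewrite sy.
Qed.

End RadialGlobal.

(** * Moments of the transform against null powers *)
Section EvenLegendre.
Context {R : realType}.

(** For even [l], [P_l] is an even function, and up to a nonzero factor [P_l(0)] is the
    coefficient of order [l] of [(X^2 - 1)^l], a signed binomial coefficient. *)
Lemma even_legendre l : ~~ odd l ->
  exists2 Q : {poly R}, Q.[0] != 0 & forall x, (@legendre R l).[x] = Q.[x ^+ 2].
Proof.
move=> el; set q : {poly R} := ('X ^+ 2 - 1) ^+ l.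
have qE : q = ('X - 1) ^+ l \Po 'X^2.
  by rewrite /q rmorphXn /= comp_polyB comp_polyX -[1 in RHS]/(1%:P) comp_polyC.
have c0 : ((2 ^ l * l`!)%:R : R)^-1 != 0.
  by rewrite invr_eq0 pnatr_eq0 -lt0n muln_gt0 expn_gt0 fact_gt0.
have coefL i : (@legendre R l)`_i = (2 ^ l * l`!)%:R^-1 * (q`_(l + i) *+ (l + i) ^_ l).
  by rewrite /legendre coefZ coef_derivn.
exists (even_poly (@legendre R l)).
  rewrite horner_coef0 coef_even_poly coefL mulf_neq0 // addn0 ffactnn qE coef_comp_poly_Xn //.
  rewrite dvdn2 el addrC exprDn coef_sum.
  have hl : (l %/ 2 < l.+1)%N by rewrite ltnS leq_div.
  have sgnE k : (-1 : {poly R}) ^+ k = ((-1) ^+ k)%:P by rewrite polyC_exp polyCN.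
  rewrite (bigD1 (Ordinal hl)) //= big1 => [|i ni].
    rewrite addr0 coefMn sgnE coefCM coefXn eqxx mulr1 -mulrnA mulrn_eq0.
    by rewrite negb_or expf_neq0 ?oppr_eq0 ?oner_eq0 // -lt0n muln_gt0 bin_gt0 leq_div fact_gt0.
  rewrite coefMn sgnE coefCM coefXn.
  rewrite (_ : (_ == _) = false) ?mulr0 ?mul0rn //.
  by apply/negbTE; move: ni; apply: contra_neq => e; exact: val_inj.
have o0 : odd_poly (@legendre R l) = 0.
  apply/polyP => i; rewrite coef_odd_poly coefL coef0 qE coef_comp_poly_Xn // dvdn2.
  by rewrite oddD (negbTE el) /= odd_double /= mul0rn mulr0.
move=> x; rewrite -[in LHS](poly_even_odd (@legendre R l)) o0 comp_poly0 mul0r addr0.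
by rewrite horner_comp hornerXn.
Qed.

End EvenLegendre.

Section SphericalMoments.
Context {R : realType}.
Notation C := (R[i]).
Notation rc := (real_complex R).

Definition dilate (F : R -> R -> R -> R) (rho x y z : R) : R :=
  F (rho * x) (rho * y) (rho * z).

Lemma dilate_C1 (F : R -> R -> R -> R) (rho : R) :
  C1_along_curves F -> C1_along_curves (dilate F rho).
Proof.
move=> [F1 [F2 [F3 [cF c1 c2 c3 dF]]]].
have ch : continuous (fun v : R * R * R => (rho * v.1.1, rho * v.1.2, rho * v.2)) by cont.
exists (fun v => rho * F1 (rho * v.1.1, rho * v.1.2, rho * v.2)),
  (fun v => rho * F2 (rho * v.1.1, rho * v.1.2, rho * v.2)),
  (fun v => rho * F3 (rho * v.1.1, rho * v.1.2, rho * v.2)); split.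
- exact: (cont_comp ch cF).
- by apply: contM; [exact: cont_cst|exact: (cont_comp ch c1)].
- by apply: contM; [exact: cont_cst|exact: (cont_comp ch c2)].
- by apply: contM; [exact: cont_cst|exact: (cont_comp ch c3)].
move=> x y z t dx dy dz hx hy hz.
have := dF _ _ _ t _ _ _ (derM (derC t rho) hx) (derM (derC t rho) hy) (derM (derC t rho) hz).
by move/is_derive_eq; apply; rewrite /=; ring.
Qed.

Lemma dilated_rotation_continuous (F : R -> R -> R -> R) : C1_along_curves F ->
  continuous (fun z : R * (R * R * R * R) => on_rotation (dilate F z.1) z.2).
Proof.
move=> [F1 [F2 [F3 [cF _ _ _ _]]]].
have ch : continuous (fun z : R * (R * R * R * R) =>
    (z.1 * euler_x z.2, z.1 * euler_y z.2, z.1 * euler_z z.2)).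
  by rewrite /euler_x /euler_y /euler_z; cont.
exact: (cont_comp ch cF).
Qed.

Lemma dilated_sphere_continuous (F : R -> R -> R -> R) : C1_along_curves F ->
  continuous (fun z : R * R * R => on_sphere (dilate F z.1.1) z.1.2 z.2).
Proof.
move=> F1; have cF := dilated_rotation_continuous F1.
have ch : continuous (fun z : R * R * R => (z.1.1, (z.1.2, z.2, 0 : R, 0 : R))) by cont.
have := cont_comp ch cF; rewrite (_ : (fun z => _) = fun z : R * R * R => on_sphere (dilate F z.1.1) z.1.2 z.2) //.
by apply/funext => z; rewrite on_rotation0.
Qed.

Lemma sph_weighted_swap (w m : R -> R) (M : R -> R -> R -> R) (q : R -> R -> R) :
  (@lebesgue_measure R).-integrable `[0, pi] (EFin \o w) ->
  continuous m -> continuous (fun z : R * R * R => M z.1.1 z.1.2 z.2) ->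
  continuous (fun z : R * R => q z.1 z.2) ->
  sph (fun a b => Int 0 pi (fun t => w t * (m t * M a b t)) * q a b) =
  Int 0 pi (fun t => w t * (m t * sph (fun a b => M a b t * q a b))).
Proof.
move=> iw cm cM cq.
have cM' (T : topologicalType) (f g h : T -> R) : continuous f -> continuous g -> continuous h ->
    continuous (fun x => M (f x) (g x) (h x)).
  move=> cf cg ch.
  by apply: (cont_comp (f := fun x => (f x, g x, h x)) _ cM); cont.
have cq' (T : topologicalType) (f g : T -> R) : continuous f -> continuous g ->
    continuous (fun x => q (f x) (g x)).
  by move=> cf cg; apply: (cont_comp (f := fun x => (f x, g x)) _ cq); cont.
have step a b : sin b * (Int 0 pi (fun t => w t * (m t * M a b t)) * q a b) =
    Int 0 pi (fun t => w t * (sin b * m t * M a b t * q a b)).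
  rewrite mulrCA mulrC -IntwZ //; last by apply: contM => //; apply: cM'; cont.
  by apply: eq_Int => t _; ring.
rewrite /sph.
rewrite (eq_Int (g := fun a => Int 0 pi (fun t => w t * Int 0 pi (fun b => sin b * m t * M a b t * q a b)))); last first.
  move=> a _; rewrite -(Int_swap_weight _ _ iw); last first.
    apply: contM; first apply: contM; first by cont.
    - by apply: cM'; cont.
    - by apply: cq'; cont.
  by apply: eq_Int => b _; exact: step.
rewrite (Int_swap_weight _ _ iw); last first.
  apply: Int_param_cont.
  apply: contM; first apply: contM; first by cont.
  - by apply: cM'; cont.
  - by apply: cq'; cont.
apply: eq_Int => t _; congr (_ * _); rewrite -IntZ; last first.
  apply: Int_param_cont; apply: contM; first by cont.
  by apply: contM; [apply: cM'; cont|apply: cq'; cont].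
apply: eq_Int => a _; rewrite -IntZ; last first.
  apply: contM; first by cont.
  by apply: contM; [apply: cM'; cont|apply: cq'; cont].
by apply: eq_Int => b _; ring.
Qed.

Definition null_power (s : R) l (a b : R) : C :=
  dotC (null1 s) (null2 s) 1 (sin b * cos a) (sin b * sin a) (cos b) ^+ l.

Lemma null_power_continuous (s : R) l :
  continuous (fun z : R * R => complex.Re (null_power s l z.1 z.2)) /\
  continuous (fun z : R * R => complex.Im (null_power s l z.1 z.2)).
Proof.
have [cr ci] := dotC_power_C1 (null1 s) (null2 s) 1 l.
have h (q : R -> R -> R -> R) : C1_along_curves q ->
    continuous (fun z : R * R => q (sin z.2 * cos z.1) (sin z.2 * sin z.1) (cos z.2)).
  move=> [? [? [? [cq _ _ _ _]]]].
  by apply: (cont_comp (f := fun z : R * R => (sin z.2 * cos z.1, sin z.2 * sin z.1, cos z.2)) _ cq); cont.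
by split; [exact: (h _ cr)|exact: (h _ ci)].
Qed.

Lemma circle_mean_sph (F : R -> R -> R -> R) (s : R) l (rho phi : R) :
  C1_along_curves F -> s != 0 -> 0 < phi < pi ->
  let M a b := Int 0 (2 * pi) (fun c => on_rotation (dilate F rho) (a, b, c, phi)) in
  sph (fun a b => M a b * complex.Re (null_power s l a b)) =
    2 * pi * (@legendre R l).[cos phi] *
    sph (fun a b => on_sphere (dilate F rho) a b * complex.Re (null_power s l a b)) /\
  sph (fun a b => M a b * complex.Im (null_power s l a b)) =
    2 * pi * (@legendre R l).[cos phi] *
    sph (fun a b => on_sphere (dilate F rho) a b * complex.Im (null_power s l a b)).
Proof.
move=> F1 s0 phi0 M.
have := circle_mean_null_power l (dilate_C1 rho F1) (null12 s0) phi0.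
rewrite -/(null_power s l) -/(M _ _).
have -> : sphC (fun a b => rc (M a b) * null_power s l a b) =
  Complex (sph (fun a b => M a b * complex.Re (null_power s l a b)))
          (sph (fun a b => M a b * complex.Im (null_power s l a b))) by exact: sphC_rcM.
have -> : sphC (fun a b => rc (on_sphere (dilate F rho) a b) * null_power s l a b) =
  Complex (sph (fun a b => on_sphere (dilate F rho) a b * complex.Re (null_power s l a b)))
          (sph (fun a b => on_sphere (dilate F rho) a b * complex.Im (null_power s l a b))).
  exact: sphC_rcM.
move=> E; split.
  by have := congr1 (@complex.Re R) E; rewrite Re_rcM.
by have := congr1 (@complex.Im R) E; rewrite Im_rcM.
Qed.

Lemma sph_moment_continuous (F : R -> R -> R -> R) (q : R -> R -> R) :
  C1_along_curves F -> continuous (fun z : R * R => q z.1 z.2) ->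
  continuous (fun rho => sph (fun a b => on_sphere (dilate F rho) a b * q a b)).
Proof.
move=> F1 cq; have cF := dilated_sphere_continuous F1.
have cq2 : continuous (fun z : R * R * R => q z.1.2 z.2).
  by apply: (cont_comp (f := fun z : R * R * R => (z.1.2, z.2)) _ cq); cont.
rewrite /sph; do 2 apply: Int_param_cont.
by apply: contM; [cont|apply: contM].
Qed.

(** The hypothesis is integrated over the sphere against the power of the null form; after
    exchange of the integrals the eigenvalue identity applies at each [t] in ]0, pi[, and
    [m] vanishes at the end points. *)
Lemma null_moment_equation (w m G : R -> R) (F : R -> R -> R -> R) (s : R) l :
  (@lebesgue_measure R).-integrable `[0, pi] (EFin \o w) ->
  continuous m -> continuous G -> m 0 = 0 -> m pi = 0 ->
  C1_along_curves F -> s != 0 ->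
  (forall a b, 0 <= a <= 2 * pi -> 0 <= b <= pi ->
    Int 0 (2 * pi) (fun c => Int 0 pi (fun t =>
      w t * (m t * on_rotation (dilate F (G t)) (a, b, c, t)))) = 0) ->
  let c q rho := sph (fun a b => on_sphere (dilate F rho) a b * q (null_power s l a b)) in
  Int 0 pi (fun t => w t * (m t * (2 * pi * (@legendre R l).[cos t] * c (@complex.Re R) (G t)))) = 0 /\
  Int 0 pi (fun t => w t * (m t * (2 * pi * (@legendre R l).[cos t] * c (@complex.Im R) (G t)))) = 0.
Proof.
move=> iw cm cG m0 mpi F1 s0 SF c.
have cF := dilated_rotation_continuous F1.
have cH : continuous (fun z : R * R * R * R => on_rotation (dilate F (G z.1.2)) (z.1.1.1, z.1.1.2, z.2, z.1.2)).
  by apply: (cont_comp (f := fun z : R * R * R * R => (G z.1.2, (z.1.1.1, z.1.1.2, z.2, z.1.2))) _ cF); cont.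
pose M a b t := Int 0 (2 * pi) (fun c => on_rotation (dilate F (G t)) (a, b, c, t)).
have cM : continuous (fun z : R * R * R => M z.1.1 z.1.2 z.2).
  by apply: Int_param_cont; exact: cH.
have key (q : R -> R -> R) : continuous (fun z : R * R => q z.1 z.2) ->
    Int 0 pi (fun t => w t * (m t * sph (fun a b => M a b t * q a b))) = 0.
  move=> cq; rewrite -(sph_weighted_swap iw cm cM cq).
  rewrite /sph (eq_Int (g := fun=> 0)) ?Int0 // => a aI.
  rewrite (eq_Int (g := fun=> 0)) ?Int0 // => b bI.
  rewrite (_ : Int 0 pi _ = 0) ?mul0r ?mulr0 // -[RHS](SF a b aI bI).
  rewrite (Int_swap_weight _ _ iw); last first.
    apply: contM; first by cont.
    by apply: (cont_comp (f := fun z : R * R => (a, b, z.2, z.1)) _ cH); cont.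
  apply: eq_Int => t _; rewrite IntZ //.
  by apply: (cont_comp (f := fun z : R => (a, b, t, z)) _ cH); cont.
have [cr ci] := null_power_continuous s l.
have tE t : 0 <= t <= pi -> m t != 0 -> 0 < t < pi.
  move=> /andP[t0 tp] mt; rewrite !lt_neqAle t0 tp !andbT.
  apply/andP; split; apply: contra_neq mt => e; first by rewrite -e.
  by rewrite e.
split.
  rewrite -[RHS](key (fun a b => complex.Re (null_power s l a b)) cr); apply: eq_Int => t tI; congr (_ * _).
  have [->|mt] := eqVneq (m t) 0; first by rewrite !mul0r.
  by congr (_ * _); rewrite (circle_mean_sph l (G t) F1 s0 (tE t tI mt)).1.
rewrite -[RHS](key (fun a b => complex.Im (null_power s l a b)) ci); apply: eq_Int => t tI; congr (_ * _).
have [->|mt] := eqVneq (m t) 0; first by rewrite !mul0r.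
by congr (_ * _); rewrite (circle_mean_sph l (G t) F1 s0 (tE t tI mt)).2.
Qed.

End SphericalMoments.

(** * The spindle transform as a weighted circle mean *)
Section SpindleForm.
Context {R : realType}.

Lemma asin0 : asin 0 = 0 :> R.
Proof.
by rewrite -[in LHS](@sin0 R) sinK // in_itv /= oppr_le0 divr_ge0 // pi_ge0.
Qed.

Lemma asin_ge0 (y : R) : 0 <= y <= 1 -> 0 <= asin y.
Proof.
move=> /andP[y0 y1]; have y11 : -1 <= y <= 1.
  by rewrite y1 andbT; apply: le_trans y0; rewrite oppr_le0 ler01.
have [aI sy] := asin_def y11; rewrite leNgt; apply/negP => a0.
have : 0 < sin (- asin y).
  apply: sin_gt0_pi; rewrite oppr_gt0 a0 /=.
  move: aI (pi_gt0 R) => /andP[+ _]; move: (pi) (asin y) => P a; lra.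
by rewrite sinN sy oppr_gt0 ltNge y0.
Qed.

Lemma curve_fun0 (p : R -> R) : curve_fun p 0 = p 0.
Proof. by rewrite /curve_fun asin0. Qed.

(** Intermediate value theorem: the curve function starts at [p 0 > 0] and has no zero. *)
Lemma curve_fun_gt0 (p : R -> R) :
  C1_on `[0, 1[ (curve_fun p) -> 0 < p 0 ->
  (forall phi : R, 0 <= phi <= pi / 2 -> p phi != 0) ->
  forall x, 0 <= x < 1 -> 0 < curve_fun p x.
Proof.
move=> /C1_on_within_continuous cg p0 pn x /andP[x0 x1]; rewrite ltNge; apply/negP => gx.
have cx : {within `[0, x], continuous (curve_fun p)}.
  apply: continuous_subspaceW cg => y /=; rewrite !in_itv /= => /andP[-> yx] /=.
  exact: le_lt_trans yx x1.
have [|y] := IVT (v := 0) x0 cx.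
  by rewrite curve_fun0 ge_min gx orbT /= le_max (ltW p0).
rewrite in_itv /= => /andP[y0 yx] /eqP; apply/negP; apply: pn.
have y01 : 0 <= y <= 1 by rewrite y0 (ltW (le_lt_trans yx x1)).
rewrite asin_ge0 //= asin_lepi2 //.
by case/andP: y01 => _ ->; rewrite andbT (le_trans _ y0) // oppr_le0 ler01.
Qed.

Definition spindle_radius (g : R -> R) (r t : R) : R := g (r * `|sin t|).

Definition spindle_factor (g dg : R -> R) (r t : R) : R :=
  spindle_radius g r t * sin t * Num.sqrt
    (spindle_radius g r t ^+ 2 + (dg (r * `|sin t|) * (r * cos t)) ^+ 2).

Lemma within_spindle_continuous (g : R -> R) (r : R) : 0 < r < 1 ->
  {within `[0, 1[, continuous g} -> continuous (spindle_radius g r).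
Proof.
move=> /andP[r0 r1] cg; apply: (continuous_comp_from_within cg); first by cont.
move=> t /=; rewrite in_itv /= mulr_ge0 //= ?(ltW r0) //.
by apply: le_lt_trans r1; rewrite ler_piMr ?(ltW r0) // ler_norml sin_le1 sin_geN1.
Qed.

Lemma spindle_factor_continuous (g dg : R -> R) (r : R) : 0 < r < 1 ->
  {within `[0, 1[, continuous g} -> {within `[0, 1[, continuous dg} ->
  continuous (spindle_factor g dg r).
Proof.
move=> r01 cg cdg.
have c1 := within_spindle_continuous r01 cg.
have c2 : continuous (fun t => dg (r * `|sin t|)) := within_spindle_continuous r01 cdg.
by rewrite /spindle_factor; cont.
Qed.

Lemma polar_rotated (f : 'cV[R]_3 -> R) (a b rho c t : R) :
  polar (rot_act (rotU a *m rotV b) f) rho c t =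
  on_rotation (dilate (fun x y z => f (vec3 x y z)) rho) (a, b, c, t).
Proof.
rewrite /polar /rot_act /on_rotation /dilate; congr f; apply/matrixP => i j.
rewrite -mulmxA !mxE !big_ord_recl big_ord0 !mxE !big_ord_recl !big_ord0 !mxE /=.
rewrite /euler_x /euler_y /euler_z /=.
by case: i => -[|[|[|//]]] i /=; ring.
Qed.

(** For [0 < t < pi] the point [r sin t] is interior to [[0, 1[], so the one-sided
    derivative of the curve function is an ordinary one. *)
Lemma derive1_sym_curve (p dg : R -> R) (r t : R) : 0 < r < 1 -> 0 < t < pi ->
  (forall x : R, `[0, 1[%classic x -> is_derive_within `[0, 1[ (curve_fun p) x (dg x)) ->
  derive1 (sym_curve p r) t = dg (r * sin t) * (r * cos t).
Proof.
move=> /andP[r0 r1] t0 gd; have st := sin_gt0_pi t0.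
have rs0 : 0 < r * sin t by rewrite mulr_gt0.
have rs1 : r * sin t < 1 by apply: le_lt_trans r1; rewrite ler_piMr ?(ltW r0) // sin_le1.
have dgx : is_derive (r * sin t) (1 : R) (curve_fun p) (dg (r * sin t)).
  apply: (@is_derive_within_interior _ `[0, 1[); last first.
    by apply: gd; rewrite /= in_itv /= (ltW rs0).
  have := near_in_itvoo (_ : (r * sin t) \in `]0, 1[); rewrite in_itv /= rs0 rs1 => /(_ isT).
  by apply: filterS => x; rewrite /= !in_itv /= => /andP[/ltW -> ->].
have ds : is_derive t (1 : R) (fun t => r * sin t) (r * cos t).
  by have := derM (derC t r) (is_derive_sin t); move/is_derive_eq; apply; rewrite mul0r add0r.
by have [_] := (@is_derive1_comp R (curve_fun p) (fun t : R => r * sin t) t _ _ dgx ds); rewrite -derive1E.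
Qed.

(** At [t = 0] and [t = pi], where [derive1_sym_curve] does not apply, both integrands
    vanish with [sin t]. *)
Lemma spindleE (w : R -> R -> R) (p dg : R -> R) (f : 'cV[R]_3 -> R) (r a b : R) :
  0 < r < 1 ->
  (forall x : R, `[0, 1[%classic x -> is_derive_within `[0, 1[ (curve_fun p) x (dg x)) ->
  spindle w p f r a b =
  Int 0 (2 * pi) (fun c => Int 0 pi (fun t => w r t * (spindle_factor (curve_fun p) dg r t *
    on_rotation (dilate (fun x y z => f (vec3 x y z)) (spindle_radius (curve_fun p) r t)) (a, b, c, t)))).
Proof.
move=> r01 gd; apply: eq_Int => c _; apply: eq_Int => t /andP[t0 tp].
have sE : `|sin t| = sin t by rewrite ger0_norm // sin_ge0_pi // t0.
have gE : sym_curve p r t = spindle_radius (curve_fun p) r t by rewrite /spindle_radius sE.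
rewrite polar_rotated gE /spindle_factor !mulrA; congr (_ * _).
have [s0|s0] := eqVneq (sin t) 0; first by rewrite s0 !mulr0 !mul0r.
have tI : 0 < t < pi.
  rewrite !lt_neqAle t0 tp !andbT.
  apply/andP; split; apply: contra_neq s0 => e; first by rewrite -e sin0.
  by rewrite e sinpi.
by rewrite (derive1_sym_curve r01 tI gd) sE mulrA.
Qed.

End SpindleForm.

(** * Harmonic coefficients *)
Section HarmonicCoefficients.
Context {R : realType}.
Notation C := (R[i]).
Notation rc := (real_complex R).

(** The dependence of a spherical harmonic on the colatitude, up to a constant factor. *)
Definition zonal_factor l n (b : R) : R := sin b ^+ n * (derivn n (@legendre R l)).[cos b].

Lemma zonal_factor_continuous l n : continuous (zonal_factor l n).
Proof.
apply: contM; first by cont.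
by apply: (cont_comp (f := cos) (@continuous_cos R)) => x; exact: continuous_horner.
Qed.

Lemma sph_harm_zonal l m : exists k : R, forall a b : R, 0 <= b <= pi ->
  sph_harm l m a b = rc (k * zonal_factor l (absz m) b) * cis (m%:~R * a).
Proof.
have sE b : 0 <= b <= pi -> Num.sqrt (1 - cos b ^+ 2) = sin b.
  by move=> bI; rewrite -sin2cos2 sqrtr_sqr ger0_norm // sin_ge0_pi.
case: m => k.
  exists ((-1) ^ Posz k * Num.sqrt (((2 * l + 1)%:R * (absz (l%:Z - Posz k))`!%:R)
                 / (4 * pi * (absz (l%:Z + Posz k))`!%:R)) * (-1) ^+ k) => a b bI.
  rewrite /sph_harm /assoc_legendre /assoc_legendre_nat sE // /zonal_factor absz_nat.
  by rewrite !mulrA.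
exists ((-1) ^ Negz k * Num.sqrt (((2 * l + 1)%:R * (absz (l%:Z - Negz k))`!%:R)
    / (4 * pi * (absz (l%:Z + Negz k))`!%:R)) *
    ((-1) ^+ k.+1 * ((l - k.+1)`!%:R / (l + k.+1)`!%:R)) * (-1) ^+ k.+1) => a b bI.
rewrite /sph_harm /assoc_legendre /assoc_legendre_nat sE // /zonal_factor.
by rewrite !mulrA.
Qed.

Lemma cis_intr (m : int) : exists e : R, forall a : R, cis (m%:~R * a) =
   Complex (cos ((absz m)%:R * a)) (e * sin ((absz m)%:R * a)).
Proof.
case: m => k; [exists 1|exists (-1)] => a.
  by rewrite /cis mul1r.
by rewrite /cis NegzE mulrNz mulNr cosN sinN mulN1r abszN absz_nat.
Qed.

Lemma harm_coef_sph l m : exists k1 k2 : R, forall (f : 'cV[R]_3 -> R) (rho : R),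
  let P := on_sphere (dilate (fun x y z => f (vec3 x y z)) rho) in
  continuous (fun z : R * R => P z.1 z.2) ->
  harm_coef f l m rho = Complex
    (k1 * sph (fun a b => P a b * (zonal_factor l (absz m) b * cos ((absz m)%:R * a))))
    (k2 * sph (fun a b => P a b * (zonal_factor l (absz m) b * sin ((absz m)%:R * a)))).
Proof.
have [k kE] := sph_harm_zonal l m; have [e eE] := cis_intr m.
exists k, (- (k * e)) => f rho P cP.
have cz : continuous (zonal_factor l (absz m)) by exact: zonal_factor_continuous.
have cP' (a : R) : continuous (P a) by exact: (cont_section (H := P)).
have Z (k0 : R) (u : R -> R) : continuous u ->
    k0 * sph (fun a b => P a b * (zonal_factor l (absz m) b * u a)) =
    Int 0 (2 * pi) (fun a => Int 0 pi (fun b =>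
      k0 * (sin b * (P a b * (zonal_factor l (absz m) b * u a))))).
  move=> cu; rewrite /sph -IntZ; last by apply: Int_param_cont; cont.
  apply: eq_Int => a _; rewrite -IntZ //.
  by have := cP' a; move=> cPa; cont.
have polE a b : polar f rho a b = P a b by rewrite /polar /P /on_sphere /dilate !mulrA.
rewrite /harm_coef /sphere_integral; congr Complex.
  rewrite Z; last by cont.
  apply: eq_Int => a _; apply: eq_Int => b bI.
  rewrite polE (kE a b bI) eE.
  by rewrite /=; ring.
rewrite Z; last by cont.
apply: eq_Int => a _; apply: eq_Int => b bI.
rewrite polE (kE a b bI) eE.
by rewrite /=; ring.
Qed.

Lemma sphB (f g : R -> R -> R) :
  continuous (fun z : R * R => f z.1 z.2) -> continuous (fun z : R * R => g z.1 z.2) ->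
  sph (fun a b => f a b - g a b) = sph f - sph g.
Proof.
move=> cf cg.
have cf' (a : R) : continuous (f a) by exact: (cont_section (H := f)).
have cg' (a : R) : continuous (g a) by exact: (cont_section (H := g)).
rewrite /sph -IntB; [|by apply: Int_param_cont; cont|by apply: Int_param_cont; cont].
apply: eq_Int => a _.
have := cf' a; have := cg' a => cga cfa.
by rewrite -IntB; [apply: eq_Int => b _; ring|cont|cont].
Qed.

End HarmonicCoefficients.

(** * The uniqueness theorem *)
Section Supports.
Context {R : realType}.

Lemma enorm_continuous : continuous (@enorm R).
Proof.
have c1 (i : 'I_3) : continuous (fun x : 'cV[R]_3 => x i 0 ^+ 2).
  by apply: contX => x; exact: coord_continuous.
rewrite (_ : @enorm R = fun x => Num.sqrt (x ord0 0 ^+ 2 + (x (lift ord0 ord0) 0 ^+ 2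
   + x (lift ord0 (lift ord0 ord0)) 0 ^+ 2))).
  by apply: cont_sqrt; apply: contD; [exact: c1|apply: contD; exact: c1].
by apply/funext => x; rewrite /enorm !big_ord_recl big_ord0 addr0.
Qed.

Lemma enorm_polar (rho a b : R) : 0 <= rho ->
  enorm (vec3 (rho * (sin b * cos a)) (rho * (sin b * sin a)) (rho * cos b)) = rho.
Proof.
move=> rho0; rewrite /enorm !big_ord_recl big_ord0 !mxE /= addr0.
rewrite (_ : _ + _ = rho ^+ 2); first by rewrite sqrtr_sqr ger0_norm.
rewrite [_ + _](_ : _ = rho ^+ 2 * (sin b ^+ 2 * (cos a ^+ 2 + sin a ^+ 2) + cos b ^+ 2)); last by ring.
by rewrite cos2Dsin2 mulr1 addrC cos2Dsin2 mulr1.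
Qed.

Definition radial_support (f : 'cV[R]_3 -> R) : set R := @enorm R @` Defs.support f.

Lemma radial_support_closed f : compact (Defs.support f) -> closed (radial_support f).
Proof.
move=> cf; apply: compact_closed; first exact: Rhausdorff.
by apply: continuous_compact cf; exact: continuous_subspaceT enorm_continuous.
Qed.

Lemma radial_supportP f (rho a b : R) : 0 <= rho ->
  on_sphere (dilate (fun x y z => f (vec3 x y z)) rho) a b != 0 -> radial_support f rho.
Proof.
move=> rho0 fn; exists (vec3 (rho * (sin b * cos a)) (rho * (sin b * sin a)) (rho * cos b)).
  exact: subset_closure.
exact: enorm_polar.
Qed.

Lemma spindle_zero (w m G : R -> R) (F1 F2 : R -> R -> R -> R) (a b : R) :
  (@lebesgue_measure R).-integrable `[0, pi] (EFin \o w) -> continuous m -> continuous G ->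
  C1_along_curves F1 -> C1_along_curves F2 ->
  let S F := Int 0 (2 * pi) (fun c => Int 0 pi (fun t =>
      w t * (m t * on_rotation (dilate F (G t)) (a, b, c, t)))) in
  S F1 = S F2 -> S (fun x y z => F1 x y z - F2 x y z) = 0.
Proof.
move=> iw cm cG C1 C2 S S12.
have cS F : C1_along_curves F ->
    continuous (fun z : R * R => m z.2 * on_rotation (dilate F (G z.2)) (a, b, z.1, z.2)).
  move=> CF; apply: contM; first by cont.
  by apply: (cont_comp (f := fun z : R * R => (G z.2, (a, b, z.1, z.2))) _
    (dilated_rotation_continuous CF)); cont.
rewrite (_ : S _ = S F1 - S F2); first by rewrite S12 subrr.
have c1 := cS _ C1; have c2 := cS _ C2.
rewrite /S -IntB; [|exact: (Int_weight_param_cont iw c1)|exact: (Int_weight_param_cont iw c2)].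
apply: eq_Int => c _.
have c1' := cont_section (H := fun c t => m t * on_rotation (dilate F1 (G t)) (a, b, c, t)) (t := c) c1.
have c2' := cont_section (H := fun c t => m t * on_rotation (dilate F2 (G t)) (a, b, c, t)) (t := c) c2.
rewrite -(IntwB iw c1' c2').
by apply: eq_Int => t _; rewrite -mulrBr.
Qed.

End Supports.

Theorem theorem2 (R : realType) (p : R -> R) (e1 e2 e3 : R) (w : R -> R -> R)
    (f1 f2 : 'cV[R]_3 -> R)
    (p_C1 : C1_on `[0, pi / 2] p)
    (p_neq0 : forall phi : R, 0 <= phi <= pi / 2 -> p phi != 0)
    (g_C1 : C1_on `[0, 1[ (curve_fun p))
    (e1_gt0 : 0 < e1) (e12 : e1 < e2) (e23 : e2 < e3)
    (p0_gap : e1 < p 0 < e2)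
    (w_integrable : forall r : R, 0 <= r <= 1 ->
       (@lebesgue_measure R).-integrable `[0, pi] (fun phi => (w r phi)%:E))
    (w_repr : represented_by_W (radius_set p e1 e2 e3) w)
    (W_C1 : W_C1_in_r (radius_set p e1 e2 e3) w)
    (W_diag : forall rho : R, radius_set p e1 e2 e3 rho -> weight_W w rho rho != 0)
    (f1_Cc : Cc_smooth (hollow_ball 0 e1 `|` hollow_ball e2 e3) f1)
    (f2_Cc : Cc_smooth (hollow_ball 0 e1 `|` hollow_ball e2 e3) f2)
    (S_eq : forall r alpha beta : R,
       0 <= r <= 1 -> 0 <= alpha <= 2 * pi -> 0 <= beta <= pi ->
       spindle w p f1 r alpha beta = spindle w p f2 r alpha beta) :
  forall rho : R, (exists2 x : R, 0 <= x < 1 & rho = curve_fun p x) ->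
  forall (l : nat) (m : int), ~~ odd l -> (absz m <= l)%N ->
    harm_coef f1 l m rho = harm_coef f2 l m rho.
Proof.
move=> rho [x x01 ->{rho}] l m el ml.
have [sm1 cpt1 sub1] := f1_Cc; have [sm2 cpt2 sub2] := f2_Cc.
have C1 := smooth_C1 sm1; have C2 := smooth_C1 sm2.
pose F1 (x y z : R) := f1 (vec3 x y z); pose F2 (x y z : R) := f2 (vec3 x y z).
pose F x y z := F1 x y z - F2 x y z.
have CF : C1_along_curves F.
  have := C1D C1 (C1M (C1_cst (-1)) C2); congr C1_along_curves.
  by apply/funext => u; apply/funext => v; apply/funext => t; rewrite mulN1r.
have cg := C1_on_within_continuous g_C1.
have [dg [gd cdg]] := g_C1.
have p0 : 0 < p 0 by case/andP: p0_gap => h _; exact: lt_trans h.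
have gpos := curve_fun_gt0 g_C1 p0 p_neq0.
(* [P_l] is a polynomial in the square of the variable: the equation depends on [t]
   through [sin t] and [cos t ^ 2] alone. *)
have [Q Q0 QE] := even_legendre (R := R) el.
(* [V] contains the radii of the two shells; it misses [p 0], and [g x] is in [V] only if
   [x] is in [A].  [Z] is the closed set of radii met by the supports. *)
pose V : set R := `]e2, e3[ `|` `]0, e1[.
pose Z := radial_support f1 `|` radial_support f2.
have oV : open V by apply: openU; exact: interval_open.
have gV : ~ V (curve_fun p 0).
  rewrite curve_fun0 /V /=; case/andP: p0_gap => h1 h2.
  by case; rewrite /= in_itv /= => /andP[h3 h4]; [move: (lt_trans h3 h2)|move: (lt_trans h1 h4)]; rewrite ltxx.
have VA y : 0 <= y < 1 -> V (curve_fun p y) -> radius_set p e1 e2 e3 y.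
  move=> yI [] /=; rewrite in_itv /= => /andP[h3 h4]; split => //.
    by right; rewrite (ltW h3) (ltW h4).
  by left; rewrite (ltW h3) (ltW h4).
have cZ : closed Z.
  by apply: closedU; [exact: (radial_support_closed cpt1)|exact: (radial_support_closed cpt2)].
have ZV : Z `<=` V.
  move=> _ [] [v sv <-]; [have := sub1 v sv|have := sub2 v sv];
    by case; rewrite /hollow_ball /= => h; [right|left]; rewrite /= in_itv.
have pos2 : (2 * pi : R) != 0 by rewrite mulf_neq0 ?pnatr_eq0 // gt_eqF // pi_gt0.
have vanish (q : R -> R -> R) : continuous (fun z : R * R => q z.1 z.2) ->
    let c rho := sph (fun a b => on_sphere (dilate F rho) a b * q a b) in
    (forall r, 0 < r < 1 -> Int 0 pi (fun t => w r t * (spindle_factor (curve_fun p) dg r t *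
      (2 * pi * (@legendre R l).[cos t] * c (spindle_radius (curve_fun p) r t)))) = 0) ->
    c (curve_fun p x) = 0.
  move=> cq c ceq.
  apply: (@radial_uniqueness R (radius_set p e1 e2 e3) V Z w (curve_fun p) dg c ((2 * pi) *: Q)) => //.
  - by move=> y [/andP[]].
  - by rewrite hornerZ mulf_neq0.
  - exact: sph_moment_continuous.
  - move=> rho rho0; apply: contraNP => /not_orP[n1 n2].
    rewrite /c /sph (eq_Int (g := fun=> 0)) ?Int0 // => a _.
    rewrite (eq_Int (g := fun=> 0)) ?Int0 // => b _.
    have z1 : on_sphere (dilate F1 rho) a b = 0.
      by apply/eqP; apply: contra_notT n1; exact: radial_supportP.
    have z2 : on_sphere (dilate F2 rho) a b = 0.
      by apply/eqP; apply: contra_notT n2; exact: radial_supportP.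
    by rewrite [on_sphere _ _ _](_ : _ = on_sphere (dilate F1 rho) a b - on_sphere (dilate F2 rho) a b) // z1 z2 subrr mul0r mulr0.
  - move=> r r01; rewrite -[RHS](ceq r r01); apply: eq_Int => t _.
    by rewrite hornerZ -QE.
have moment s : s != 0 -> sphC (fun a b => real_complex R (on_sphere (dilate F (curve_fun p x)) a b) *
     dotC (null1 s) (null2 s) 1 (sin b * cos a) (sin b * sin a) (cos b) ^+ l) = 0.
  move=> s0; rewrite -/(null_power s l) sphC_rcM.
  have eqn r (r01 : 0 < r < 1) : let c q rho :=
        sph (fun a b => on_sphere (dilate F rho) a b * q (null_power s l a b)) in
      Int 0 pi (fun t => w r t * (spindle_factor (curve_fun p) dg r t *
        (2 * pi * (@legendre R l).[cos t] * c (@complex.Re R) (spindle_radius (curve_fun p) r t)))) = 0 /\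
      Int 0 pi (fun t => w r t * (spindle_factor (curve_fun p) dg r t *
        (2 * pi * (@legendre R l).[cos t] * c (@complex.Im R) (spindle_radius (curve_fun p) r t)))) = 0.
    have r01' : 0 <= r <= 1 by case/andP: r01 => /ltW -> /ltW ->.
    have iw := w_integrable r r01'.
    have cm := spindle_factor_continuous r01 cg cdg.
    have cG := within_spindle_continuous r01 cg.
    have m0 : spindle_factor (curve_fun p) dg r 0 = 0.
      by rewrite /spindle_factor sin0 mulr0 mul0r.
    have mpi : spindle_factor (curve_fun p) dg r pi = 0.
      by rewrite /spindle_factor sinpi mulr0 mul0r.
    apply: (@null_moment_equation R (w r) _ _ F s l iw cm cG m0 mpi CF s0).
    move=> a b aI bI; apply: (spindle_zero iw cm cG C1 C2).
    by have := S_eq r a b r01' aI bI; rewrite !(spindleE w _ a b r01 gd).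
  have [cr ci] := null_power_continuous s l.
  have h1 := vanish (fun a b => complex.Re (null_power s l a b)) cr (fun r r01 => (eqn r r01).1).
  have h2 := vanish (fun a b => complex.Im (null_power s l a b)) ci (fun r r01 => (eqn r r01).2).
  by rewrite /= in h1 h2; rewrite h1 h2.
have cs (H : R -> R -> R -> R) : C1_along_curves H ->
    continuous (fun z : R * R => on_sphere (dilate H (curve_fun p x)) z.1 z.2).
  move=> CH; apply: (cont_comp (f := fun z : R * R => (curve_fun p x, z.1, z.2)) _
    (dilated_sphere_continuous CH)); cont.
have [hc hs] := legendre_projection_vanishes (cs F CF) ml moment.
have [k1 [k2 kE]] := harm_coef_sph (R := R) l m.
rewrite (kE f1 _ (cs F1 C1)) (kE f2 _ (cs F2 C2)).
have cz : continuous (zonal_factor (R := R) l (absz m)) by exact: zonal_factor_continuous.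
have eqs (u : R -> R) : continuous u ->
    sph (fun a b => on_sphere (dilate F (curve_fun p x)) a b * (zonal_factor l (absz m) b * u a)) = 0 ->
    sph (fun a b => on_sphere (dilate F1 (curve_fun p x)) a b * (zonal_factor l (absz m) b * u a)) =
    sph (fun a b => on_sphere (dilate F2 (curve_fun p x)) a b * (zonal_factor l (absz m) b * u a)).
  move=> cu h0; apply/eqP; rewrite -subr_eq0 -sphB.
  - rewrite -[X in _ == X]h0; apply/eqP; congr sph; apply/funext => a; apply/funext => b.
    by rewrite -mulrBl.
  - by have := cs F1 C1 => cs1; cont.
  - by have := cs F2 C2 => cs2; cont.
have ccos : continuous (fun a : R => cos ((absz m)%:R * a)) by cont.
have csin : continuous (fun a : R => sin ((absz m)%:R * a)) by cont.
by rewrite (eqs _ ccos hc) (eqs _ csin hs).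
Qed.
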